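(* Let $\mathcal{A}^\infty=(\{f_i\},\{a_i\},u)$ be a non-negative approximation system for a sequence $\{g_i\}_{i=0}^\infty$, where $f_i$ has domain $U\times V_i$, and let $g:=g_0$. Suppose that for some $R>0$ we have $U=B(u,R)$ and, for all $i\ge1$, $B(a_i,\widetilde R_i)\subset V_{i-1}$, where $\widetilde R_i=\lim_{r\uparrow R}\,g_i(u+r)-a_i$. Then $\mathcal{A}^\infty$ is also a proper approximation system for $\{g_i\}_{i=0}^\infty$, and its $n$-th order approximations $g^{[n]}$ converge uniformly to $g$ on $U$ as $n\to\infty$.
   Context: An approximation system (AS) of infinite order is a triple $\mathcal{A}^\infty=(\{f_i\}_{i=0}^{\infty},\{a_i\}_{i=0}^{\infty},u)$ consisting of: holomorphic functions $f_i\colon U\times V_i\to\mathbb{C}$ of two complex variables, where $U\subset\mathbb{C}$ is open, connected and simply connected, $V_i\subset\mathbb{C}$ is open, and $f_i(x,\cdot)$ is non-constant for every $x\in U$; complex constants $a_i$ with $a_{i+1}\in V_i$ for all $i\ge0$; and a base point $u\in U$. $\mathcal{A}^\infty$ is an AS for the sequence $\{g_i\}_{i=0}^\infty$ if the $g_i$ are holomorphic functions on $U$ with $g_{i+1}(U)\subset V_i$, $g_i(u)=a_i$, and $g_i'(x)=f_i(x,g_{i+1}(x))$ for $x\in U$, for all $i\ge0$. For an integer $n\ge0$ define recursively $g_n^{[n]}(x):=a_n$ and $g_i^{[n]}(x):=a_i+\int_u^x f_i(t,g_{i+1}^{[n]}(t))\,dt$ for $x\in U$, $i=n-1,\dots,0$.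 $\mathcal{A}^\infty$ is proper if for every $n\ge0$ the inclusions $g_{i+1}^{[n]}(U)\subset V_i$ ($i<n$) hold at each step of this construction; then $g^{[n]}:=g_0^{[n]}$ is the $n$-th order approximation. $\mathcal{A}^\infty$ is non-negative if $a_i\ge0$ and $(D_1^kD_2^lf_i)(u,a_{i+1})\ge0$ for all $i,k,l\ge0$, where $D_1,D_2$ denote the derivatives with respect to the first and second argument. $B(c,\rho)$ is the open disk with center $c$ and radius $\rho$, with $B(c,0)=\emptyset$ and $B(c,\infty)=\mathbb{C}$. For real $0\le r<R$ the values $g_i(u+r)$ are real and nondecreasing in $r$ in this setting, so the limit $\widetilde R_i$ exists in $[0,\infty]$.
   Formalization: Uniform convergence on U fails for f_i(x,y)=y, a_i=i!, U=B(0,1), V_i=C, g=1/(1-x); proved instead: uniform convergence on every B(u,r) with 0<r<R, and on all of U whenever the limit R̃_0 is finite. R is taken to be a finite positive real. *)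

(* Defs.v *)
From Stdlib Require Import Reals ClassicalEpsilon.
From Coquelicot Require Import Coquelicot.

Open Scope R_scope.

(** Functions with a domain [D] are total Rocq functions [C -> C]; only their
    values on [D] are ever constrained or used.  All domains are open, so the
    derivatives at points of [D] do not depend on the values outside. *)

Definition subset (A B : C -> Prop) : Prop := forall z, A z -> B z.

(** The case [rho = p_infty] gives the whole plane, [rho = 0] the empty set. *)
Definition disk (c : C) (rho : Rbar) (z : C) : Prop :=
  Rbar_lt (Finite (Cmod (z - c)%C)) rho.

Definition connected_set (U : C -> Prop) : Prop :=
  forall A B : C -> Prop, open A -> open B ->
    (forall z, U z -> A z \/ B z) ->
    (forall z, U z -> ~ (A z /\ B z)) ->
    (forall z, U z -> A z) \/ (forall z, U z -> B z).

(** Paths and homotopies are given on the whole of [R] resp. [R * R]: continuous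
    maps on [0,1] and [0,1]^2 extend continuously by clamping the arguments. *)
Definition loop_in (U : C -> Prop) (gamma : R -> C) : Prop :=
  (forall t : R, continuous gamma t) /\
  (forall t, 0 <= t <= 1 -> U (gamma t)) /\
  gamma 0 = gamma 1.

Definition null_homotopic_in (U : C -> Prop) (gamma : R -> C) : Prop :=
  exists (H : R * R -> C) (c : C),
    (forall p : R * R, continuous H p) /\
    (forall s t, 0 <= s <= 1 -> 0 <= t <= 1 -> U (H (s, t))) /\
    (forall s, 0 <= s <= 1 -> H (s, 0) = H (s, 1)) /\
    (forall t, 0 <= t <= 1 -> H (0, t) = gamma t) /\
    (forall t, 0 <= t <= 1 -> H (1, t) = c).

Definition simply_connected (U : C -> Prop) : Prop :=
  connected_set U /\
  forall gamma, loop_in U gamma -> null_homotopic_in U gamma.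

Definition holomorphic_on (D : C -> Prop) (g : C -> C) : Prop :=
  forall z : C, D z -> @ex_derive C_AbsRing C_NormedModule g z.

(** Joint complex differentiability: the differential is [C]-linear. *)
Definition holomorphic2_on (D E : C -> Prop) (f : C -> C -> C) : Prop :=
  forall x y : C, D x -> E y ->
    @ex_filterdiff C_AbsRing
      (prod_NormedModule C_AbsRing C_NormedModule C_NormedModule)
      C_NormedModule
      (fun p => f (fst p) (snd p)) (locally (x, y)).

Fixpoint C_derive_n (n : nat) (h : C -> C) : C -> C :=
  match n with
  | O => h
  | S m => C_derive (C_derive_n m h)
  end.

Definition D1D2 (k l : nat) (f : C -> C -> C) (x y : C) : C :=
  C_derive_n k (fun x' => C_derive_n l (f x') y) x.

Definition C_nonneg (z : C) : Prop := Im z = 0 /\ 0 <= Re z.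

(** [C^1] path from [u] to [x] in [U], parametrised by [0,1], with velocity
    [dgamma]. *)
Definition C1_path_in (U : C -> Prop) (u x : C) (gamma dgamma : R -> C) : Prop :=
  gamma 0 = u /\ gamma 1 = x /\
  forall t, 0 <= t <= 1 ->
    U (gamma t) /\
    @is_derive R_AbsRing C_R_NormedModule gamma t (dgamma t) /\
    continuous dgamma t.

Definition is_path_integral (U : C -> Prop) (h : C -> C) (u x v : C) : Prop :=
  exists gamma dgamma : R -> C,
    C1_path_in U u x gamma dgamma /\
    @is_RInt C_R_NormedModule (fun t => (h (gamma t) * dgamma t)%C) 0 1 v.

(** The integral of [h] from [u] to [x] along some path in [U].  By Cauchy's
    theorem it does not depend on the path when [h] is holomorphic on the simply
    connected open set [U]. *)
Definition path_integral (U : C -> Prop) (h : C -> C) (u x : C) : C :=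
  epsilon (inhabits (RtoC 0)) (is_path_integral U h u x).

Record approx_system : Type := ApproxSystem {
  as_f : nat -> C -> C -> C;
  as_a : nat -> C;
  as_u : C;
  as_U : C -> Prop;
  as_V : nat -> C -> Prop;
  as_U_open : open as_U;
  as_U_simply_connected : simply_connected as_U;
  as_V_open : forall i, open (as_V i);
  as_f_holo : forall i, holomorphic2_on as_U (as_V i) (as_f i);
  as_f_nonconst : forall i x, as_U x ->
    exists y1 y2, as_V i y1 /\ as_V i y2 /\ as_f i x y1 <> as_f i x y2;
  as_a_in : forall i, as_V i (as_a (S i));
  as_u_in : as_U as_u
}.

Definition is_AS_for (A : approx_system) (g : nat -> C -> C) : Prop :=
  forall i,
    holomorphic_on (as_U A) (g i) /\
    (forall x, as_U A x -> as_V A i (g (S i) x)) /\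
    g i (as_u A) = as_a A i /\
    (forall x, as_U A x ->
       @is_derive C_AbsRing C_NormedModule (g i) x (as_f A i x (g (S i) x))).

(** [approx_aux A m i] is the function [g_i^[i + m]]: the recursion runs
    downwards in [i] with the order [n = i + m] fixed. *)
Fixpoint approx_aux (A : approx_system) (m i : nat) (x : C) : C :=
  match m with
  | O => as_a A i
  | S m' =>
      (as_a A i +
       path_integral (as_U A) (fun t => as_f A i t (approx_aux A m' (S i) t))
         (as_u A) x)%C
  end.

(** [g_i^[n]], for [i <= n]. *)
Definition approx_at (A : approx_system) (n i : nat) : C -> C :=
  approx_aux A (n - i) i.

Definition approximation (A : approx_system) (n : nat) : C -> C :=
  approx_at A n 0.

Definition proper (A : approx_system) : Prop :=
  forall n i, (i < n)%nat ->
    forall x, as_U A x -> as_V A i (approx_at A n (S i) x).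

Definition non_negative (A : approx_system) : Prop :=
  forall i,
    C_nonneg (as_a A i) /\
    forall k l, C_nonneg (D1D2 k l (as_f A i) (as_u A) (as_a A (S i))).

(** The limit, in the extended reals, of [g_i (u + r) - a_i] as the real number
    [r] increases to [rho].  For a non-negative system these values are real and
    nondecreasing, so the limit exists and taking real parts loses nothing. *)
Definition R_tilde (A : approx_system) (g : nat -> C -> C) (rho : R) (i : nat)
  : Rbar :=
  epsilon (inhabits p_infty)
    (fun l : Rbar =>
       filterlim (fun r : R => Re (g i (as_u A + RtoC r)%C - as_a A i)%C)
         (at_left rho) (Rbar_locally l)).

Definition converges_uniformly_on (D : C -> Prop) (F : nat -> C -> C)
  (g : C -> C) : Prop :=
  forall eps : R, 0 < eps ->
    exists N : nat, forall n : nat, (N <= n)%nat ->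
      forall x, D x -> Cmod (F n x - g x)%C < eps.

(* Main.v *)
Require Import Defs.
From Stdlib Require Import Reals Lra Lia Psatz Arith ClassicalEpsilon Classical.
From Coquelicot Require Import Coquelicot.
Open Scope R_scope.

(** Expand everything in powers of [x - u].  By non-negativity and the equations
    [g_i' = f_i (x, g_(i+1))], induction on the order shows that all the Taylor
    coefficients of the [g_i] at [u] are real and nonnegative: those of
    [f (x, phi x)] are polynomials with nonnegative coefficients in the Taylor
    coefficients of [f] and [phi].  For the same reason the coefficients of
    [g_i^[n]] lie between [0] and those of [g_i], with equality up to order
    [n - i].  Hence [|g_i^[n] (x) - a_i| <= g_i (u + |x - u|) - a_i], which is
    strictly below [R_tilde i] unless [g_i] is constant, and this gives
    properness; and [|g^[n] (x) - g (x)|] is at most the tail of order [n] of the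
    series of [g] at [u + |x - u|], which gives uniform convergence.

    The required complex analysis rests on Goursat's lemma for the image of a
    rectangle under a map [gamma (s, t)].  Applied to the radial contraction of a
    circle to an interior point, it yields Cauchy's formula without any
    regularity assumption on the derivative. *)

(** * Complex differentiability and integrals along real intervals *)

(** The Taylor coefficients of f (x, phi x) are never written down. They are compared through jets,
    polynomial approximations up to O(|z|^N): jets can be added, multiplied and substituted into a
    polynomial, they do not see errors of order N, and their coefficients are unique, so an
    inequality between jets is one between Taylor coefficients. For [f] itself an error K m^N for
    |x|, |y| <= m is enough, because phi (u + z) - a is O(|z|).

    The integral defining g_i^[n] is under control only when its integrand is holomorphic, hence
    only after g_(i+1)^[n] is known to map U into V_i. Properness can therefore not be postponed:
    holomorphy, domination and inclusion go through a single induction on the number of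
    integrations.

    As a disk of radius 0 is empty, a constant g_(i+1) is a separate case, settled by a_(i+1) lying
    in V_i. *)

Definition cderiv (f : C -> C) (z d : C) : Prop :=
  forall eps, 0 < eps -> exists delta, 0 < delta /\
    forall w, Cmod (w - z) < delta ->
      Cmod (f w - f z - d * (w - z)) <= eps * Cmod (w - z).

Definition rderiv (g : R -> C) (t : R) (v : C) : Prop :=
  forall eps, 0 < eps -> exists delta, 0 < delta /\
    forall t', Rabs (t' - t) < delta ->
      Cmod (g t' - g t - RtoC (t' - t) * v) <= eps * Rabs (t' - t).

Lemma locally_C_intro (z : C) (P : C -> Prop) (d : R) :
  0 < d -> (forall w, Cmod (w - z) < d -> P w) -> @locally C_UniformSpace z P.
Proof.
  intros Hd H. apply (@locally_le_locally_norm C_AbsRing C_NormedModule).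
  exists (mkposreal d Hd). intros y Hy. apply H. exact Hy.
Qed.

Lemma locally_C_elim (z : C) (P : C -> Prop) :
  @locally C_UniformSpace z P ->
  exists d, 0 < d /\ forall w, Cmod (w - z) < d -> P w.
Proof.
  intros H. apply (@locally_norm_le_locally C_AbsRing C_NormedModule) in H.
  destruct H as [d Hd]. exists d. split. apply cond_pos. intros w Hw. apply Hd. exact Hw.
Qed.

Lemma locally_AbsRing_C (z : C) (P : C -> Prop) :
  @locally (AbsRing_UniformSpace C_AbsRing) z P <-> @locally C_UniformSpace z P.
Proof. split; intro H; now apply locally_C. Qed.

Lemma cderiv_is_derive (f : C -> C) (z d : C) :
  cderiv f z d <-> @is_derive C_AbsRing C_NormedModule f z d.
Proof.
  split.
  - intros H. split. apply is_linear_scal_l.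
    intros x Hx.
    apply (is_filter_lim_locally_unique (V := AbsRing_NormedModule C_AbsRing)) in Hx.
    subst x. intros eps. apply locally_AbsRing_C.
    destruct (H eps (cond_pos eps)) as [del [Hd H1]].
    apply (locally_C_intro _ _ del Hd). intros w Hw.
    generalize (H1 w Hw). rewrite (Cmult_comm d). intros H2. exact H2.
  - intros [_ H] eps He.
    specialize (H z (fun P H => H) (mkposreal eps He)).
    apply locally_AbsRing_C in H.
    destruct (locally_C_elim _ _ H) as [del [Hd H1]]. exists del. split; [exact Hd|].
    intros w Hw. generalize (H1 w Hw). rewrite (Cmult_comm d). intros H2. exact H2.
Qed.

Lemma norm_C_R (x : C) : @norm _ C_R_NormedModule x = Cmod x.
Proof.
  unfold norm; simpl. unfold prod_norm, Cmod, norm; simpl. unfold abs; simpl.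
  unfold pow. rewrite !Rmult_1_r, <- !Rabs_mult.
  rewrite !Rabs_pos_eq; try apply Rle_0_sqr. reflexivity.
Qed.

Lemma scal_C_R (x : R) (y : C) : @scal _ C_R_NormedModule x y = (RtoC x * y)%C.
Proof. apply scal_R_Cmult. Qed.

Lemma rderiv_is_derive (g : R -> C) (t : R) (v : C) :
  rderiv g t v <-> @is_derive R_AbsRing C_R_NormedModule g t v.
Proof.
  split.
  - intros H. split. apply is_linear_scal_l.
    intros x Hx.
    apply (is_filter_lim_locally_unique (V := R_NormedModule)) in Hx.
    subst x. intros eps.
    destruct (H eps (cond_pos eps)) as [del [Hd H1]].
    exists (mkposreal del Hd). intros w Hw.
    rewrite norm_C_R. rewrite scal_C_R. exact (H1 w Hw).
  - intros [_ H] eps He.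
    specialize (H t (fun P H => H) (mkposreal eps He)).
    destruct H as [del H1]. exists del. split; [apply cond_pos|].
    intros w Hw. generalize (H1 w Hw).
    rewrite norm_C_R. rewrite scal_C_R. intros H2; exact H2.
Qed.

Lemma continuous_R_C (g : R -> C) (t : R) :
  (forall eps, 0 < eps -> exists delta, 0 < delta /\
     forall t', Rabs (t' - t) < delta -> Cmod (g t' - g t) < eps)
  <-> @continuous R_UniformSpace C_UniformSpace g t.
Proof.
  split.
  - intros H P HP. destruct (locally_C_elim _ _ HP) as [e [He H1]].
    destruct (H e He) as [d [Hd H2]]. exists (mkposreal d Hd). intros y Hy.
    apply H1, H2, Hy.
  - intros H eps He.
    destruct (H (fun w => Cmod (w - g t) < eps)) as [d Hd].
    { apply (locally_C_intro _ _ eps He). auto. }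
    exists d. split. apply cond_pos. intros t' Ht. apply Hd, Ht.
Qed.

Lemma Cmod_triangle_minus (x y : C) : Cmod (x - y) <= Cmod x + Cmod y.
Proof. unfold Cminus. rewrite <- (Cmod_opp y). apply Cmod_triangle. Qed.

Lemma Cmod_sym (x y : C) : Cmod (x - y) = Cmod (y - x).
Proof. rewrite <- Cmod_opp. f_equal. ring. Qed.

Lemma cderiv_lip (f : C -> C) (z d : C) : cderiv f z d ->
  exists delta, 0 < delta /\ forall w, Cmod (w - z) < delta ->
    Cmod (f w - f z) <= (Cmod d + 1) * Cmod (w - z).
Proof.
  intros H. destruct (H 1 Rlt_0_1) as [del [Hd H1]]. exists del. split; [exact Hd|].
  intros w Hw. specialize (H1 w Hw).
  replace (f w - f z)%C with ((f w - f z - d * (w - z)) + d * (w - z))%C by ring.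
  eapply Rle_trans; [apply Cmod_triangle|]. rewrite Cmod_mult. lra.
Qed.

Lemma rderiv_lip (f : R -> C) (z : R) (d : C) : rderiv f z d ->
  exists delta, 0 < delta /\ forall w, Rabs (w - z) < delta ->
    Cmod (f w - f z) <= (Cmod d + 1) * Rabs (w - z).
Proof.
  intros H. destruct (H 1 Rlt_0_1) as [del [Hd H1]]. exists del. split; [exact Hd|].
  intros w Hw. specialize (H1 w Hw).
  replace (f w - f z)%C with ((f w - f z - RtoC (w - z) * d) + RtoC (w - z) * d)%C by ring.
  eapply Rle_trans; [apply Cmod_triangle|]. rewrite Cmod_mult, Cmod_R. lra.
Qed.

(** Supplies the delta for most linear estimates below; dividing by k + 1 covers k = 0 without a
    case distinction. *)
Lemma lip_small (k e : R) : 0 <= k -> 0 < e ->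
  exists d, 0 < d /\ forall x, 0 <= x -> x < d -> k * x < e.
Proof.
  intros Hk He. exists (e / (k + 1)). split. apply Rdiv_lt_0_compat; lra.
  intros x Hx0 Hx.
  assert (H : (k + 1) * x < (k + 1) * (e / (k + 1))) by (apply Rmult_lt_compat_l; lra).
  replace ((k + 1) * (e / (k + 1))) with e in H by (field; lra). nra.
Qed.

Lemma rderiv_continuous (f : R -> C) (t : R) (v : C) : rderiv f t v ->
  @continuous R_UniformSpace C_UniformSpace f t.
Proof.
  intros H. apply continuous_R_C. intros eps He.
  destruct (rderiv_lip _ _ _ H) as [d1 [Hd1 H1]].
  destruct (lip_small (Cmod v + 1) eps) as [d2 [Hd2 H2]]; [pose proof (Cmod_ge_0 v); lra | easy |].
  exists (Rmin d1 d2). split. now apply Rmin_pos. intros w Hw.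
  eapply Rle_lt_trans. apply H1. eapply Rlt_le_trans; [exact Hw | apply Rmin_l].
  apply H2. apply Rabs_pos. eapply Rlt_le_trans; [exact Hw | apply Rmin_r].
Qed.

Lemma continuous_R_Cmult (f g : R -> C) (t : R) :
  @continuous R_UniformSpace C_UniformSpace f t ->
  @continuous R_UniformSpace C_UniformSpace g t ->
  @continuous R_UniformSpace C_UniformSpace (fun s => (f s * g s)%C) t.
Proof.
  rewrite <- !continuous_R_C. intros Hf Hg eps He.
  set (M := Cmod (f t) + Cmod (g t) + 1).
  assert (HM : 1 <= M) by (pose proof (Cmod_ge_0 (f t)); pose proof (Cmod_ge_0 (g t)); unfold M; lra).
  set (e := Rmin 1 (eps / (2 * M))).
  assert (He' : 0 < e) by (apply Rmin_pos; [lra | apply Rdiv_lt_0_compat; lra]).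
  destruct (Hf e He') as [d1 [Hd1 H1]]. destruct (Hg e He') as [d2 [Hd2 H2]].
  exists (Rmin d1 d2). split. now apply Rmin_pos. intros s Hs.
  specialize (H1 s (Rlt_le_trans _ _ _ Hs (Rmin_l _ _))).
  specialize (H2 s (Rlt_le_trans _ _ _ Hs (Rmin_r _ _))).
  replace (f s * g s - f t * g t)%C with
    ((f s - f t) * (g s - g t) + (f s - f t) * g t + f t * (g s - g t))%C by ring.
  eapply Rle_lt_trans. apply Cmod_triangle.
  eapply Rle_lt_trans. apply Rplus_le_compat_r. apply Cmod_triangle. rewrite !Cmod_mult.
  assert (e <= 1) by apply Rmin_l.
  assert (e * (2 * M) <= eps).
  { apply Rle_trans with (eps / (2 * M) * (2 * M)). apply Rmult_le_compat_r; [lra | apply Rmin_r].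
    right. field. lra. }
  pose proof (Cmod_ge_0 (f t)); pose proof (Cmod_ge_0 (g t)).
  pose proof (Cmod_ge_0 (f s - f t)); pose proof (Cmod_ge_0 (g s - g t)).
  assert (Cmod (f s - f t) * Cmod (g s - g t) <= e * 1) by (apply Rmult_le_compat; lra).
  assert (Cmod (f s - f t) * Cmod (g t) <= e * Cmod (g t)) by (apply Rmult_le_compat_r; lra).
  assert (Cmod (f t) * Cmod (g s - g t) <= Cmod (f t) * e) by (apply Rmult_le_compat_l; lra).
  unfold M in *. nra.
Qed.

Lemma rderiv_comp (h : C -> C) (g : R -> C) (t : R) (d v : C) :
  cderiv h (g t) d -> rderiv g t v -> rderiv (fun s => h (g s)) t (d * v)%C.
Proof.
  intros Hh Hg eps He.
  destruct (rderiv_lip _ _ _ Hg) as [d1 [Hd1 H1]].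
  set (k := Cmod v + 1) in *.
  assert (Hk : 0 < k) by (unfold k; pose proof (Cmod_ge_0 v); lra).
  set (m := Cmod d + 1).
  assert (Hm : 0 < m) by (unfold m; pose proof (Cmod_ge_0 d); lra).
  destruct (Hh (eps / (2 * k))) as [d2 [Hd2 H2]]. apply Rdiv_lt_0_compat; lra.
  destruct (Hg (eps / (2 * m))) as [d3 [Hd3 H3]]. apply Rdiv_lt_0_compat; lra.
  destruct (lip_small k d2) as [d4 [Hd4 H4]]; [lra | easy |].
  exists (Rmin (Rmin d1 d3) d4). split. repeat apply Rmin_pos; easy.
  intros s Hs.
  assert (S1 : Rabs (s - t) < d1) by (eapply Rlt_le_trans; [exact Hs | eapply Rle_trans; [apply Rmin_l | apply Rmin_l]]).
  assert (S3 : Rabs (s - t) < d3) by (eapply Rlt_le_trans; [exact Hs | eapply Rle_trans; [apply Rmin_l | apply Rmin_r]]).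
  assert (S4 : Rabs (s - t) < d4) by (eapply Rlt_le_trans; [exact Hs | apply Rmin_r]).
  specialize (H1 s S1). specialize (H3 s S3). specialize (H4 _ (Rabs_pos _) S4).
  specialize (H2 (g s) (Rle_lt_trans _ _ _ H1 H4)).
  replace (h (g s) - h (g t) - RtoC (s - t) * (d * v))%C with
    ((h (g s) - h (g t) - d * (g s - g t)) + d * (g s - g t - RtoC (s - t) * v))%C by ring.
  eapply Rle_trans. apply Cmod_triangle. rewrite Cmod_mult.
  pose proof (Rabs_pos (s - t)).
  assert (A : eps / (2 * k) * Cmod (g s - g t) <= eps / (2 * k) * (k * Rabs (s - t))).
  { apply Rmult_le_compat_l; [apply Rlt_le, Rdiv_lt_0_compat; lra | exact H1]. }
  replace (eps / (2 * k) * (k * Rabs (s - t))) with (eps / 2 * Rabs (s - t)) in A by (field; lra).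
  assert (B : Cmod d * Cmod (g s - g t - RtoC (s - t) * v) <= m * (eps / (2 * m) * Rabs (s - t))).
  { apply Rmult_le_compat; [apply Cmod_ge_0 | apply Cmod_ge_0 | unfold m; lra | exact H3]. }
  replace (m * (eps / (2 * m) * Rabs (s - t))) with (eps / 2 * Rabs (s - t)) in B by (field; lra).
  lra.
Qed.

(** * Integrals of complex-valued functions over real intervals *)

Notation is_CInt := (@is_RInt C_R_NormedModule).
Notation CInt := (@RInt C_R_CompleteNormedModule).

(** The factor [k] is complex, whereas [C_R_NormedModule] scales by reals, so the two real
    coordinates are integrated separately. *)
Lemma is_CInt_scal (f : R -> C) (a b : R) (k l : C) :
  is_CInt f a b l -> is_CInt (fun t => (k * f t)%C) a b (k * l)%C.
Proof.
  intros H.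
  pose proof (is_RInt_fct_extend_fst (U := R_NormedModule) (V := R_NormedModule) _ _ _ _ H) as H1.
  pose proof (is_RInt_fct_extend_snd (U := R_NormedModule) (V := R_NormedModule) _ _ _ _ H) as H2.
  apply (is_RInt_fct_extend_pair (U := R_NormedModule) (V := R_NormedModule)); simpl.
  - apply (is_RInt_minus (V := R_NormedModule));
      now apply (is_RInt_scal (V := R_NormedModule)).
  - apply (is_RInt_plus (V := R_NormedModule));
      now apply (is_RInt_scal (V := R_NormedModule)).
Qed.

Lemma is_CInt_minus (f g : R -> C) (a b : R) (l m : C) :
  is_CInt f a b l -> is_CInt g a b m -> is_CInt (fun t => (f t - g t)%C) a b (l - m)%C.
Proof. intros. now apply (is_RInt_minus (V := C_R_NormedModule)). Qed.

Lemma is_CInt_const (a b : R) (v : C) : is_CInt (fun _ => v) a b (RtoC (b - a) * v)%C.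
Proof. rewrite <- scal_C_R. apply (is_RInt_const (V := C_R_NormedModule)). Qed.

Lemma is_CInt_unique (f : R -> C) (a b : R) (l m : C) :
  is_CInt f a b l -> is_CInt f a b m -> l = m.
Proof.
  intros H1 H2. transitivity (CInt f a b).
  symmetry. now apply (is_RInt_unique (V := C_R_CompleteNormedModule)).
  now apply (is_RInt_unique (V := C_R_CompleteNormedModule)).
Qed.

Lemma is_CInt_CInt (f : R -> C) (a b : R) :
  a <= b ->
  (forall t, a <= t <= b -> @continuous R_UniformSpace C_UniformSpace f t) ->
  is_CInt f a b (CInt f a b).
Proof.
  intros Hab H. apply (RInt_correct (V := C_R_CompleteNormedModule)).
  apply (ex_RInt_continuous (V := C_R_CompleteNormedModule)).
  rewrite Rmin_left, Rmax_right by exact Hab. exact H.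
Qed.

Lemma is_CInt_bound (f : R -> C) (a b M : R) (l : C) :
  a <= b -> (forall t, a <= t <= b -> Cmod (f t) <= M) ->
  is_CInt f a b l -> Cmod l <= (b - a) * M.
Proof.
  intros Hab H Hl. rewrite <- norm_C_R.
  apply (norm_RInt_le_const (V := C_R_NormedModule) f); auto.
  intros t Ht. rewrite norm_C_R. now apply H.
Qed.

Lemma is_CInt_deriv (F f : R -> C) (a b : R) :
  a <= b -> (forall t, a <= t <= b -> rderiv F t (f t)) ->
  (forall t, a <= t <= b -> @continuous R_UniformSpace C_UniformSpace f t) ->
  is_CInt f a b (F b - F a)%C.
Proof.
  intros Hab H1 H2.
  apply (is_RInt_derive (V := C_R_CompleteNormedModule) F f);
    rewrite Rmin_left, Rmax_right by exact Hab.
  - intros t Ht. now apply rderiv_is_derive, H1.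
  - exact H2.
Qed.

Lemma is_CInt_ext (f g : R -> C) (a b : R) (l : C) :
  a <= b -> (forall t, a <= t <= b -> f t = g t) -> is_CInt f a b l -> is_CInt g a b l.
Proof.
  intros Hab H. apply is_RInt_ext. rewrite Rmin_left, Rmax_right by exact Hab.
  intros; apply H; lra.
Qed.

(** * Goursat's lemma *)

Lemma half_pow_small (k e : R) : 0 <= k -> 0 < e -> exists n, k * (/ 2) ^ n < e.
Proof.
  intros Hk He.
  destruct (pow_lt_1_zero (/ 2)) with (y := e / (k + 1)) as [n Hn].
  - rewrite Rabs_pos_eq; lra.
  - apply Rdiv_lt_0_compat; lra.
  - exists n. specialize (Hn n (le_n n)).
    assert (P : 0 < (/ 2) ^ n) by (apply pow_lt; lra).
    rewrite Rabs_pos_eq in Hn by lra.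
    apply (Rmult_lt_compat_l (k + 1)) in Hn; [|lra].
    replace ((k + 1) * (e / (k + 1))) with e in Hn by (field; lra). lra.
Qed.

(** The supremum of the left endpoints works: by nesting, every right endpoint bounds every left
    endpoint, earlier or later. *)
Lemma nested_point (x : nat -> R) (w : R) :
  0 <= w -> (forall n, x n <= x (S n)) ->
  (forall n, x (S n) + w * (/ 2) ^ S n <= x n + w * (/ 2) ^ n) ->
  exists p, forall n, x n <= p <= x n + w * (/ 2) ^ n.
Proof.
  intros Hw Hi Hd.
  assert (P : forall n, 0 <= w * (/ 2) ^ n).
  { intros n. apply Rmult_le_pos; [exact Hw | apply pow_le; lra]. }
  assert (U : forall n k, x (n + k)%nat + w * (/ 2) ^ (n + k) <= x n + w * (/ 2) ^ n).
  { intros n k. induction k. rewrite Nat.add_0_r; lra.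
    rewrite Nat.add_succ_r. eapply Rle_trans; [apply Hd | exact IHk]. }
  assert (M : forall n k, x n <= x (n + k)%nat).
  { intros n k. induction k. rewrite Nat.add_0_r; lra.
    rewrite Nat.add_succ_r. eapply Rle_trans; [exact IHk | apply Hi]. }
  destruct (completeness (fun r => exists n, r = x n)) as [p [H1 H2]].
  - exists (x 0%nat + w * (/ 2) ^ 0). intros r [n ->].
    pose proof (U 0%nat n). simpl in *. pose proof (P n). lra.
  - exists (x 0%nat). now exists 0%nat.
  - exists p. intros n. split. apply H1. now exists n.
    apply H2. intros r [k ->].
    destruct (le_lt_dec n k) as [L | L].
    + pose proof (U n (k - n)%nat). replace (n + (k - n))%nat with k in * by lia.
      pose proof (P k). lra.
    + pose proof (M k (n - k)%nat). replace (k + (n - k))%nat with n in * by lia.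
      pose proof (P n). lra.
Qed.

(** Pigeonhole by the triangle inequality: three summands that are too small leave at least [m] for
    the fourth. *)
Lemma Cmod_sum4 (A x y z t : C) (m : R) : A = (x + y + z + t)%C -> 4 * m <= Cmod A ->
  Cmod x < m -> Cmod y < m -> Cmod z < m -> m <= Cmod t.
Proof.
  intros -> H Hx Hy Hz.
  pose proof (Cmod_triangle (x + y + z) t). pose proof (Cmod_triangle (x + y) z).
  pose proof (Cmod_triangle x y). lra.
Qed.

(* Quadrisect repeatedly, keeping a quarter on which [|Phi|] is at least a fourth
   of its previous value. *)
Lemma additive_rect_zero (Phi : R -> R -> R -> R -> C) (a b c d : R) :
  a < b -> c < d ->
  (forall x y w h, a <= x -> x + (w + w) <= b -> c <= y -> y + (h + h) <= d ->
     0 < w -> 0 < h ->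
     Phi x y (w + w) (h + h) =
       (Phi x y w h + Phi (x + w)%R y w h + Phi x (y + h)%R w h
        + Phi (x + w)%R (y + h)%R w h)%C) ->
  (forall p q, a <= p <= b -> c <= q <= d -> forall eps, 0 < eps ->
     exists delta, 0 < delta /\
     forall x y w h, a <= x -> x + w <= b -> c <= y -> y + h <= d ->
       0 < w -> 0 < h -> x <= p <= x + w -> y <= q <= y + h -> w + h < delta ->
       Cmod (Phi x y w h) <= eps * (w + h) ^ 2) ->
  Phi a c (b - a) (d - c) = RtoC 0.
Proof.
  intros Hab Hcd Hadd Hloc.
  set (W := fun n => (b - a) * (/ 2) ^ n). set (H := fun n => (d - c) * (/ 2) ^ n).
  assert (EW : forall n, W n = W (S n) + W (S n)) by (intros n; unfold W; simpl; lra).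
  assert (EH : forall n, H n = H (S n) + H (S n)) by (intros n; unfold H; simpl; lra).
  assert (PW : forall n, 0 < W n).
  { intros n. apply Rmult_lt_0_compat; [lra | apply pow_lt; lra]. }
  assert (PH : forall n, 0 < H n).
  { intros n. apply Rmult_lt_0_compat; [lra | apply pow_lt; lra]. }
  set (Q := fun n (s : R * R) => Cmod (Phi (fst s) (snd s) (W n) (H n))).
  set (next := fun n (s : R * R) =>
    let m := Q n s / 4 in
    let s1 := (fst s + W (S n), snd s) in
    let s2 := (fst s, snd s + H (S n)) in
    if Rle_dec m (Q (S n) s) then s
    else if Rle_dec m (Q (S n) s1) then s1
    else if Rle_dec m (Q (S n) s2) then s2
    else (fst s + W (S n), snd s + H (S n))).
  set (pos := fix pos n := match n with O => (a, c) | S m => next m (pos m) end).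
  assert (Inv : forall n, a <= fst (pos n) /\ fst (pos n) + W n <= b /\
                          c <= snd (pos n) /\ snd (pos n) + H n <= d).
  { induction n. simpl. unfold W, H; simpl. lra.
    specialize (EW n). specialize (EH n). specialize (PW (S n)). specialize (PH (S n)).
    simpl pos. unfold next. destruct (pos n) as [x y]; simpl fst in *; simpl snd in *.
    repeat (destruct Rle_dec; simpl fst; simpl snd); lra. }
  assert (Mono : forall n,
    fst (pos n) <= fst (pos (S n)) /\ fst (pos (S n)) + W (S n) <= fst (pos n) + W n /\
    snd (pos n) <= snd (pos (S n)) /\ snd (pos (S n)) + H (S n) <= snd (pos n) + H n).
  { intros n. specialize (EW n). specialize (EH n). specialize (PW (S n)). specialize (PH (S n)).
    simpl pos. unfold next. destruct (pos n) as [x y]; simpl fst in *; simpl snd in *.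
    repeat (destruct Rle_dec; simpl fst; simpl snd); lra. }
  assert (Dec : forall n, Q n (pos n) / 4 <= Q (S n) (pos (S n))).
  { intros n. specialize (Inv n). specialize (EW n). specialize (EH n). specialize (PW (S n)). specialize (PH (S n)).
    simpl pos. unfold next. destruct (pos n) as [x y]; simpl fst in *; simpl snd in *.
    destruct Rle_dec as [? | N1]; [easy|]. destruct Rle_dec as [? | N2]; [easy|].
    destruct Rle_dec as [? | N3]; [easy|].
    apply Rnot_le_lt in N1, N2, N3. unfold Q at 2; simpl fst; simpl snd.
    eapply Cmod_sum4; [ | | exact N1 | exact N2 | exact N3].
    2: { unfold Q. simpl. right. field_simplify. reflexivity. }
    simpl fst; simpl snd. rewrite EW, EH.
    apply Hadd; lra. }
  assert (Low : forall n, Q 0%nat (pos 0%nat) * (/ 4) ^ n <= Q n (pos n)).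
  { induction n. simpl; lra. eapply Rle_trans; [|apply Dec]. simpl. simpl in IHn. lra. }
  destruct (nested_point (fun n => fst (pos n)) (b - a)) as [p Hp].
  { lra. } { intros n; apply Mono. } { intros n; apply Mono. }
  destruct (nested_point (fun n => snd (pos n)) (d - c)) as [q Hq].
  { lra. } { intros n; apply Mono. } { intros n; apply Mono. }
  (* The local hypothesis at the limit point bounds the n-th rectangle by eps 4^(-n), and [Low]
     bounds it below by 4^(-n) times the initial value; the factor 4^(-n) cancels. *)
  assert (Zero : Q 0%nat (pos 0%nat) <= 0).
  { apply le_epsilon. intros eps He. rewrite Rplus_0_l.
    set (S := (b - a) + (d - c)). assert (HS : 0 < S) by (unfold S; lra).
    destruct (Hloc p q) with (eps := eps / S ^ 2) as [del [Hdel Hl]].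
    - pose proof (Hp 0%nat). pose proof (Inv 0%nat). unfold W in *. simpl in *. lra.
    - pose proof (Hq 0%nat). pose proof (Inv 0%nat). unfold H in *. simpl in *. lra.
    - apply Rdiv_lt_0_compat. lra. apply pow_lt; lra.
    - destruct (half_pow_small S del) as [n Hn]; [lra | lra |].
      pose proof (Inv n) as I.
      assert (ES : W n + H n = S * (/ 2) ^ n) by (unfold W, H, S; ring).
      assert (B : Q n (pos n) <= eps / S ^ 2 * (W n + H n) ^ 2).
      { apply Hl; try apply I; try apply PW; try apply PH; try apply Hp; try apply Hq.
        rewrite ES. exact Hn. }
      rewrite ES in B. rewrite Rpow_mult_distr in B.
      replace (eps / S ^ 2 * (S ^ 2 * ((/ 2) ^ n) ^ 2)) with (eps * ((/ 2) ^ n) ^ 2) in B by (field; lra).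
      rewrite <- pow_mult, Nat.mul_comm, pow_mult in B.
      replace ((/ 2) ^ 2) with (/ 4) in B by (simpl; lra).
      specialize (Low n). pose proof (pow_lt (/ 4) n ltac:(lra)). nra. }
  apply Cmod_eq_0. unfold Q, W, H in Zero. simpl in Zero. rewrite !Rmult_1_r in Zero.
  pose proof (Cmod_ge_0 (Phi a c (b - a) (d - c))). lra.
Qed.

(** * Goursat's lemma for the image of a rectangle *)

Section CurvilinearGoursat.

Variables (q : C -> C) (g g1 g2 : R -> R -> C) (a b c d L : R).
Hypothesis (Hab : a < b) (Hcd : c < d) (HL : 0 < L).
Hypothesis Hq : forall s t, a <= s <= b -> c <= t <= d -> exists l, cderiv q (g s t) l.
Hypothesis Hg1 : forall s t, a <= s <= b -> c <= t <= d -> rderiv (fun s => g s t) s (g1 s t).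
Hypothesis Hg2 : forall s t, a <= s <= b -> c <= t <= d -> rderiv (fun t => g s t) t (g2 s t).
Hypothesis Hc1 : forall s t, a <= s <= b -> c <= t <= d ->
  @continuous R_UniformSpace C_UniformSpace (fun s => g1 s t) s.
Hypothesis Hc2 : forall s t, a <= s <= b -> c <= t <= d ->
  @continuous R_UniformSpace C_UniformSpace (fun t => g2 s t) t.
Hypothesis Hb1 : forall s t, a <= s <= b -> c <= t <= d -> Cmod (g1 s t) <= L.
Hypothesis Hb2 : forall s t, a <= s <= b -> c <= t <= d -> Cmod (g2 s t) <= L.
Hypothesis Hlip : forall s t s' t', a <= s <= b -> c <= t <= d -> a <= s' <= b -> c <= t' <= d ->
  Cmod (g s t - g s' t') <= L * (Rabs (s - s') + Rabs (t - t')).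

(** The integrals of q dw along the images of horizontal edges ([A], at height [t]) and of vertical
    edges ([B], at abscissa [s]). *)
Let A (t s s' : R) : C := CInt (fun s => (q (g s t) * g1 s t)%C) s s'.
Let B (s t t' : R) : C := CInt (fun t => (q (g s t) * g2 s t)%C) t t'.

Lemma edge_cont1 s t : a <= s <= b -> c <= t <= d ->
  @continuous R_UniformSpace C_UniformSpace (fun s => (q (g s t) * g1 s t)%C) s.
Proof.
  intros Hs Ht. apply continuous_R_Cmult; [|now apply Hc1].
  destruct (Hq s t Hs Ht) as [l Hl].
  apply (rderiv_continuous _ _ (l * g1 s t)%C).
  apply (rderiv_comp q (fun s => g s t)); auto.
Qed.

Lemma edge_cont2 s t : a <= s <= b -> c <= t <= d ->
  @continuous R_UniformSpace C_UniformSpace (fun t => (q (g s t) * g2 s t)%C) t.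
Proof.
  intros Hs Ht. apply continuous_R_Cmult; [|now apply Hc2].
  destruct (Hq s t Hs Ht) as [l Hl].
  apply (rderiv_continuous _ _ (l * g2 s t)%C).
  apply (rderiv_comp q (g s)); auto.
Qed.

Lemma edge_int1 t s s' : c <= t <= d -> a <= s -> s <= s' -> s' <= b ->
  is_CInt (fun s => (q (g s t) * g1 s t)%C) s s' (A t s s').
Proof. intros. apply is_CInt_CInt; auto. intros; apply edge_cont1; lra. Qed.

Lemma edge_int2 s t t' : a <= s <= b -> c <= t -> t <= t' -> t' <= d ->
  is_CInt (fun t => (q (g s t) * g2 s t)%C) t t' (B s t t').
Proof. intros. apply is_CInt_CInt; auto. intros; apply edge_cont2; lra. Qed.

Lemma edge_chasles1 t s s' s'' : c <= t <= d -> a <= s -> s <= s' -> s' <= s'' -> s'' <= b ->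
  A t s s'' = (A t s s' + A t s' s'')%C.
Proof.
  intros. eapply is_CInt_unique. apply edge_int1; lra.
  apply (is_RInt_Chasles (V := C_R_NormedModule) _ _ s'); apply edge_int1; lra.
Qed.

Lemma edge_chasles2 s t t' t'' : a <= s <= b -> c <= t -> t <= t' -> t' <= t'' -> t'' <= d ->
  B s t t'' = (B s t t' + B s t' t'')%C.
Proof.
  intros. eapply is_CInt_unique. apply edge_int2; lra.
  apply (is_RInt_Chasles (V := C_R_NormedModule) _ _ t'); apply edge_int2; lra.
Qed.

(** Primitive of the first-order approximation of [q] at [w0]; being exact, that part contributes
    only its endpoint values. *)
Let E (w0 q0 q1 w : C) : C := (q0 * (w - w0) + q1 * (w - w0) * (w - w0) / 2)%C.

Lemma quadratic_primitive_deriv w0 q0 q1 w : cderiv (E w0 q0 q1) w (q0 + q1 * (w - w0))%C.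
Proof.
  intros eps He. set (k := Cmod (q1 / 2)).
  destruct (lip_small k eps) as [dl [Hd H]]; [apply Cmod_ge_0 | exact He |].
  exists dl. split; [exact Hd|]. intros v Hv.
  replace (E w0 q0 q1 v - E w0 q0 q1 w - (q0 + q1 * (w - w0)) * (v - w))%C
    with (q1 / 2 * (v - w) * (v - w))%C by (unfold E; field).
  rewrite !Cmod_mult. fold k. specialize (H _ (Cmod_ge_0 (v - w)) Hv).
  apply Rmult_le_compat_r; [apply Cmod_ge_0 | lra].
Qed.

(* Near [w0] the integrand is, up to [eta |w - w0|], the exact form [dE]. *)
Lemma path_near_exact (h h1 : R -> C) (w0 q0 q1 : C) (s s' eta D : R) (l : C) :
  s <= s' -> 0 <= eta -> 0 <= D ->
  (forall t, s <= t <= s' -> rderiv h t (h1 t)) ->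
  (forall t, s <= t <= s' -> @continuous R_UniformSpace C_UniformSpace h1 t) ->
  (forall t, s <= t <= s' -> Cmod (h1 t) <= L) ->
  (forall t, s <= t <= s' -> Cmod (h t - w0) <= D) ->
  (forall t, s <= t <= s' ->
     Cmod (q (h t) - q0 - q1 * (h t - w0)) <= eta * Cmod (h t - w0)) ->
  is_CInt (fun t => (q (h t) * h1 t)%C) s s' l ->
  Cmod (l - (E w0 q0 q1 (h s') - E w0 q0 q1 (h s))) <= (s' - s) * (eta * D * L).
Proof.
  intros Hs He HD Hh Hc Hb HDb Hqe Hl.
  assert (I : is_CInt (fun t => ((q0 + q1 * (h t - w0)) * h1 t)%C) s s'
    (E w0 q0 q1 (h s') - E w0 q0 q1 (h s))%C).
  { apply (is_CInt_deriv (fun t => E w0 q0 q1 (h t))); [exact Hs | |].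
    - intros t Ht. apply (rderiv_comp (E w0 q0 q1) h); [apply quadratic_primitive_deriv | auto].
    - intros t Ht. apply continuous_R_Cmult; [|auto].
      apply (rderiv_continuous _ _ (q1 * h1 t)%C).
      apply (rderiv_comp (fun w => q0 + q1 * (w - w0))%C h); [|auto].
      intros eps Heps. exists 1. split; [lra|]. intros w _.
      replace (q0 + q1 * (w - w0) - (q0 + q1 * (h t - w0)) - q1 * (w - h t))%C with (RtoC 0) by ring.
      rewrite Cmod_0. apply Rmult_le_pos; [lra | apply Cmod_ge_0]. }
  pose proof (is_CInt_minus _ _ _ _ _ _ Hl I) as J.
  refine (is_CInt_bound _ _ _ _ _ Hs _ J).
  intros t Ht.
  replace (q (h t) * h1 t - (q0 + q1 * (h t - w0)) * h1 t)%C
    with ((q (h t) - q0 - q1 * (h t - w0)) * h1 t)%C by ring.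
  rewrite Cmod_mult. specialize (Hqe t Ht). specialize (Hb t Ht). specialize (HDb t Ht).
  apply Rmult_le_compat; try apply Cmod_ge_0; auto.
  eapply Rle_trans; [exact Hqe|]. now apply Rmult_le_compat_l.
Qed.

(** Integral of q dw along the image of the counterclockwise boundary of the rectangle with lower
    left corner (x, y) and sides [w], [h]. *)
Let Phi (x y w h : R) : C :=
  (A y x (x + w) + B (x + w)%R y (y + h) - A (y + h)%R x (x + w) - B x y (y + h))%C.

Lemma goursat_curvilinear : (A c a b + B b c d - A d a b - B a c d)%C = RtoC 0.
Proof.
  replace (A c a b + B b c d - A d a b - B a c d)%C with (Phi a c (b - a) (d - c)).
  2: { unfold Phi. replace (a + (b - a))%R with b by ring. now replace (c + (d - c))%R with d by ring. }
  apply additive_rect_zero; [exact Hab | exact Hcd | |].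
  - intros x y w h. intros. unfold Phi.
    replace (x + w + w)%R with (x + (w + w))%R by ring.
    replace (y + h + h)%R with (y + (h + h))%R by ring.
    rewrite (edge_chasles1 y x (x + w) (x + (w + w))) by lra.
    rewrite (edge_chasles1 (y + (h + h)) x (x + w) (x + (w + w))) by lra.
    rewrite (edge_chasles2 x y (y + h) (y + (h + h))) by lra.
    rewrite (edge_chasles2 (x + (w + w)) y (y + h) (y + (h + h))) by lra.
    ring.
  - intros p r Hp Hr eps He.
    destruct (Hq p r Hp Hr) as [q1 Hl]. set (w0 := g p r) in *.
    (* Every edge has an error of at most its length times eta D L, where D = L (w + h). The four
       errors add up to 2 eta L^2 (w + h)^2, which this [eta] makes eps (w + h)^2. *)
    set (eta := eps / (2 * (L * L))).
    assert (Heta : 0 < eta) by (apply Rdiv_lt_0_compat; nra).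
    destruct (Hl eta Heta) as [dl [Hdl H1]].
    destruct (lip_small L dl) as [d2 [Hd2 H2]]; [lra | lra |].
    exists d2. split; [exact Hd2|]. intros x y w h Hx Hxw Hy Hyh Hw Hh Hpx Hry Hwh.
    assert (Near : forall s t, x <= s <= x + w -> y <= t <= y + h -> Cmod (g s t - w0) <= L * (w + h)).
    { intros s t Hs Ht. eapply Rle_trans. apply Hlip; lra.
      apply Rmult_le_compat_l; [lra|].
      apply Rplus_le_compat; apply Rabs_le; lra. }
    assert (Quad : forall s t, x <= s <= x + w -> y <= t <= y + h ->
      Cmod (q (g s t) - q w0 - q1 * (g s t - w0)) <= eta * Cmod (g s t - w0)).
    { intros s t Hs Ht. apply H1. eapply Rle_lt_trans. apply Near; auto. apply H2; lra. }
    set (D := L * (w + h)) in *. assert (HD : 0 <= D) by (unfold D; nra).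
    set (G := E w0 (q w0) q1).
    assert (T1 : forall t, y <= t <= y + h ->
      Cmod (A t x (x + w) - (G (g (x + w)%R t) - G (g x t))) <= w * (eta * D * L)).
    { intros t Ht. replace w with (x + w - x) at 3 by ring.
      apply (path_near_exact (fun s => g s t) (fun s => g1 s t)); try lra.
      - intros s Hs; apply Hg1; lra.
      - intros s Hs; apply Hc1; lra.
      - intros s Hs; apply Hb1; lra.
      - intros s Hs; apply Near; lra.
      - intros s Hs; apply Quad; lra.
      - apply edge_int1; lra. }
    assert (T2 : forall s, x <= s <= x + w ->
      Cmod (B s y (y + h) - (G (g s (y + h)%R) - G (g s y))) <= h * (eta * D * L)).
    { intros s Hs. replace h with (y + h - y) at 3 by ring.
      apply (path_near_exact (g s) (g2 s)); try lra.
      - intros t Ht; apply Hg2; lra.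
      - intros t Ht; apply Hc2; lra.
      - intros t Ht; apply Hb2; lra.
      - intros t Ht; apply Near; lra.
      - intros t Ht; apply Quad; lra.
      - apply edge_int2; lra. }
    pose proof (T1 y ltac:(lra)) as U1. pose proof (T1 (y + h)%R ltac:(lra)) as U2.
    pose proof (T2 x ltac:(lra)) as U3. pose proof (T2 (x + w)%R ltac:(lra)) as U4.
    set (e1 := (A y x (x + w) - (G (g (x + w)%R y) - G (g x y)))%C) in *.
    set (e2 := (A (y + h)%R x (x + w) - (G (g (x + w)%R (y + h)%R) - G (g x (y + h)%R)))%C) in *.
    set (e3 := (B x y (y + h) - (G (g x (y + h)%R) - G (g x y)))%C) in *.
    set (e4 := (B (x + w)%R y (y + h) - (G (g (x + w)%R (y + h)%R) - G (g (x + w)%R y)))%C) in *.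
    (* The values of the primitive [G] at the four corners cancel along the closed boundary, leaving
       the four errors. *)
    replace (Phi x y w h) with ((e1 + e4) - (e2 + e3))%C
      by (unfold Phi, e1, e2, e3, e4; ring).
    eapply Rle_trans; [apply Cmod_triangle_minus|].
    pose proof (Cmod_triangle e1 e4). pose proof (Cmod_triangle e2 e3).
    replace (eps * (w + h) ^ 2) with (2 * (w + h) * (eta * D * L)).
    + lra.
    + unfold eta, D. field. lra.
Qed.

End CurvilinearGoursat.

(** * Cauchy's formula on circles *)

Definition cis (t : R) : C := (cos t, sin t).

Lemma Cmod_cis t : Cmod (cis t) = 1.
Proof.
  unfold Cmod, cis; simpl fst; simpl snd. rewrite <- sqrt_1. f_equal.
  pose proof (sin2_cos2 t). unfold Rsqr in *. simpl. lra.
Qed.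

Lemma cis_neq_0 t : cis t <> RtoC 0.
Proof. intros H. pose proof (Cmod_cis t). rewrite H, Cmod_0 in *. lra. Qed.

Lemma Cmod_le_parts (x y : R) : Cmod (x, y) <= Rabs x + Rabs y.
Proof.
  replace ((x, y) : C) with (RtoC x + Ci * RtoC y)%C.
  eapply Rle_trans; [apply Cmod_triangle|].
  rewrite Cmod_mult, !Cmod_R, Cmod_Ci. lra.
  unfold RtoC, Ci, Cmult, Cplus; simpl. f_equal; ring.
Qed.

Lemma rderiv_parts (x y : R -> R) (t x' y' : R) :
  is_derive x t x' -> is_derive y t y' ->
  rderiv (fun s => (x s, y s)) t (x', y').
Proof.
  intros [_ Hx] [_ Hy] eps He.
  assert (He2 : 0 < eps / 2) by lra.
  destruct (Hx t (fun P H => H) (mkposreal _ He2)) as [d1 H1].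
  destruct (Hy t (fun P H => H) (mkposreal _ He2)) as [d2 H2].
  exists (Rmin d1 d2). split. apply Rmin_pos; apply cond_pos.
  intros s Hs.
  specialize (H1 s (Rlt_le_trans _ _ _ Hs (Rmin_l _ _))).
  specialize (H2 s (Rlt_le_trans _ _ _ Hs (Rmin_r _ _))).
  replace ((x s, y s) - (x t, y t) - RtoC (s - t) * (x', y'))%C
    with ((x s - x t - (s - t) * x', y s - y t - (s - t) * y') : C).
  2: { unfold RtoC, Cminus, Cmult, Cplus, Copp; simpl. f_equal; ring. }
  eapply Rle_trans. apply Cmod_le_parts.
  change (Rabs (x s - x t - (s - t) * x') <= eps / 2 * Rabs (s - t)) in H1.
  change (Rabs (y s - y t - (s - t) * y') <= eps / 2 * Rabs (s - t)) in H2.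
  lra.
Qed.

Lemma rderiv_cis (k t : R) : rderiv (fun s => cis (k * s)) t (RtoC k * Ci * cis (k * t))%C.
Proof.
  replace (RtoC k * Ci * cis (k * t))%C with ((- k * sin (k * t), k * cos (k * t)) : C).
  2: { unfold RtoC, Ci, cis, Cmult; simpl. f_equal; ring. }
  apply rderiv_parts; auto_derive; auto; ring.
Qed.

Lemma rderiv_cis1 (t : R) : rderiv cis t (Ci * cis t)%C.
Proof.
  replace (Ci * cis t)%C with ((- sin t, cos t) : C).
  2: { unfold RtoC, Ci, cis, Cmult; simpl. f_equal; ring. }
  apply (rderiv_parts cos sin); auto_derive; auto; ring.
Qed.

Lemma rderiv_affine (g : R -> C) (t : R) (v m k : C) :
  rderiv g t v -> rderiv (fun s => (m + k * g s)%C) t (k * v)%C.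
Proof.
  intros H. apply (rderiv_comp (fun w => m + k * w)%C g); [|exact H].
  intros eps He. exists 1. split; [lra|]. intros w _.
  replace (m + k * w - (m + k * g t) - k * (w - g t))%C with (RtoC 0) by ring.
  rewrite Cmod_0. apply Rmult_le_pos; [lra | apply Cmod_ge_0].
Qed.

(** The mean value theorem is applied to cos and sin separately, whence the constant 2. *)
Lemma cis_lip s t : Cmod (cis s - cis t) <= 2 * Rabs (s - t).
Proof.
  replace (cis s - cis t)%C with ((cos s - cos t, sin s - sin t) : C) by reflexivity.
  eapply Rle_trans. apply Cmod_le_parts.
  assert (H : forall f f', (forall x, is_derive f x (f' x)) -> (forall x, Rabs (f' x) <= 1) ->
     Rabs (f s - f t) <= Rabs (s - t)).
  { intros f f' Hf Hb. destruct (MVT_gen f t s f') as [c [_ Hc]].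
    - intros; apply Hf.
    - intros. apply derivable_continuous_pt. exists (f' x). apply is_derive_Reals, Hf.
    - rewrite Hc, Rabs_mult. pose proof (Rabs_pos (s - t)). specialize (Hb c). nra. }
  assert (Rabs (cos s - cos t) <= Rabs (s - t)).
  { apply (H cos (fun x => - sin x)). intros; auto_derive; auto; ring.
    intros. rewrite Rabs_Ropp. apply Rabs_le. apply SIN_bound. }
  assert (Rabs (sin s - sin t) <= Rabs (s - t)).
  { apply (H sin cos). intros; auto_derive; auto; ring.
    intros. apply Rabs_le. apply COS_bound. }
  lra.
Qed.

Lemma cis_2PI : cis (2 * PI) = cis 0.
Proof. unfold cis. now rewrite cos_2PI, sin_2PI, cos_0, sin_0. Qed.

Lemma cis_pow t n : (cis t ^ n)%C = cis (INR n * t).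
Proof.
  induction n.
  - simpl. rewrite Rmult_0_l. unfold cis. now rewrite cos_0, sin_0.
  - rewrite Cpow_S, IHn, S_INR.
    replace ((INR n + 1) * t) with (t + INR n * t) by ring.
    unfold cis, Cmult; simpl. rewrite cos_plus, sin_plus. f_equal; ring.
Qed.

Lemma cis_inv t : (/ cis t)%C = cis (- t).
Proof.
  assert (H : (cis (- t) * cis t)%C = RtoC 1).
  { unfold cis, Cmult, RtoC; simpl. rewrite cos_neg, sin_neg.
    pose proof (sin2_cos2 t). unfold Rsqr in *. f_equal; lra. }
  pose proof (cis_neq_0 t).
  replace (cis (- t)) with (cis (- t) * cis t * / cis t)%C by (field; easy).
  rewrite H. ring.
Qed.

(** The integrand is e^(ikt) with k = -(n + 1). As k is a nonzero integer, the primitive e^(ikt) /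
    (ik) exists and takes equal values at 0 and 2 pi. *)
Lemma is_CInt_cis_pow n : is_CInt (fun t => ((/ cis t) ^ S n)%C) 0 (2 * PI) (RtoC 0).
Proof.
  pose proof PI_RGT_0.
  set (k := - INR (S n)).
  assert (Hk : k <> 0) by (unfold k; pose proof (lt_0_INR (S n) ltac:(lia)); lra).
  assert (HkC : (RtoC k * Ci)%C <> RtoC 0).
  { apply Cmult_neq_0; [intros E; apply RtoC_inj in E; auto | apply Ci_nz]. }
  assert (I : is_CInt (fun t => (RtoC k * Ci * cis (k * t))%C) 0 (2 * PI)
     (cis (k * (2 * PI)) - cis (k * 0))%C).
  { apply (is_CInt_deriv (fun t => cis (k * t))); [lra | |].
    - intros; apply rderiv_cis.
    - intros t _. eapply rderiv_continuous.
      assert (Q : rderiv (fun s => (RtoC 0 + RtoC k * Ci * cis (k * s))%C) t (RtoC k * Ci * (RtoC k * Ci * cis (k * t)))%C).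
      { apply rderiv_affine, rderiv_cis. }
      intros eps He. destruct (Q eps He) as [d [Hd H1]]. exists d. split; auto.
      intros s Hs. specialize (H1 s Hs). rewrite !Cplus_0_l in H1. exact H1. }
  replace (cis (k * (2 * PI)) - cis (k * 0))%C with (RtoC 0) in I.
  2: { unfold k. replace (- INR (S n) * (2 * PI)) with (- (INR (S n) * (2 * PI))) by ring.
       rewrite <- cis_inv, <- cis_pow, cis_2PI.
       replace (cis 0) with (RtoC 1) by (unfold cis; now rewrite cos_0, sin_0).
       rewrite Cpow_1_l, Rmult_0_r.
       replace (cis 0) with (RtoC 1) by (unfold cis; now rewrite cos_0, sin_0).
       field. }
  apply (is_CInt_scal _ _ _ (/ (RtoC k * Ci))%C) in I. rewrite Cmult_0_r in I.
  refine (is_CInt_ext _ _ _ _ _ _ _ I). lra.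
  intros t _. rewrite cis_inv, cis_pow.
  replace (INR (S n) * - t) with (k * t) by (unfold k; ring).
  rewrite Cmult_assoc, Cinv_l by exact HkC. ring.
Qed.

Lemma cderiv_ext_near (f g : C -> C) z d :
  (exists e, 0 < e /\ forall w, Cmod (w - z) < e -> f w = g w) ->
  cderiv f z d -> cderiv g z d.
Proof.
  intros [e [He E]] H eps Heps. destruct (H eps Heps) as [d1 [Hd H1]].
  exists (Rmin d1 e). split. now apply Rmin_pos. intros w Hw.
  rewrite <- !E. apply H1. eapply Rlt_le_trans; [exact Hw | apply Rmin_l].
  replace (z - z)%C with (RtoC 0) by ring. rewrite Cmod_0; lra.
  eapply Rlt_le_trans; [exact Hw | apply Rmin_r].
Qed.

(* With [Q = (f w0 - f z) / (w0 - z)] the quotient satisfies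
   [(f w - f z) / (w - z) - Q = (f w - f w0 - Q (w - w0)) / (w - z)]. *)
Lemma cderiv_quotient (f : C -> C) (z w0 d : C) : w0 <> z -> cderiv f w0 d ->
  exists l, cderiv (fun w => ((f w - f z) / (w - z))%C) w0 l.
Proof.
  intros Hz Hf.
  set (Q := ((f w0 - f z) / (w0 - z))%C).
  assert (Hnz : (w0 - z)%C <> RtoC 0) by now apply Cminus_eq_contra.
  set (m := Cmod (w0 - z)). assert (Hm : 0 < m) by now apply Cmod_gt_0.
  exists ((d - Q) / (w0 - z))%C. intros eps He.
  set (k := Cmod ((d - Q) / (w0 - z))). assert (Hk : 0 <= k) by apply Cmod_ge_0.
  destruct (Hf (eps * m / 4)) as [d1 [Hd1 H1]]. { apply Rdiv_lt_0_compat; nra. }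
  destruct (lip_small k (eps * m / 4)) as [d2 [Hd2 H2]]; [exact Hk | apply Rdiv_lt_0_compat; nra |].
  exists (Rmin (Rmin d1 d2) (m / 2)). split. repeat apply Rmin_pos; lra.
  intros w Hw.
  assert (S1 : Cmod (w - w0) < d1) by (eapply Rlt_le_trans; [exact Hw | eapply Rle_trans; [apply Rmin_l | apply Rmin_l]]).
  assert (S2 : Cmod (w - w0) < d2) by (eapply Rlt_le_trans; [exact Hw | eapply Rle_trans; [apply Rmin_l | apply Rmin_r]]).
  assert (S3 : Cmod (w - w0) < m / 2) by (eapply Rlt_le_trans; [exact Hw | apply Rmin_r]).
  specialize (H1 w S1). specialize (H2 _ (Cmod_ge_0 _) S2).
  assert (Hwz : m / 2 <= Cmod (w - z)).
  { pose proof (Cmod_triangle_minus (w - z) (w - w0)).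
    replace (w - z - (w - w0))%C with (w0 - z)%C in H by ring. unfold m in *. lra. }
  assert (Hwz0 : (w - z)%C <> RtoC 0) by (apply Cmod_gt_0; lra).
  replace ((f w - f z) / (w - z) - (f w0 - f z) / (w0 - z) - (d - Q) / (w0 - z) * (w - w0))%C
    with (((f w - f w0 - d * (w - w0)) - (d - Q) / (w0 - z) * (w - w0) * (w - w0)) / (w - z))%C.
  2: { unfold Q. field. split; assumption. }
  rewrite Cmod_div by exact Hwz0.
  apply Rle_div_l; [lra|].
  eapply Rle_trans; [apply Cmod_triangle_minus|]. rewrite !Cmod_mult. fold k.
  pose proof (Cmod_ge_0 (w - w0)).
  assert (k * Cmod (w - w0) * Cmod (w - w0) <= eps * m / 4 * Cmod (w - w0)) by (apply Rmult_le_compat_r; lra).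
  assert (eps * Cmod (w - w0) * (m / 2) <= eps * Cmod (w - w0) * Cmod (w - z)) by (apply Rmult_le_compat_l; [nra | lra]).
  nra.
Qed.

(** * Cauchy's formula by radial contraction *)

Section CauchyKernel.

Variables (f : C -> C) (rho r : R).
Hypothesis Hf : forall w, Cmod w < rho -> exists l, cderiv f w l.
Hypothesis Hr : 0 < r < rho.

Let W (t : R) : C := (RtoC r * cis t)%C.

Lemma Cmod_W t : Cmod (W t) = r.
Proof. unfold W. rewrite Cmod_mult, Cmod_R, Cmod_cis, Rabs_pos_eq; lra. Qed.

Lemma rderiv_W t : rderiv W t (Ci * W t)%C.
Proof.
  replace (Ci * W t)%C with (RtoC r * (Ci * cis t))%C by (unfold W; ring).
  intros eps He. destruct (rderiv_affine cis t _ (RtoC 0) (RtoC r) (rderiv_cis1 t) eps He) as [d [Hd H1]].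
  exists d. split; auto. intros s Hs. specialize (H1 s Hs). rewrite !Cplus_0_l in H1. exact H1.
Qed.

Lemma W_neq_0 t : W t <> RtoC 0.
Proof. apply Cmod_gt_0. rewrite Cmod_W. lra. Qed.

(** Let K (s) be the integral of the difference quotient over the circle contracted towards [z] by
    the factor [s]. For s > 0 the contracted circles avoid [z], so Goursat's lemma makes K constant;
    and K (s) tends to 0 with s because the quotient stays bounded while the length shrinks. *)
Lemma cauchy_circle (z : C) : Cmod z < r ->
  is_CInt (fun t => ((f (W t) - f z) / (W t - z) * (Ci * W t))%C) 0 (2 * PI) (RtoC 0).
Proof.
  intros Hz. pose proof PI_RGT_0 as HPI.
  set (q := fun w => ((f w - f z) / (w - z))%C).
  set (g := fun s t => (z + RtoC s * (W t - z))%C).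
  set (g1 := fun (s t : R) => (W t - z)%C).
  set (g2 := fun (s t : R) => (RtoC s * (Ci * W t))%C).
  assert (Hdist : forall t, 0 < Cmod (W t - z) <= 2 * r).
  { intros t. pose proof (Cmod_triangle_minus (W t) z). pose proof (Cmod_triangle (W t - z) z).
    replace (W t - z + z)%C with (W t) in * by ring. rewrite Cmod_W in *. lra. }
  assert (Hin : forall s t, 0 <= s <= 1 -> Cmod (g s t) < rho).
  { intros s t Hs. replace (g s t) with (RtoC (1 - s) * z + RtoC s * W t)%C.
    2: { unfold g. rewrite RtoC_minus. ring. }
    eapply Rle_lt_trans; [apply Cmod_triangle|].
    rewrite !Cmod_mult, !Cmod_R, Cmod_W, !Rabs_pos_eq by lra. pose proof (Cmod_ge_0 z). nra. }
  assert (Hg2z : forall s t, (g s t - z)%C = (RtoC s * (W t - z))%C) by (intros; unfold g; ring).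
  assert (G2 : forall s t, rderiv (fun t => g s t) t (g2 s t)).
  { intros s t. unfold g, g2.
    intros eps He.
    destruct (rderiv_affine W t _ (z - RtoC s * z)%C (RtoC s) (rderiv_W t) eps He) as [d [Hd H1]].
    exists d. split; auto. intros t' Ht. specialize (H1 t' Ht).
    replace (z + RtoC s * (W t' - z) - (z + RtoC s * (W t - z)))%C
      with (z - RtoC s * z + RtoC s * W t' - (z - RtoC s * z + RtoC s * W t))%C by ring.
    exact H1. }
  assert (C2 : forall s t, @continuous R_UniformSpace C_UniformSpace (fun t => g2 s t) t).
  { intros s t. unfold g2.
    apply (rderiv_continuous _ _ (RtoC s * Ci * (Ci * W t))%C). intros eps He.
    destruct (rderiv_affine W t _ (RtoC 0) (RtoC s * Ci)%C (rderiv_W t) eps He) as [d' [Hd' H1']].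
    exists d'. split; auto. intros t' Ht. specialize (H1' t' Ht).
    rewrite !Cplus_0_l in H1'. rewrite !Cmult_assoc. rewrite !Cmult_assoc in H1'. exact H1'. }
  assert (Hq : forall s t, 0 < s <= 1 -> exists l, cderiv q (g s t) l).
  { intros s t Hs. destruct (Hf (g s t)) as [l Hl]. apply Hin; lra.
    apply (cderiv_quotient f z (g s t) l); [|exact Hl].
    intros E. pose proof (Hg2z s t) as E2. rewrite E in E2.
    replace (z - z)%C with (RtoC 0) in E2 by ring.
    apply (f_equal Cmod) in E2. rewrite Cmod_0, Cmod_mult, Cmod_R, Rabs_pos_eq in E2 by lra.
    pose proof (Hdist t). nra. }
  set (K := fun s : R => (CInt (fun t => (q (g s t) * g2 s t)%C) 0 (2 * PI) : C)).
  assert (IK : forall s, 0 < s <= 1 ->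
     is_CInt (fun t => (q (g s t) * g2 s t)%C) 0 (2 * PI) (K s)).
  { intros s Hs. apply is_CInt_CInt; [lra|]. intros t Ht.
    apply continuous_R_Cmult; [|apply C2].
    destruct (Hq s t Hs) as [l Hl].
    apply (rderiv_continuous _ _ (l * g2 s t)%C).
    apply (rderiv_comp q (g s)); [exact Hl | apply G2]. }
  assert (Const : forall s, 0 < s < 1 -> K s = K 1).
  { intros s Hs.
    (* Since |W t - z| <= 2 r, the number 2 r + 1 bounds both partial derivatives and is a Lipschitz
       constant for the contraction. *)
    pose proof (goursat_curvilinear q g g1 g2 s 1 0 (2 * PI) (2 * r + 1)) as GC.
    assert (E : (CInt (fun u => q (g u 0%R) * g1 u 0%R)%C s 1%R + K 1%R -
                 CInt (fun u => q (g u (2 * PI)%R) * g1 u (2 * PI)%R)%C s 1%R - K s)%C = RtoC 0).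
    { apply GC; try lra.
      - intros; apply Hq; lra.
      - intros u t _ _ eps He. exists 1. split; [lra|]. intros t' _. unfold g, g1.
        replace (z + RtoC t' * (W t - z) - (z + RtoC u * (W t - z)) - RtoC (t' - u) * (W t - z))%C
          with (RtoC 0) by (rewrite RtoC_minus; ring).
        rewrite Cmod_0. apply Rmult_le_pos; [lra | apply Rabs_pos].
      - intros; apply G2.
      - intros; apply continuous_const.
      - intros; apply C2.
      - intros u t _ _. unfold g1. pose proof (Hdist t); lra.
      - intros u t Hu _. unfold g2. rewrite !Cmod_mult, Cmod_R, Cmod_Ci, Cmod_W, Rabs_pos_eq by lra. nra.
      - intros u t u' t' Hu _ Hu' _.
        replace (g u t - g u' t')%C with
          (RtoC (u - u') * (W t - z) + RtoC u' * (RtoC r * (cis t - cis t')))%C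
          by (unfold g, W; rewrite RtoC_minus; ring).
        eapply Rle_trans; [apply Cmod_triangle|].
        rewrite !Cmod_mult, !Cmod_R, (Rabs_pos_eq u'), (Rabs_pos_eq r) by lra.
        pose proof (Hdist t). pose proof (cis_lip t t'). pose proof (Rabs_pos (u - u')).
        pose proof (Rabs_pos (t - t')). pose proof (Cmod_ge_0 (cis t - cis t')).
        assert (Rabs (u - u') * Cmod (W t - z) <= Rabs (u - u') * (2 * r)) by (apply Rmult_le_compat_l; lra).
        assert (u' * (r * Cmod (cis t - cis t')) <= 1 * (r * (2 * Rabs (t - t')))).
        { apply Rmult_le_compat; try lra. nra. apply Rmult_le_compat_l; lra. }
        nra. }
    (* The edges t = 0 and t = 2 pi have the same image and are run through in opposite directions,
       so their common value [X] cancels. *)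
    assert (Ew : W (2 * PI) = W 0) by (unfold W; now rewrite cis_2PI).
    unfold g, g1 in E. rewrite Ew in E.
    match type of E with (?x + _ - ?x - _)%C = _ => set (X := x) in E end.
    replace (K s) with (K 1 - (X + K 1 - X - K s))%C by ring. rewrite E. ring. }
  destruct (Hf z) as [l Hl]; [lra|].
  destruct (cderiv_lip _ _ _ Hl) as [d1 [Hd1 H1]].
  set (M := Cmod l + 1) in *. assert (HM : 1 <= M) by (unfold M; pose proof (Cmod_ge_0 l); lra).
  (* On a small circle the quotient is at most [M], by differentiability at [z], and the velocity
     has modulus r s; thus |K (s)| <= 2 pi M r s. *)
  assert (Z : K 1 = RtoC 0).
  { apply Cmod_eq_0. apply Rle_antisym; [|apply Cmod_ge_0].
    apply le_epsilon. intros eps He. rewrite Rplus_0_l.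
    destruct (lip_small (2 * r) d1) as [d2 [Hd2 H2]]; [lra | lra |].
    destruct (lip_small (2 * PI * (M * r)) eps) as [d3 [Hd3 H3]]; [|lra|].
    { apply Rmult_le_pos; [lra | apply Rmult_le_pos; lra]. }
    set (s := Rmin (Rmin d2 d3) 1 / 2).
    assert (Hs0 : 0 < Rmin (Rmin d2 d3) 1) by (repeat apply Rmin_pos; lra).
    assert (Rmin (Rmin d2 d3) 1 <= 1) by apply Rmin_r.
    assert (Rmin (Rmin d2 d3) 1 <= Rmin d2 d3) by apply Rmin_l.
    pose proof (Rmin_l d2 d3). pose proof (Rmin_r d2 d3).
    rewrite <- (Const s) by (unfold s; lra).
    assert (B : Cmod (K s) <= (2 * PI - 0) * (M * r * s)).
    { refine (is_CInt_bound _ _ _ _ _ _ _ (IK s _)); [lra | | unfold s; lra].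
      intros t _. unfold q. rewrite Hg2z.
      assert (N : Cmod (RtoC s * (W t - z)) = s * Cmod (W t - z)).
      { rewrite Cmod_mult, Cmod_R, Rabs_pos_eq; [easy | unfold s; lra]. }
      pose proof (Hdist t) as Ht.
      assert (Hsd2 : s < d2) by (unfold s; lra). assert (Hs00 : 0 < s) by (unfold s; lra).
      specialize (H1 (g s t)). rewrite Hg2z, N in H1.
      assert (Hsm : s * Cmod (W t - z) < d1).
      { apply Rle_lt_trans with (2 * r * s); [nra | apply H2; lra]. }
      specialize (H1 Hsm).
      unfold g2. rewrite !Cmod_mult, Cmod_div, N, Cmod_R, Cmod_Ci, Cmod_W, Rabs_pos_eq by
        (try lra; apply Cmod_gt_0; rewrite N; nra).
      assert (Cmod (f (g s t) - f z) / (s * Cmod (W t - z)) <= M).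
      { apply Rle_div_l; [nra | lra]. }
      replace (M * r * s) with (M * (s * (1 * r))) by ring.
      apply Rmult_le_compat_r; [nra | assumption]. }
    assert (Hsd3 : s < d3) by (unfold s; lra). assert (Hs00 : 0 <= s) by (unfold s; lra).
    specialize (H3 s Hs00 Hsd3). lra. }
  rewrite <- Z.
  refine (is_CInt_ext _ _ _ _ _ _ _ (IK 1 _)); [lra | | lra].
  intros t _. unfold q, g2. replace (g 1 t) with (W t) by (unfold g; ring). ring.
Qed.

End CauchyKernel.

(** * Power series and Taylor expansion *)

Fixpoint psum (p : nat -> C) (n : nat) (z : C) : C :=
  match n with
  | O => RtoC 0
  | S m => (psum p m z + p m * z ^ m)%C
  end.

Definition has_ps (p : nat -> C) (z v : C) : Prop :=
  forall eps, 0 < eps -> exists N : nat, forall n, (N <= n)%nat ->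
    Cmod (v - psum p n z) < eps.

(** The exact value of the geometric block, with the term x^(m + k) kept, is what makes the
    induction on [k] close. *)
Lemma psum_cauchy (p : nat -> C) (z : C) (M x : R) :
  0 <= x < 1 -> (forall k, Cmod (p k * z ^ k) <= M * x ^ k) ->
  forall m k, Cmod (psum p (m + k) z - psum p m z) <= M * (x ^ m / (1 - x) - x ^ (m + k) / (1 - x)).
Proof.
  intros Hx H m k. induction k.
  - rewrite Nat.add_0_r. replace (psum p m z - psum p m z)%C with (RtoC 0) by ring.
    rewrite Cmod_0. lra.
  - rewrite Nat.add_succ_r. simpl psum.
    replace (psum p (m + k) z + p (m + k)%nat * z ^ (m + k) - psum p m z)%C
      with ((psum p (m + k) z - psum p m z) + p (m + k)%nat * z ^ (m + k))%C by ring.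
    eapply Rle_trans; [apply Cmod_triangle|]. specialize (H (m + k)%nat).
    replace (x ^ S (m + k) / (1 - x)) with (x ^ (m + k) / (1 - x) - x ^ (m + k)) by (simpl; field; lra).
    lra.
Qed.

Lemma geom_bound_nonneg (p : nat -> C) (z : C) (M x : R) :
  (forall k, Cmod (p k * z ^ k) <= M * x ^ k) -> 0 <= M.
Proof. intros H. specialize (H 0%nat). simpl in H. pose proof (Cmod_ge_0 (p 0%nat * 1)). lra. Qed.

Lemma psum_cauchy_bound (p : nat -> C) (z : C) (M x : R) :
  0 <= x < 1 -> (forall k, Cmod (p k * z ^ k) <= M * x ^ k) ->
  forall m n, (m <= n)%nat -> Cmod (psum p n z - psum p m z) <= M * x ^ m / (1 - x).
Proof.
  intros Hx H m n Hmn. replace n with (m + (n - m))%nat by lia.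
  eapply Rle_trans; [now apply (psum_cauchy _ _ M x)|].
  assert (0 <= x ^ (m + (n - m)) / (1 - x)).
  { apply Rmult_le_pos. apply pow_le; lra. apply Rlt_le, Rinv_0_lt_compat; lra. }
  pose proof (geom_bound_nonneg _ _ _ _ H). unfold Rdiv in *. nra.
Qed.

Lemma pow_small (k x e : R) : 0 <= k -> 0 <= x < 1 -> 0 < e ->
  exists N, forall n, (N <= n)%nat -> k * x ^ n < e.
Proof.
  intros Hk Hx He.
  destruct (pow_lt_1_zero x) with (y := e / (k + 1)) as [N HN].
  - rewrite Rabs_pos_eq; lra.
  - apply Rdiv_lt_0_compat; lra.
  - exists N. intros n Hn. specialize (HN n Hn).
    assert (P : 0 <= x ^ n) by (apply pow_le; lra).
    rewrite Rabs_pos_eq in HN by lra.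
    apply (Rmult_lt_compat_l (k + 1)) in HN; [|lra].
    replace ((k + 1) * (e / (k + 1))) with e in HN by (field; lra). lra.
Qed.

Lemma C_complete (u : nat -> C) :
  (forall eps, 0 < eps -> exists N, forall n m, (N <= n)%nat -> (N <= m)%nat -> Cmod (u n - u m) < eps) ->
  exists l, forall eps, 0 < eps -> exists N, forall n, (N <= n)%nat -> Cmod (l - u n) < eps.
Proof.
  intros H.
  assert (Hre : ex_finite_lim_seq (fun n => fst (u n))).
  { apply ex_lim_seq_cauchy_corr. intros e. destruct (H e (cond_pos e)) as [N HN].
    exists N. intros n m Hn Hm. eapply Rle_lt_trans; [|apply (HN n m Hn Hm)].
    eapply Rle_trans; [|apply Rmax_Cmod]. apply Rmax_l. }
  assert (Him : ex_finite_lim_seq (fun n => snd (u n))).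
  { apply ex_lim_seq_cauchy_corr. intros e. destruct (H e (cond_pos e)) as [N HN].
    exists N. intros n m Hn Hm. eapply Rle_lt_trans; [|apply (HN n m Hn Hm)].
    eapply Rle_trans; [|apply Rmax_Cmod]. apply Rmax_r. }
  destruct Hre as [a Ha]. destruct Him as [b Hb]. exists (a, b). intros eps He.
  assert (He2 : 0 < eps / 2) by lra.
  apply is_lim_seq_spec in Ha. apply is_lim_seq_spec in Hb.
  destruct (Ha (mkposreal _ He2)) as [N1 H1]. destruct (Hb (mkposreal _ He2)) as [N2 H2].
  exists (max N1 N2). intros n Hn.
  specialize (H1 n ltac:(lia)). specialize (H2 n ltac:(lia)). simpl in H1, H2.
  eapply Rle_lt_trans. apply (Cmod_le_parts (a + - fst (u n)) (b + - snd (u n))).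
  rewrite Rabs_minus_sym in H1, H2. unfold Rminus in *. lra.
Qed.

Lemma has_ps_exists (p : nat -> C) (z : C) (M x : R) :
  0 <= x < 1 -> (forall k, Cmod (p k * z ^ k) <= M * x ^ k) -> exists v, has_ps p z v.
Proof.
  intros Hx H. apply C_complete. intros eps He.
  pose proof (geom_bound_nonneg _ _ _ _ H).
  destruct (pow_small (M / (1 - x)) x eps) as [N HN]; auto.
  { apply Rmult_le_pos; [lra | apply Rlt_le, Rinv_0_lt_compat; lra]. }
  assert (B : forall n m, (N <= n)%nat -> (n <= m)%nat -> Cmod (psum p m z - psum p n z) < eps).
  { intros n m Hn Hnm. eapply Rle_lt_trans; [now apply (psum_cauchy_bound _ _ M x)|].
    specialize (HN n Hn). replace (M * x ^ n / (1 - x)) with (M / (1 - x) * x ^ n) by (field; lra). exact HN. }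
  exists N. intros n m Hn Hm. destruct (le_lt_dec n m).
  - rewrite Cmod_sym. now apply B.
  - apply B; lia.
Qed.

Lemma has_ps_limit_le (p : nat -> C) (z v w : C) (B : R) (n0 : nat) :
  has_ps p z v -> (forall n, (n0 <= n)%nat -> Cmod (w - psum p n z) <= B) -> Cmod (v - w) <= B.
Proof.
  intros Hv H. apply le_epsilon. intros eps He. destruct (Hv eps He) as [N HN].
  specialize (HN (max N n0) ltac:(lia)). specialize (H (max N n0) ltac:(lia)).
  replace (v - w)%C with ((v - psum p (max N n0) z) - (w - psum p (max N n0) z))%C by ring.
  eapply Rle_trans; [apply Cmod_triangle_minus|]. lra.
Qed.

Lemma has_ps_unique (p : nat -> C) (z v w : C) : has_ps p z v -> has_ps p z w -> v = w.
Proof.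
  intros Hv Hw. apply Ceq_minus, Cmod_eq_0. apply Rle_antisym; [|apply Cmod_ge_0].
  apply le_epsilon. intros eps He. rewrite Rplus_0_l. destruct (Hw eps He) as [N HN].
  apply (has_ps_limit_le p z v w eps N); auto. intros n Hn. now apply Rlt_le, HN.
Qed.

Lemma has_ps_tail (p : nat -> C) (z v : C) (M x : R) :
  0 <= x < 1 -> (forall k, Cmod (p k * z ^ k) <= M * x ^ k) -> has_ps p z v ->
  forall m, Cmod (v - psum p m z) <= M * x ^ m / (1 - x).
Proof.
  intros Hx H Hv m. apply (has_ps_limit_le p z v _ _ m Hv).
  intros n Hn. rewrite Cmod_sym. now apply psum_cauchy_bound.
Qed.

(** Late terms are differences of two partial sums that are both within 1 of [v], hence the bound 2;
    the remaining ones are finite in number. *)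
Lemma has_ps_terms_bounded (p : nat -> C) (z v : C) : has_ps p z v ->
  exists M, forall k, Cmod (p k * z ^ k) <= M.
Proof.
  intros H. destruct (H 1 Rlt_0_1) as [N HN].
  assert (F : exists M, forall k, (k < N)%nat -> Cmod (p k * z ^ k) <= M).
  { clear HN. induction N as [|N [M HM]]. exists 0; intros; lia.
    exists (Rmax M (Cmod (p N * z ^ N))). intros k Hk.
    destruct (Nat.eq_dec k N) as [->|]. apply Rmax_r.
    eapply Rle_trans; [apply HM; lia | apply Rmax_l]. }
  destruct F as [M HM]. exists (Rmax M 2). intros k.
  destruct (le_lt_dec N k).
  - eapply Rle_trans; [|apply Rmax_r].
    pose proof (HN k ltac:(lia)). pose proof (HN (S k) ltac:(lia)).
    replace (p k * z ^ k)%C with ((v - psum p k z) - (v - psum p (S k) z))%C by (simpl; ring).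
    eapply Rle_trans; [apply Cmod_triangle_minus|]. lra.
  - eapply Rle_trans; [apply HM; lia | apply Rmax_l].
Qed.

(** Abel's condition: it gives geometric convergence for |z| < r, and it is easily carried over to
    the derived series (with a smaller radius) and to the integrated one. *)
Definition bdd (p : nat -> C) (r : R) : Prop :=
  exists M, forall n, Cmod (p n) * r ^ n <= M.

Lemma bdd_geom (p : nat -> C) (r M : R) (z : C) : 0 < r ->
  (forall n, Cmod (p n) * r ^ n <= M) ->
  forall k, Cmod (p k * z ^ k) <= M * (Cmod z / r) ^ k.
Proof.
  intros Hr H k. rewrite Cmod_mult, Cmod_pow. unfold Rdiv. rewrite Rpow_mult_distr, pow_inv.
  pose proof (pow_lt r k Hr). pose proof (pow_le (Cmod z) k (Cmod_ge_0 z)).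
  specialize (H k).
  replace (Cmod (p k) * Cmod z ^ k) with (Cmod (p k) * r ^ k * (Cmod z ^ k * / r ^ k)) by (field; lra).
  apply Rmult_le_compat_r; [|exact H].
  apply Rmult_le_pos; [auto | apply Rlt_le, Rinv_0_lt_compat; auto].
Qed.

Lemma ratio_lt_1 (a r : R) : 0 <= a -> a < r -> 0 <= a / r < 1.
Proof.
  intros. split. apply Rmult_le_pos; [lra | apply Rlt_le, Rinv_0_lt_compat; lra].
  apply Rlt_div_l; lra.
Qed.

Lemma has_ps_bdd (p : nat -> C) (r : R) (v : C) : 0 <= r -> has_ps p (RtoC r) v -> bdd p r.
Proof.
  intros Hr H. destruct (has_ps_terms_bounded _ _ _ H) as [M HM]. exists M. intros n.
  specialize (HM n). rewrite Cmod_mult, Cmod_pow, Cmod_R, Rabs_pos_eq in HM by lra. exact HM.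
Qed.

(* [z = 0] is left out so that dividing by [z] is harmless. *)
Definition jet (N : nat) (phi : C -> C) (p : nat -> C) : Prop :=
  exists K d, 0 < d /\ forall z, 0 < Cmod z < d ->
    Cmod (phi z - psum p N z) <= K * Cmod z ^ N.

Lemma jet_pred (N : nat) (phi : C -> C) (p : nat -> C) : jet (S N) phi p -> jet N phi p.
Proof.
  intros (K & d & Hd & H). exists (Rabs K + Cmod (p N)), (Rmin d 1).
  split. apply Rmin_pos; lra. intros z Hz.
  assert (Z1 : Cmod z < d) by (eapply Rlt_le_trans; [apply Hz | apply Rmin_l]).
  assert (Z2 : Cmod z < 1) by (eapply Rlt_le_trans; [apply Hz | apply Rmin_r]).
  specialize (H z (conj (proj1 Hz) Z1)). simpl psum in H.
  replace (phi z - psum p N z)%C with ((phi z - (psum p N z + p N * z ^ N)) + p N * z ^ N)%C by ring.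
  eapply Rle_trans; [apply Cmod_triangle|]. rewrite Cmod_mult, Cmod_pow.
  pose proof (pow_le (Cmod z) N (Cmod_ge_0 z)). pose proof (Cmod_ge_0 z).
  assert (K * Cmod z ^ S N <= Rabs K * Cmod z ^ N).
  { apply Rle_trans with (Rabs K * Cmod z ^ S N).
    apply Rmult_le_compat_r; [apply pow_le; lra | apply Rle_abs].
    apply Rmult_le_compat_l; [apply Rabs_pos|]. simpl. nra. }
  lra.
Qed.

Lemma psum_ext (p q : nat -> C) (n : nat) (z : C) :
  (forall k, (k < n)%nat -> p k = q k) -> psum p n z = psum q n z.
Proof. intros H. induction n; simpl; [easy|]. rewrite IHn, H by (try lia; intros; apply H; lia). easy. Qed.

(** The lower coefficients agree by induction. Subtracting the two estimates at a small real x > 0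
    leaves |p N - q N| x^N <= (K1 + K2) x^(N + 1), and x tends to 0. *)
Lemma jet_unique (N : nat) (phi : C -> C) (p q : nat -> C) :
  jet N phi p -> jet N phi q -> forall k, (k < N)%nat -> p k = q k.
Proof.
  induction N; intros Hp Hq k Hk; [lia|].
  assert (IH : forall k, (k < N)%nat -> p k = q k) by (apply IHN; now apply jet_pred).
  destruct (Nat.eq_dec k N) as [->|]; [|apply IH; lia]. clear Hk IHN.
  destruct Hp as (K1 & d1 & Hd1 & H1). destruct Hq as (K2 & d2 & Hd2 & H2).
  apply Ceq_minus, Cmod_eq_0. apply Rle_antisym; [|apply Cmod_ge_0].
  apply le_epsilon. intros eps He. rewrite Rplus_0_l.
  destruct (lip_small (Rabs (K1 + K2)) eps) as [d3 [Hd3 H3]]; [apply Rabs_pos | exact He |].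
  set (x := Rmin (Rmin d1 d2) d3 / 2).
  assert (0 < Rmin (Rmin d1 d2) d3) by (repeat apply Rmin_pos; lra).
  pose proof (Rmin_l (Rmin d1 d2) d3). pose proof (Rmin_r (Rmin d1 d2) d3).
  pose proof (Rmin_l d1 d2). pose proof (Rmin_r d1 d2).
  assert (Hx : 0 < x) by (unfold x; lra).
  assert (Ex : Cmod (RtoC x) = x) by (rewrite Cmod_R, Rabs_pos_eq; lra).
  specialize (H1 (RtoC x)). specialize (H2 (RtoC x)). rewrite Ex in H1, H2.
  specialize (H1 ltac:(unfold x; lra)). specialize (H2 ltac:(unfold x; lra)).
  specialize (H3 x ltac:(lra) ltac:(unfold x; lra)).
  simpl psum in H1, H2. rewrite (psum_ext p q N) in H1 by exact IH.
  set (s := psum q N (RtoC x)) in *.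
  assert (B : Cmod ((p N - q N) * RtoC x ^ N) <= (K1 + K2) * x ^ S N).
  { replace ((p N - q N) * RtoC x ^ N)%C with
      ((phi (RtoC x) - (s + q N * RtoC x ^ N)) - (phi (RtoC x) - (s + p N * RtoC x ^ N)))%C by ring.
    eapply Rle_trans; [apply Cmod_triangle_minus|]. lra. }
  rewrite Cmod_mult, Cmod_pow, Ex in B.
  pose proof (pow_lt x N Hx). simpl pow in B.
  assert (Cmod (p N - q N) <= (K1 + K2) * x).
  { apply Rmult_le_reg_r with (x ^ N); [lra|]. lra. }
  pose proof (Rle_abs (K1 + K2)). nra.
Qed.

Lemma has_ps_jet (p : nat -> C) (phi : C -> C) (d : R) : 0 < d ->
  (forall z, Cmod z < d -> has_ps p z (phi z)) -> forall N, jet N phi p.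
Proof.
  intros Hd H N.
  assert (B : bdd p (d / 2)).
  { apply (has_ps_bdd _ _ (phi (RtoC (d / 2)))); [lra|]. apply H. rewrite Cmod_R, Rabs_pos_eq; lra. }
  destruct B as [M HM].
  (* The coefficients are controlled at radius d / 2. For |z| < d / 4 the ratio is at most 1/2, so
     the geometric tail costs a factor of at most 2. *)
  exists (M / (d / 2) ^ N * 2), (d / 4). split; [lra|]. intros z Hz.
  assert (Hx : 0 <= Cmod z / (d / 2) < 1) by (apply ratio_lt_1; [apply Cmod_ge_0 | lra]).
  assert (Hx2 : Cmod z / (d / 2) <= / 2) by (apply Rle_div_l; lra).
  eapply Rle_trans; [apply (has_ps_tail p z _ M (Cmod z / (d / 2)) Hx)|].
  - apply bdd_geom; [lra | exact HM].
  - apply H; lra.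
  - assert (HM0 : 0 <= M) by (specialize (HM 0%nat); simpl in HM; pose proof (Cmod_ge_0 (p 0%nat)); lra).
    set (x := Cmod z / (d / 2)) in *.
    replace (M / (d / 2) ^ N * 2 * Cmod z ^ N) with (M * x ^ N * 2).
    2: { unfold x, Rdiv. rewrite (Rpow_mult_distr (Cmod z)), pow_inv. ring. }
    unfold Rdiv. apply Rmult_le_compat_l.
    + apply Rmult_le_pos; [exact HM0 | apply pow_le; lra].
    + rewrite <- (Rinv_inv 2). apply Rinv_le_contravar; lra.
Qed.

Lemma has_ps_coef_unique (p q : nat -> C) (phi : C -> C) (d : R) : 0 < d ->
  (forall z, Cmod z < d -> has_ps p z (phi z)) ->
  (forall z, Cmod z < d -> has_ps q z (phi z)) -> forall n, p n = q n.
Proof.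
  intros Hd Hp Hq n. apply (jet_unique (S n) phi); [| |lia]; now apply (has_ps_jet _ _ d).
Qed.

Lemma has_ps_ext (p q : nat -> C) (z v : C) : (forall n, p n = q n) -> has_ps p z v -> has_ps q z v.
Proof.
  intros E H eps He. destruct (H eps He) as [N HN]. exists N. intros n Hn.
  rewrite <- (psum_ext p q) by auto. now apply HN.
Qed.

(** Cauchy's integral of f (w) / w^(n + 1) along |w| = r, divided by 2 pi i: the substitution dw = i
    w dt absorbs one factor w and the i. *)
Definition circle_coef (f : C -> C) (r : R) (n : nat) : C :=
  (CInt (fun t => (f (RtoC r * cis t) * (/ (RtoC r * cis t)) ^ n)%C) 0 (2 * PI) / RtoC (2 * PI))%C.

(** * Cauchy's coefficient integrals and the Taylor series at 0 *)

Section TaylorAtZero.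

Variables (f : C -> C) (rho : R).
Hypothesis Hf : forall w, Cmod w < rho -> exists l, cderiv f w l.

Let W (r t : R) : C := (RtoC r * cis t)%C.

Lemma circle_continuous (r t : R) : 0 < r < rho ->
  @continuous R_UniformSpace C_UniformSpace (fun t => f (W r t)) t.
Proof.
  intros Hr. destruct (Hf (W r t)) as [l Hl].
  { unfold W. rewrite (Cmod_W rho r Hr). lra. }
  apply (rderiv_continuous _ _ (l * (Ci * W r t))%C).
  apply (rderiv_comp f (W r)); [exact Hl | apply rderiv_W].
Qed.

Lemma circle_inv_continuous (r t : R) (n : nat) : 0 < r < rho ->
  @continuous R_UniformSpace C_UniformSpace (fun t => ((/ W r t) ^ n)%C) t.
Proof.
  intros Hr. induction n; simpl.
  - apply (@continuous_const R_UniformSpace C_UniformSpace).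
  - apply (continuous_R_Cmult (fun t => (/ W r t)%C)); [|exact IHn].
    apply (rderiv_continuous _ _ (RtoC 0 + / RtoC r * (RtoC (-1) * Ci * cis (-1 * t)))%C).
    intros eps He.
    destruct (rderiv_affine (fun s => cis (-1 * s)) t _ (RtoC 0) (/ RtoC r)%C (rderiv_cis (-1) t) eps He)
      as [d [Hd H]].
    exists d. split; [exact Hd|]. intros s Hs. specialize (H s Hs).
    assert (E : forall u, (/ W r u)%C = (RtoC 0 + / RtoC r * cis (-1 * u))%C).
    { intros u. replace (-1 * u) with (- u) by ring. rewrite <- cis_inv. unfold W.
      pose proof (cis_neq_0 u). field. split; [easy|]. intros E. apply RtoC_inj in E. lra. }
    rewrite !E. rewrite (Cplus_0_l (/ RtoC r * (RtoC (-1) * Ci * cis (-1 * t)))). exact H.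
Qed.

Lemma circle_coef_int (r : R) (n : nat) : 0 < r < rho ->
  is_CInt (fun t => (f (W r t) * (/ W r t) ^ n)%C) 0 (2 * PI) (RtoC (2 * PI) * circle_coef f r n)%C.
Proof.
  intros Hr. pose proof PI_RGT_0.
  assert (I : is_CInt (fun t => (f (W r t) * (/ W r t) ^ n)%C) 0 (2 * PI)
    (CInt (fun t => (f (W r t) * (/ W r t) ^ n)%C) 0 (2 * PI))).
  { apply is_CInt_CInt; [lra|]. intros t _.
    apply continuous_R_Cmult; [now apply circle_continuous | now apply circle_inv_continuous]. }
  set (X := CInt (fun t => (f (W r t) * (/ W r t) ^ n)%C) 0 (2 * PI) : C) in I.
  change (is_CInt (fun t => (f (W r t) * (/ W r t) ^ n)%C) 0 (2 * PI)
    (RtoC (2 * PI) * (X / RtoC (2 * PI)))%C).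
  replace (RtoC (2 * PI) * (X / RtoC (2 * PI)))%C with X; [exact I|].
  field. intros E. apply RtoC_inj in E. lra.
Qed.

Lemma circle_bounded (r : R) : 0 < r < rho ->
  exists M, forall t, 0 <= t <= 2 * PI -> Cmod (f (W r t)) <= M.
Proof.
  intros Hr. pose proof PI_RGT_0.
  destruct (continuity_ab_maj (fun t => Cmod (f (W r t))) 0 (2 * PI)) as [t0 [H1 _]]; [lra| |eauto].
  intros t _. apply continuity_pt_filterlim.
  apply (continuous_comp (V := C_UniformSpace) (fun t => f (W r t)) Cmod).
  - now apply circle_continuous.
  - intros P [e HP]. apply (locally_C_intro _ _ e (cond_pos e)). intros w Hw. apply HP.
    eapply Rle_lt_trans; [|exact Hw].
    unfold abs, minus, plus, opp; simpl. apply Rabs_le.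
    pose proof (Cmod_triangle (w - f (W r t)) (f (W r t))).
    pose proof (Cmod_triangle (f (W r t) - w) w).
    replace (w - f (W r t) + f (W r t))%C with w in * by ring.
    replace (f (W r t) - w + w)%C with (f (W r t)) in * by ring.
    rewrite (Cmod_sym (f (W r t)) w) in *. lra.
Qed.

Lemma circle_coef_bound (r M : R) (n : nat) : 0 < r < rho ->
  (forall w, Cmod w < rho -> Cmod (f w) <= M) -> Cmod (circle_coef f r n) * r ^ n <= M.
Proof.
  intros Hr HM. pose proof PI_RGT_0. pose proof (pow_lt r n (proj1 Hr)).
  pose proof (circle_coef_int r n Hr) as I.
  apply (is_CInt_bound _ _ _ (M / r ^ n)) in I; [|lra|].
  - rewrite Cmod_mult, Cmod_R, Rabs_pos_eq in I by lra.
    apply Rmult_le_reg_l with (2 * PI); [lra|].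
    apply Rmult_le_compat_r with (r := r ^ n) in I; [|lra].
    replace ((2 * PI - 0) * (M / r ^ n) * r ^ n) with (2 * PI * M) in I by (field; lra). lra.
  - intros t _. rewrite Cmod_mult, Cmod_pow, Cmod_inv by (unfold W; now apply (W_neq_0 rho)).
    assert (E : Cmod (W r t) = r) by (now apply (Cmod_W rho)).
    rewrite E, pow_inv. apply Rmult_le_compat_r; [apply Rlt_le, Rinv_0_lt_compat; lra|].
    apply HM. rewrite E. lra.
Qed.

(* Expanding the Cauchy kernel [w / (w - z) = sum_(k < n) (z/w)^k + (z/w)^n w / (w - z)]. *)
Lemma cauchy_remainder (r : R) (z : C) (n : nat) : 0 < r < rho -> Cmod z < r ->
  is_CInt (fun t => ((f (W r t) - f z) * (z / W r t) ^ S n * (W r t / (W r t - z)))%C) 0 (2 * PI)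
    (RtoC (2 * PI) * (f z - psum (circle_coef f r) (S n) z))%C.
Proof.
  intros Hr Hz. pose proof PI_RGT_0.
  assert (Wn : forall t, W r t <> RtoC 0) by (intros; unfold W; now apply (W_neq_0 rho)).
  assert (Wz : forall t, (W r t - z)%C <> RtoC 0).
  { intros t E. assert (E2 : W r t = z) by (replace (W r t) with (W r t - z + z)%C by ring; rewrite E; ring).
    assert (E3 : Cmod (W r t) = r) by (now apply (Cmod_W rho)). rewrite E2 in E3. lra. }
  assert (I0 : is_CInt (fun t => ((f (W r t) - f z) * (W r t / (W r t - z)))%C) 0 (2 * PI) (RtoC 0)).
  { pose proof (cauchy_circle f rho r Hf Hr z Hz) as I.
    apply (is_CInt_scal _ _ _ (/ Ci)%C) in I. rewrite Cmult_0_r in I.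
    refine (is_CInt_ext _ _ _ _ _ _ _ I); [lra|]. intros t _. change (RtoC r * cis t)%C with (W r t). field. split; [apply Wz | apply Ci_nz]. }
  (* The positive powers of z / W integrate to 0 over the circle, so the subtracted constant f z
     contributes only for k = 0. *)
  assert (Step : forall k, is_CInt (fun t => ((f (W r t) - f z) * (z / W r t) ^ k)%C) 0 (2 * PI)
    (RtoC (2 * PI) * (circle_coef f r k * z ^ k - match k with O => f z | _ => RtoC 0 end))%C).
  { intros k.
    pose proof (is_CInt_scal _ _ _ (z ^ k)%C _ (circle_coef_int r k Hr)) as I1.
    assert (I2 : is_CInt (fun t => (f z * (z / W r t) ^ k)%C) 0 (2 * PI)
      (RtoC (2 * PI) * match k with O => f z | _ => RtoC 0 end)%C).
    { destruct k.
      - simpl. pose proof (is_CInt_const 0 (2 * PI) (f z)) as I2. rewrite Rminus_0_r in I2.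
        refine (is_CInt_ext _ _ _ _ _ _ _ I2); [lra|]. intros; ring.
      - pose proof (is_CInt_scal _ _ _ (f z * (z / RtoC r) ^ S k)%C _ (is_CInt_cis_pow k)) as I2.
        rewrite Cmult_0_r in I2. rewrite Cmult_0_r.
        refine (is_CInt_ext _ _ _ _ _ _ _ I2); [lra|]. intros t _.
        replace (z / W r t)%C with (z / RtoC r * / cis t)%C.
        2: { unfold W. pose proof (cis_neq_0 t). field. split; [easy|]. intros E; apply RtoC_inj in E; lra. }
        rewrite Cpow_mult_l. ring. }
    pose proof (is_CInt_minus _ _ _ _ _ _ I1 I2) as I.
    replace (RtoC (2 * PI) * (circle_coef f r k * z ^ k - match k with O => f z | _ => RtoC 0 end))%C
      with (z ^ k * (RtoC (2 * PI) * circle_coef f r k) - RtoC (2 * PI) * match k with O => f z | _ => RtoC 0 end)%C by ring.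
    refine (is_CInt_ext _ _ _ _ _ _ _ I); [lra|]. intros t _.
    unfold Cdiv. rewrite Cpow_mult_l. ring. }
  (* One more term of the kernel is split off with W / (W - z) - 1 = (z / W) (W / (W - z)). *)
  assert (Next : forall k v,
    is_CInt (fun t => ((f (W r t) - f z) * (z / W r t) ^ k * (W r t / (W r t - z)))%C) 0 (2 * PI) v ->
    is_CInt (fun t => ((f (W r t) - f z) * (z / W r t) ^ S k * (W r t / (W r t - z)))%C) 0 (2 * PI)
      (v - RtoC (2 * PI) * (circle_coef f r k * z ^ k - match k with O => f z | _ => RtoC 0 end))%C).
  { intros k v I. pose proof (is_CInt_minus _ _ _ _ _ _ I (Step k)) as J.
    refine (is_CInt_ext _ _ _ _ _ _ _ J); [lra|]. intros t _. rewrite Cpow_S. field. split; auto. }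
  induction n.
  - assert (I1 : is_CInt (fun t => ((f (W r t) - f z) * (z / W r t) ^ 0 * (W r t / (W r t - z)))%C) 0 (2 * PI) (RtoC 0)).
    { refine (is_CInt_ext _ _ _ _ _ _ _ I0); [lra|]. intros t _. simpl. ring. }
    apply Next in I1.
    change (psum (circle_coef f r) 1 z) with (RtoC 0 + circle_coef f r 0%nat * z ^ 0)%C.
    replace (RtoC (2 * PI) * (f z - (RtoC 0 + circle_coef f r 0%nat * z ^ 0)))%C with
      (RtoC 0 - RtoC (2 * PI) * (circle_coef f r 0 * z ^ 0 - f z))%C by ring.
    exact I1.
  - apply Next in IHn.
    replace (RtoC (2 * PI) * (f z - psum (circle_coef f r) (S (S n)) z))%C with
      (RtoC (2 * PI) * (f z - psum (circle_coef f r) (S n) z) - RtoC (2 * PI) * (circle_coef f r (S n) * z ^ S n - RtoC 0))%C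
      by (change (psum (circle_coef f r) (S (S n)) z) with
            (psum (circle_coef f r) (S n) z + circle_coef f r (S n) * z ^ S n)%C; ring).
    exact IHn.
Qed.

Lemma circle_coef_has_ps (r : R) (z : C) : 0 < r < rho -> Cmod z < r ->
  has_ps (circle_coef f r) z (f z).
Proof.
  intros Hr Hz. pose proof PI_RGT_0. destruct (circle_bounded r Hr) as [M HM].
  set (x := Cmod z / r). assert (Hx : 0 <= x < 1) by (apply ratio_lt_1; [apply Cmod_ge_0 | exact Hz]).
  (* Bounds (f W - f z) W / (W - z) on the circle; the factor (z / W)^(n + 1) supplies the geometric
     decay. *)
  set (K := (M + Cmod (f z)) * (r / (r - Cmod z))).
  assert (HK : 0 <= K).
  { apply Rmult_le_pos. pose proof (HM 0 ltac:(lra)). pose proof (Cmod_ge_0 (f (W r 0))). pose proof (Cmod_ge_0 (f z)). lra.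
    apply Rlt_le, Rdiv_lt_0_compat; lra. }
  intros eps He. destruct (pow_small K x eps HK Hx He) as [N HN].
  exists (S N). intros n Hn. destruct n as [|n]; [lia|].
  eapply Rle_lt_trans; [|apply (HN (S n)); lia].
  pose proof (cauchy_remainder r z n Hr Hz) as I.
  apply (is_CInt_bound _ _ _ (K * x ^ S n)) in I; [|lra|].
  - rewrite Cmod_mult, Cmod_R, Rabs_pos_eq in I by lra. rewrite Rminus_0_r in I.
    apply Rmult_le_reg_l in I; [exact I | lra].
  - intros t Ht.
    assert (E : Cmod (W r t) = r) by (now apply (Cmod_W rho)).
    assert (Wn : W r t <> RtoC 0) by (unfold W; now apply (W_neq_0 rho)).
    assert (D : r - Cmod z <= Cmod (W r t - z)).
    { pose proof (Cmod_triangle (W r t - z) z). replace (W r t - z + z)%C with (W r t) in * by ring. lra. }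
    assert (Wz : (W r t - z)%C <> RtoC 0) by (apply Cmod_gt_0; lra).
    rewrite !Cmod_mult, Cmod_pow, !Cmod_div, E by assumption. fold x.
    unfold K. replace ((M + Cmod (f z)) * (r / (r - Cmod z)) * x ^ S n) with
      ((M + Cmod (f z)) * x ^ S n * (r / (r - Cmod z))) by ring.
    apply Rmult_le_compat.
    + apply Rmult_le_pos; [apply Cmod_ge_0 | apply pow_le; lra].
    + apply Rmult_le_pos; [lra | apply Rlt_le, Rinv_0_lt_compat; lra].
    + apply Rmult_le_compat_r; [apply pow_le; lra|].
      eapply Rle_trans; [apply Cmod_triangle_minus|]. apply Rplus_le_compat_r, HM, Ht.
    + apply Rmult_le_compat_l; [lra|]. apply Rinv_le_contravar; lra.
Qed.

End TaylorAtZero.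

Definition analytic_on_disk (f : C -> C) (c : C) (rho : R) (p : nat -> C) : Prop :=
  forall z, Cmod (z - c) < rho -> has_ps p (z - c) (f z).

Lemma cderiv_shift (f : C -> C) (c w l : C) :
  cderiv f (c + w)%C l -> cderiv (fun w => f (c + w)%C) w l.
Proof.
  intros H eps He. destruct (H eps He) as [d [Hd H1]]. exists d. split; [exact Hd|].
  intros v Hv. specialize (H1 (c + v)%C). replace (c + v - (c + w))%C with (v - w)%C in H1 by ring. auto.
Qed.

(** Every radius r < rho gives a series valid for |z - c| < r. Two of them agree near [c], so by
    uniqueness the coefficients do not depend on r, and one series serves the whole disk and all
    Cauchy estimates. *)
Theorem taylor_on_disk (f : C -> C) (c : C) (rho : R) : 0 < rho ->
  (forall w, Cmod (w - c) < rho -> exists l, cderiv f w l) ->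
  exists p, analytic_on_disk f c rho p /\
    forall M r, 0 < r < rho -> (forall w, Cmod (w - c) < rho -> Cmod (f w) <= M) ->
      forall n, Cmod (p n) * r ^ n <= M.
Proof.
  intros Hrho Hf. set (f0 := fun w => f (c + w)%C).
  assert (Hf0 : forall w, Cmod w < rho -> exists l, cderiv f0 w l).
  { intros w Hw. destruct (Hf (c + w)%C) as [l Hl].
    - replace (c + w - c)%C with w by ring. exact Hw.
    - exists l. now apply cderiv_shift. }
  assert (Same : forall r, 0 < r < rho -> forall n, circle_coef f0 r n = circle_coef f0 (rho / 2) n).
  { intros r Hr. assert (0 < Rmin r (rho / 2)) by (apply Rmin_pos; lra).
    pose proof (Rmin_l r (rho / 2)). pose proof (Rmin_r r (rho / 2)).
    apply (has_ps_coef_unique _ _ f0 (Rmin r (rho / 2))); [lra | |];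
      intros z Hz; apply (circle_coef_has_ps f0 rho Hf0); lra. }
  exists (circle_coef f0 (rho / 2)). split.
  - intros z Hz. pose proof (Cmod_ge_0 (z - c)).
    apply (has_ps_ext (circle_coef f0 ((Cmod (z - c) + rho) / 2))).
    + apply Same; lra.
    + replace (f z) with (f0 (z - c)%C) by (unfold f0; f_equal; ring).
      apply (circle_coef_has_ps f0 rho Hf0); lra.
  - intros M r Hr HM n. rewrite <- (Same r Hr). apply (circle_coef_bound f0 rho Hf0); [exact Hr|].
    intros w Hw. apply HM. replace (c + w - c)%C with w by ring. exact Hw.
Qed.

(** * Termwise differentiation *)

Definition pder (p : nat -> C) (n : nat) : C := (RtoC (INR (S n)) * p (S n))%C.

(** Because (n + 1) x^n <= 1 + x + ... + x^n <= 1 / (1 - x). *)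
Lemma mul_pow_bound (x : R) (n : nat) : 0 <= x < 1 -> INR (S n) * x ^ n <= / (1 - x).
Proof.
  intros Hx. assert (P : forall n, x ^ n <= 1).
  { intros k. rewrite <- (pow1 k). apply pow_incr. lra. }
  induction n.
  - simpl. rewrite Rmult_1_r. rewrite <- Rinv_1 at 1. apply Rinv_le_contravar; lra.
  - rewrite S_INR. replace ((INR (S n) + 1) * x ^ S n) with (x * (INR (S n) * x ^ n) + x ^ S n) by (simpl; ring).
    replace (/ (1 - x)) with (x * / (1 - x) + 1) by (field; lra).
    specialize (P (S n)). apply Rplus_le_compat; [|exact P]. apply Rmult_le_compat_l; lra.
Qed.

Lemma bdd_mul_S (p : nat -> C) (r s : R) : 0 < s < r -> bdd p r ->
  bdd (fun n => (RtoC (INR (S n)) * p n)%C) s.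
Proof.
  intros Hs [M HM]. exists (M * / (1 - s / r)). intros n.
  assert (Hx : 0 <= s / r < 1) by (apply ratio_lt_1; lra).
  rewrite Cmod_mult, Cmod_R, Rabs_pos_eq by apply pos_INR.
  replace (INR (S n) * Cmod (p n) * s ^ n) with (Cmod (p n) * r ^ n * (INR (S n) * (s / r) ^ n)).
  2: { unfold Rdiv. rewrite Rpow_mult_distr, pow_inv. field. apply pow_nonzero; intro; subst; lra. }
  apply Rmult_le_compat.
  - apply Rmult_le_pos; [apply Cmod_ge_0 | apply pow_le; lra].
  - apply Rmult_le_pos; [apply pos_INR | apply pow_le; lra].
  - apply HM.
  - now apply mul_pow_bound.
Qed.

Lemma bdd_shift (p : nat -> C) (r : R) : 0 < r -> bdd p r -> bdd (fun n => p (S n)) r.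
Proof.
  intros Hr [M HM]. exists (M / r). intros n. apply (Rle_div_r _ M r); [lra|].
  specialize (HM (S n)). simpl in HM. rewrite Rmult_assoc, (Rmult_comm (r ^ n)). exact HM.
Qed.

Lemma bdd_pder (p : nat -> C) (r s : R) : 0 < s < r -> bdd p r -> bdd (pder p) s.
Proof. intros Hs H. apply (bdd_mul_S (fun n => p (S n)) r s Hs). apply bdd_shift; [lra | exact H]. Qed.

(** The second-order remainder of a power. The factor [s] on the left turns the expected exponent n
    - 1 into n, so that n = 0 fits the same formula. *)
Lemma pow_quad (z w : C) (s : R) (n : nat) : Cmod z <= s -> Cmod w <= s ->
  s * Cmod (w ^ S n - z ^ S n - RtoC (INR (S n)) * z ^ n * (w - z))
    <= INR (S n) * INR (S n) * s ^ n * Cmod (w - z) ^ 2.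
Proof.
  intros Hz Hw. assert (Hs : 0 <= s) by (pose proof (Cmod_ge_0 z); lra).
  induction n.
  - replace (w ^ 1 - z ^ 1 - RtoC (INR 1) * z ^ 0 * (w - z))%C with (RtoC 0) by (simpl; ring).
    rewrite Cmod_0. simpl. pose proof (Cmod_ge_0 (w - z)). nra.
  - replace (w ^ S (S n) - z ^ S (S n) - RtoC (INR (S (S n))) * z ^ S n * (w - z))%C with
      (w * (w ^ S n - z ^ S n - RtoC (INR (S n)) * z ^ n * (w - z))
       + RtoC (INR (S n)) * z ^ n * ((w - z) * (w - z)))%C.
    2: { rewrite (S_INR (S n)), RtoC_plus, !Cpow_S. ring. }
    set (e := (w ^ S n - z ^ S n - RtoC (INR (S n)) * z ^ n * (w - z))%C) in *.
    assert (T : Cmod (w * e + RtoC (INR (S n)) * z ^ n * ((w - z) * (w - z))) <=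
       s * Cmod e + INR (S n) * s ^ n * Cmod (w - z) ^ 2).
    { eapply Rle_trans; [apply Cmod_triangle|]. rewrite !Cmod_mult, Cmod_pow, Cmod_R, Rabs_pos_eq by apply pos_INR.
      apply Rplus_le_compat; [apply Rmult_le_compat_r; [apply Cmod_ge_0 | exact Hw]|].
      replace (Cmod (w - z) ^ 2) with (Cmod (w - z) * Cmod (w - z)) by ring.
      apply Rmult_le_compat_r; [apply Rmult_le_pos; apply Cmod_ge_0|].
      apply Rmult_le_compat_l; [apply pos_INR|]. apply pow_incr. split; [apply Cmod_ge_0 | exact Hz]. }
    apply Rmult_le_compat_l with (r := s) in T; [|exact Hs].
    eapply Rle_trans; [exact T|].
    apply Rmult_le_compat_l with (r := s) in IHn; [|exact Hs].
    rewrite (S_INR (S n)). set (k := INR (S n)) in *. assert (0 <= k) by apply pos_INR.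
    replace ((k + 1) * (k + 1) * s ^ S n * Cmod (w - z) ^ 2) with
      (s * (k * k * s ^ n * Cmod (w - z) ^ 2) + s * (k * s ^ n * Cmod (w - z) ^ 2)
       + (k + 1) * (s * s ^ n * Cmod (w - z) ^ 2)) by (simpl; ring).
    assert (0 <= s * s ^ n * Cmod (w - z) ^ 2).
    { apply Rmult_le_pos; [apply Rmult_le_pos; [exact Hs | now apply pow_le] | apply pow2_ge_0]. }
    nra.
Qed.

Lemma psum_quad (p : nat -> C) (s r M : R) (z w : C) (n : nat) : 0 < s < r ->
  (forall k, Cmod (p (S k)) * (INR (S k) * INR (S k)) * r ^ k <= M) ->
  Cmod z <= s -> Cmod w <= s ->
  s * Cmod (psum p (S n) w - psum p (S n) z - psum (pder p) n z * (w - z))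
    <= Cmod (w - z) ^ 2 * (M * ((1 - (s / r) ^ n) / (1 - s / r))).
Proof.
  intros Hs HM Hz Hw. assert (Hx : 0 <= s / r < 1) by (apply ratio_lt_1; lra).
  induction n.
  - replace (psum p 1 w - psum p 1 z - psum (pder p) 0 z * (w - z))%C with (RtoC 0) by (simpl; ring).
    rewrite Cmod_0. simpl. replace ((1 - 1) / (1 - s / r)) with 0 by (field; split; lra). lra.
  - replace (psum p (S (S n)) w - psum p (S (S n)) z - psum (pder p) (S n) z * (w - z))%C with
      ((psum p (S n) w - psum p (S n) z - psum (pder p) n z * (w - z)) +
       p (S n) * (w ^ S n - z ^ S n - RtoC (INR (S n)) * z ^ n * (w - z)))%C.
    2: { change (psum p (S (S n)) w) with (psum p (S n) w + p (S n) * w ^ S n)%C.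
         change (psum p (S (S n)) z) with (psum p (S n) z + p (S n) * z ^ S n)%C.
         change (psum (pder p) (S n) z) with (psum (pder p) n z + pder p n * z ^ n)%C.
         unfold pder. ring. }
    set (A := (psum p (S n) w - psum p (S n) z - psum (pder p) n z * (w - z))%C) in *.
    pose proof (pow_quad z w s n Hz Hw) as Q.
    set (e := (w ^ S n - z ^ S n - RtoC (INR (S n)) * z ^ n * (w - z))%C) in *.
    pose proof (Cmod_triangle A (p (S n) * e)%C) as T. rewrite Cmod_mult in T.
    apply Rmult_le_compat_l with (r := s) in T; [|lra].
    eapply Rle_trans; [exact T|].
    assert (B : s * (Cmod (p (S n)) * Cmod e) <= Cmod (w - z) ^ 2 * (M * (s / r) ^ n)).
    { apply Rmult_le_compat_l with (r := Cmod (p (S n))) in Q; [|apply Cmod_ge_0].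
      specialize (HM n).
      assert (E : Cmod (p (S n)) * (INR (S n) * INR (S n) * s ^ n * Cmod (w - z) ^ 2) =
        Cmod (w - z) ^ 2 * (Cmod (p (S n)) * (INR (S n) * INR (S n)) * r ^ n * (s / r) ^ n)).
      { unfold Rdiv. rewrite Rpow_mult_distr, pow_inv. field. apply pow_nonzero; lra. }
      rewrite E in Q.
      assert (Cmod (w - z) ^ 2 * (Cmod (p (S n)) * (INR (S n) * INR (S n)) * r ^ n * (s / r) ^ n)
        <= Cmod (w - z) ^ 2 * (M * (s / r) ^ n)).
      { apply Rmult_le_compat_l; [apply pow2_ge_0|]. apply Rmult_le_compat_r; [apply pow_le; lra | exact HM]. }
      lra. }
    replace ((1 - (s / r) ^ S n) / (1 - s / r)) with ((1 - (s / r) ^ n) / (1 - s / r) + (s / r) ^ n)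
      by (simpl; field; split; lra).
    lra.
Qed.

Lemma has_ps_quad (p : nat -> C) (s r : R) : 0 < s < r -> bdd p r ->
  exists K, forall z w fz fw D, Cmod z <= s -> Cmod w <= s ->
    has_ps p z fz -> has_ps p w fw -> has_ps (pder p) z D ->
    Cmod (fw - fz - D * (w - z)) <= K * Cmod (w - z) ^ 2.
Proof.
  (* Each of the two factors n + 1 in [pow_quad] costs a little radius: first from [r] to [r2], then
     from [r2] to [r1], which still exceeds [s]. *)
  intros Hs Hp. set (r1 := (s + r) / 2). set (r2 := (r1 + r) / 2).
  assert (B : bdd (fun n => (RtoC (INR (S n)) * (RtoC (INR (S n)) * p (S n)))%C) r1).
  { apply (bdd_mul_S (fun n => (RtoC (INR (S n)) * p (S n))%C) r2); [unfold r2, r1; lra|].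
    apply (bdd_mul_S (fun n => p (S n)) r); [unfold r2, r1; lra|]. apply bdd_shift; [lra | exact Hp]. }
  destruct B as [M HM].
  assert (HM' : forall k, Cmod (p (S k)) * (INR (S k) * INR (S k)) * r1 ^ k <= M).
  { intros k. specialize (HM k). rewrite !Cmod_mult, !Cmod_R, !Rabs_pos_eq in HM by apply pos_INR. lra. }
  assert (M0 : 0 <= M).
  { eapply Rle_trans; [|apply (HM' 0%nat)]. simpl. pose proof (Cmod_ge_0 (p 1%nat)). lra. }
  assert (Hs1 : 0 < s < r1) by (unfold r1; lra).
  assert (Hx : 0 <= s / r1 < 1) by (apply ratio_lt_1; lra).
  set (K := M / (1 - s / r1)).
  exists (K / s). intros z w fz fw D Hz Hw Hfz Hfw HD.
  assert (Bn : forall n, Cmod (psum p (S n) w - psum p (S n) z - psum (pder p) n z * (w - z)) <= K / s * Cmod (w - z) ^ 2).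
  { intros n. apply Rmult_le_reg_l with s; [lra|].
    eapply Rle_trans; [apply (psum_quad p s r1 M z w n Hs1 HM' Hz Hw)|].
    replace (s * (K / s * Cmod (w - z) ^ 2)) with (Cmod (w - z) ^ 2 * K) by (field; lra).
    apply Rmult_le_compat_l; [apply pow2_ge_0|]. unfold K, Rdiv.
    apply Rmult_le_compat_l; [exact M0|].
    rewrite <- (Rmult_1_l (/ (1 - s * / r1))) at 2. apply Rmult_le_compat_r.
    apply Rlt_le, Rinv_0_lt_compat; unfold Rdiv in *; lra.
    pose proof (pow_le (s * / r1) n). unfold Rdiv in *. lra. }
  apply le_epsilon. intros eps He.
  set (e := eps / (2 + Cmod (w - z))). pose proof (Cmod_ge_0 (w - z)) as Hh.
  assert (He' : 0 < e) by (apply Rdiv_lt_0_compat; lra).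
  destruct (Hfz e He') as [N1 H1]. destruct (Hfw e He') as [N2 H2]. destruct (HD e He') as [N3 H3].
  set (n := (N1 + N2 + N3)%nat).
  specialize (H1 (S n) ltac:(unfold n; lia)). specialize (H2 (S n) ltac:(unfold n; lia)).
  specialize (H3 n ltac:(unfold n; lia)). specialize (Bn n).
  replace (fw - fz - D * (w - z))%C with
    ((psum p (S n) w - psum p (S n) z - psum (pder p) n z * (w - z)) +
     ((fw - psum p (S n) w) - (fz - psum p (S n) z) - (D - psum (pder p) n z) * (w - z)))%C by ring.
  eapply Rle_trans; [apply Cmod_triangle|]. apply Rplus_le_compat; [exact Bn|].
  eapply Rle_trans; [apply Cmod_triangle_minus|].
  pose proof (Cmod_triangle_minus (fw - psum p (S n) w) (fz - psum p (S n) z)).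
  rewrite Cmod_mult.
  assert (Cmod (D - psum (pder p) n z) * Cmod (w - z) <= e * Cmod (w - z)) by (apply Rmult_le_compat_r; lra).
  replace eps with (e * (2 + Cmod (w - z))) by (unfold e; field; lra). lra.
Qed.

Lemma cderiv_quad (f : C -> C) (z d : C) (K r : R) : 0 < r ->
  (forall w, Cmod (w - z) < r -> Cmod (f w - f z - d * (w - z)) <= K * Cmod (w - z) ^ 2) ->
  cderiv f z d.
Proof.
  intros Hr H eps He.
  destruct (lip_small (Rabs K) eps) as [d1 [Hd1 H1]]; [apply Rabs_pos | exact He |].
  exists (Rmin r d1). split; [now apply Rmin_pos|]. intros w Hw.
  specialize (H w (Rlt_le_trans _ _ _ Hw (Rmin_l _ _))).
  specialize (H1 _ (Cmod_ge_0 _) (Rlt_le_trans _ _ _ Hw (Rmin_r _ _))).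
  eapply Rle_trans; [exact H|]. pose proof (Cmod_ge_0 (w - z)). pose proof (Rle_abs K).
  replace (K * Cmod (w - z) ^ 2) with (K * Cmod (w - z) * Cmod (w - z)) by ring.
  apply Rmult_le_compat_r; [lra|]. nra.
Qed.

Lemma analytic_bdd (f : C -> C) (c : C) (rho r : R) (p : nat -> C) :
  0 <= r < rho -> analytic_on_disk f c rho p -> bdd p r.
Proof.
  intros Hr H. apply (has_ps_bdd _ _ (f (c + RtoC r)%C)); [lra|].
  specialize (H (c + RtoC r)%C). replace (c + RtoC r - c)%C with (RtoC r) in H by ring.
  apply H. rewrite Cmod_R, Rabs_pos_eq; lra.
Qed.

Lemma bdd_has_ps (p : nat -> C) (r : R) (z : C) : Cmod z < r -> bdd p r -> exists v, has_ps p z v.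
Proof.
  intros Hz [M HM]. pose proof (Cmod_ge_0 z).
  apply (has_ps_exists p z M (Cmod z / r)); [apply ratio_lt_1; lra | apply bdd_geom; [lra | exact HM]].
Qed.

Lemma analytic_cderiv (f : C -> C) (c : C) (rho : R) (p : nat -> C) :
  analytic_on_disk f c rho p -> forall z, Cmod (z - c) < rho ->
  exists D, has_ps (pder p) (z - c) D /\ cderiv f z D.
Proof.
  intros H z Hz. pose proof (Cmod_ge_0 (z - c)) as Hz0.
  set (s := (2 * Cmod (z - c) + rho) / 3). set (r := (Cmod (z - c) + 2 * rho) / 3).
  assert (Hs : 0 < s < r) by (unfold s, r; lra).
  assert (Hp : bdd p r) by (apply (analytic_bdd f c rho); [unfold r; lra | exact H]).
  destruct (bdd_has_ps (pder p) s (z - c)) as [D HD]; [unfold s; lra | now apply (bdd_pder p r) |].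
  exists D. split; [exact HD|].
  destruct (has_ps_quad p s r Hs Hp) as [K HK].
  apply (cderiv_quad f z D K (s - Cmod (z - c))); [unfold s; lra|].
  intros w Hw. replace (w - z)%C with ((w - c) - (z - c))%C by ring.
  assert (Hwc : Cmod (w - c) < s).
  { replace (w - c)%C with ((w - z) + (z - c))%C by ring. pose proof (Cmod_triangle (w - z) (z - c)). lra. }
  apply HK; auto; try (apply H; unfold s in *; lra); unfold s in *; lra.
Qed.

Lemma cderiv_C_derive (f : C -> C) (z d : C) : cderiv f z d -> C_derive f z = d.
Proof. intros H. apply is_C_derive_unique. now apply cderiv_is_derive. Qed.

Lemma analytic_C_derive (f : C -> C) (c : C) (rho : R) (p : nat -> C) :
  analytic_on_disk f c rho p -> analytic_on_disk (C_derive f) c rho (pder p).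
Proof.
  intros H z Hz. destruct (analytic_cderiv f c rho p H z Hz) as [D [H1 H2]].
  now rewrite (cderiv_C_derive _ _ _ H2).
Qed.

Lemma analytic_C_derive_n (f : C -> C) (c : C) (rho : R) (p : nat -> C) (n : nat) :
  analytic_on_disk f c rho p -> analytic_on_disk (C_derive_n n f) c rho (Nat.iter n pder p).
Proof. intros H. induction n; [exact H | now apply analytic_C_derive]. Qed.

(** The n-th derivative multiplies by (n + k)! / k!; with denominators cleared, the induction stays
    a ring identity. *)
Lemma iter_pder (p : nat -> C) (n k : nat) :
  (RtoC (INR (fact k)) * Nat.iter n pder p k = RtoC (INR (fact (n + k))) * p (n + k)%nat)%C.
Proof.
  revert k. induction n; intros k; [easy|]. simpl Nat.iter. unfold pder at 1.
  specialize (IHn (S k)). rewrite Nat.add_succ_r in IHn. rewrite Nat.add_succ_l, <- IHn.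
  rewrite (fact_simpl k), mult_INR, RtoC_mult. ring.
Qed.

Lemma has_ps_0 (p : nat -> C) (v : C) : has_ps p (RtoC 0) v -> v = p 0%nat.
Proof.
  intros H. apply (has_ps_unique p (RtoC 0)); [exact H|].
  intros eps He. exists 1%nat. intros n Hn. destruct n as [|n]; [lia|].
  replace (psum p (S n) (RtoC 0)) with (p 0%nat).
  - replace (p 0%nat - p 0%nat)%C with (RtoC 0) by ring. now rewrite Cmod_0.
  - induction n; [simpl; ring|]. change (p 0%nat = psum p (S n) (RtoC 0) + p (S n) * (RtoC 0) ^ S n)%C.
    rewrite <- IHn by lia. rewrite Cpow_S. ring.
Qed.

(** Built on [C_derive_n], in which the non-negativity of a system is phrased, so that the double
    coefficients of [f] become values of [D1D2] up to factorials. *)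
Definition tc (f : C -> C) (c : C) (n : nat) : C :=
  (C_derive_n n f c / RtoC (INR (fact n)))%C.

Lemma RtoC_fact_neq_0 n : RtoC (INR (fact n)) <> RtoC 0.
Proof. intros E. apply RtoC_inj in E. pose proof (INR_fact_lt_0 n). lra. Qed.

Lemma analytic_tc (f : C -> C) (c : C) (rho : R) (p : nat -> C) : 0 < rho ->
  analytic_on_disk f c rho p -> forall n, p n = tc f c n.
Proof.
  intros Hr H n. unfold tc. pose proof (analytic_C_derive_n f c rho p n H c) as E.
  replace (c - c)%C with (RtoC 0) in E by ring. rewrite Cmod_0 in E.
  specialize (E Hr). apply has_ps_0 in E. rewrite E.
  pose proof (iter_pder p n 0) as I. rewrite Nat.add_0_r in I. simpl (fact 0) in I.
  replace (Nat.iter n pder p 0%nat) with (RtoC (INR 1) * Nat.iter n pder p 0%nat)%C by (simpl; ring).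
  rewrite I. field. apply RtoC_fact_neq_0.
Qed.

Lemma analytic_ext_coef (f : C -> C) (c : C) (rho : R) (p q : nat -> C) :
  (forall n, p n = q n) -> analytic_on_disk f c rho p -> analytic_on_disk f c rho q.
Proof. intros E H z Hz. apply (has_ps_ext p q); auto. Qed.

Definition holo_disk (f : C -> C) (c : C) (rho : R) : Prop :=
  forall w, Cmod (w - c) < rho -> exists l, cderiv f w l.

Theorem taylor (f : C -> C) (c : C) (rho : R) : 0 < rho -> holo_disk f c rho ->
  analytic_on_disk f c rho (tc f c) /\
  forall M r, 0 < r < rho -> (forall w, Cmod (w - c) < rho -> Cmod (f w) <= M) ->
    forall n, Cmod (tc f c n) * r ^ n <= M.
Proof.
  intros Hr H. destruct (taylor_on_disk f c rho Hr H) as [p [H1 H2]].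
  assert (E : forall n, p n = tc f c n) by now apply (analytic_tc f c rho).
  split; [now apply (analytic_ext_coef _ _ _ p)|].
  intros M r Hr' HM n. rewrite <- E. now apply H2.
Qed.

Lemma analytic_ext (f g : C -> C) (c : C) (rho : R) (p : nat -> C) :
  (forall z, Cmod (z - c) < rho -> f z = g z) ->
  analytic_on_disk f c rho p -> analytic_on_disk g c rho p.
Proof. intros E H z Hz. rewrite <- E by exact Hz. now apply H. Qed.

Lemma tc_ext (f g : C -> C) (c : C) (rho : R) : 0 < rho -> holo_disk f c rho ->
  (forall z, Cmod (z - c) < rho -> f z = g z) -> forall n, tc f c n = tc g c n.
Proof.
  intros Hr H E. apply (analytic_tc g c rho); [exact Hr|].
  apply (analytic_ext f); [exact E|]. now apply taylor.
Qed.

Lemma tc_pder (f : C -> C) (c : C) (n : nat) : tc (C_derive f) c n = pder (tc f c) n.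
Proof.
  unfold tc, pder. replace (C_derive_n n (C_derive f)) with (C_derive_n (S n) f).
  - rewrite fact_simpl, mult_INR, RtoC_mult. pose proof (RtoC_fact_neq_0 n).
    field. split; [easy|]. intros E. apply RtoC_inj in E. pose proof (lt_0_INR (S n) ltac:(lia)). lra.
  - induction n; [easy|]. simpl in *. now rewrite IHn.
Qed.

Lemma analytic_jet (f : C -> C) (c : C) (rho : R) (p : nat -> C) (N : nat) : 0 < rho ->
  analytic_on_disk f c rho p -> jet N (fun z => f (c + z)%C) p.
Proof.
  intros Hr H. apply (has_ps_jet p _ rho Hr). intros z Hz. specialize (H (c + z)%C).
  replace (c + z - c)%C with z in H by ring. auto.
Qed.

Lemma cderiv_plus (f g : C -> C) (z l m : C) :
  cderiv f z l -> cderiv g z m -> cderiv (fun w => f w + g w)%C z (l + m)%C.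
Proof.
  intros Hf Hg eps He. destruct (Hf (eps / 2)) as [d1 [Hd1 H1]]; [lra|].
  destruct (Hg (eps / 2)) as [d2 [Hd2 H2]]; [lra|].
  exists (Rmin d1 d2). split; [now apply Rmin_pos|]. intros w Hw.
  specialize (H1 w (Rlt_le_trans _ _ _ Hw (Rmin_l _ _))).
  specialize (H2 w (Rlt_le_trans _ _ _ Hw (Rmin_r _ _))).
  replace (f w + g w - (f z + g z) - (l + m) * (w - z))%C with
    ((f w - f z - l * (w - z)) + (g w - g z - m * (w - z)))%C by ring.
  eapply Rle_trans; [apply Cmod_triangle|]. lra.
Qed.

Lemma cderiv_scal (f : C -> C) (z l k : C) :
  cderiv f z l -> cderiv (fun w => k * f w)%C z (k * l)%C.
Proof.
  intros H eps He. pose proof (Cmod_ge_0 k).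
  destruct (H (eps / (Cmod k + 1))) as [d [Hd H1]]; [apply Rdiv_lt_0_compat; lra|].
  exists d. split; [exact Hd|]. intros w Hw. specialize (H1 w Hw).
  replace (k * f w - k * f z - k * l * (w - z))%C with (k * (f w - f z - l * (w - z)))%C by ring.
  rewrite Cmod_mult.
  apply Rle_trans with ((Cmod k + 1) * (eps / (Cmod k + 1) * Cmod (w - z))).
  - apply Rmult_le_compat; try apply Cmod_ge_0; lra.
  - right. field. lra.
Qed.

Lemma cderiv_const (k z : C) : cderiv (fun _ => k) z (RtoC 0).
Proof.
  intros eps He. exists 1. split; [lra|]. intros w _.
  replace (k - k - RtoC 0 * (w - z))%C with (RtoC 0) by ring.
  rewrite Cmod_0. apply Rmult_le_pos; [lra | apply Cmod_ge_0].
Qed.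

(** * Holomorphic functions of two variables *)

(** The constant depends on [M], [r] and [n] only and not on [f]; the limits of families of
    functions below rest on this uniformity. *)
Lemma taylor_remainder (f : C -> C) (c : C) (rho r M : R) (z : C) (n : nat) :
  0 < r < rho -> holo_disk f c rho ->
  (forall w, Cmod (w - c) < rho -> Cmod (f w) <= M) -> Cmod (z - c) <= r / 2 ->
  Cmod (f z - psum (tc f c) n (z - c)) <= 2 * M / r ^ n * Cmod (z - c) ^ n.
Proof.
  intros Hr Hf HM Hz. destruct (taylor f c rho ltac:(lra) Hf) as [H1 H2].
  specialize (H2 M r Hr HM). pose proof (Cmod_ge_0 (z - c)).
  assert (HM0 : 0 <= M).
  { eapply Rle_trans; [|apply (HM z)]; [apply Cmod_ge_0 | lra]. }
  set (x := Cmod (z - c) / r). assert (Hx : 0 <= x < 1) by (apply ratio_lt_1; lra).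
  assert (Hx2 : x <= / 2).
  { unfold x. apply (proj2 (Rle_div_l _ _ r ltac:(lra))). lra. }
  eapply Rle_trans; [apply (has_ps_tail _ _ _ M x Hx)|].
  - apply bdd_geom; [lra | exact H2].
  - apply H1; lra.
  - replace (2 * M / r ^ n * Cmod (z - c) ^ n) with (M * x ^ n * 2).
    + unfold Rdiv at 1. apply Rmult_le_compat_l.
      * apply Rmult_le_pos; [exact HM0 | apply pow_le; lra].
      * rewrite <- (Rinv_inv 2). apply Rinv_le_contravar; lra.
    + unfold x, Rdiv. rewrite Rpow_mult_distr, pow_inv. ring.
Qed.

Lemma tc_0 (f : C -> C) (c : C) : tc f c 0 = f c.
Proof. unfold tc. simpl. field. Qed.

Lemma tc_1 (f : C -> C) (c : C) : tc f c 1 = C_derive f c.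
Proof. unfold tc. simpl. field. Qed.

Lemma holo_quad_uniform (f : C -> C) (c : C) (rho r M : R) (w : C) :
  0 < r < rho -> holo_disk f c rho ->
  (forall w, Cmod (w - c) < rho -> Cmod (f w) <= M) -> Cmod (w - c) <= r / 2 ->
  Cmod (f w - f c - C_derive f c * (w - c)) <= 2 * M / r ^ 2 * Cmod (w - c) ^ 2.
Proof.
  intros Hr Hf HM Hw. pose proof (taylor_remainder f c rho r M w 2 Hr Hf HM Hw) as H.
  simpl psum in H. rewrite tc_0, tc_1 in H.
  replace (f w - f c - C_derive f c * (w - c))%C with
    (f w - (0 + f c * 1 + C_derive f c * ((w - c) * 1)))%C by ring. exact H.
Qed.

(* The second-order Taylor remainders are bounded uniformly in [n], so the
   derivatives [C_derive (F n) z] form a Cauchy sequence. *)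
Lemma bounded_limit_holo (F : nat -> C -> C) (G : C -> C) (c : C) (rho M : R) :
  (forall n, holo_disk (F n) c rho) ->
  (forall n w, Cmod (w - c) < rho -> Cmod (F n w) <= M) ->
  (forall w, Cmod (w - c) < rho -> forall eps, 0 < eps ->
     exists N, forall n, (N <= n)%nat -> Cmod (G w - F n w) < eps) ->
  holo_disk G c rho.
Proof.
  intros HF HM HG z Hz. set (s := rho - Cmod (z - c)). assert (Hs : 0 < s) by (unfold s; lra).
  assert (Hin : forall w, Cmod (w - z) < s -> Cmod (w - c) < rho).
  { intros w Hw. replace (w - c)%C with ((w - z) + (z - c))%C by ring.
    pose proof (Cmod_triangle (w - z) (z - c)). unfold s in Hw. lra. }
  set (K := 2 * M / (s / 2) ^ 2).
  assert (Q : forall n w, Cmod (w - z) <= s / 4 ->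
     Cmod (F n w - F n z - C_derive (F n) z * (w - z)) <= K * Cmod (w - z) ^ 2).
  { intros n w Hw. apply (holo_quad_uniform _ _ s); try lra.
    - intros v Hv. apply HF, Hin, Hv.
    - intros v Hv. apply HM, Hin, Hv. }
  assert (HK : 0 <= K).
  { unfold K. apply Rmult_le_pos.
    - pose proof (HM 0%nat z Hz). pose proof (Cmod_ge_0 (F 0%nat z)). lra.
    - apply Rlt_le, Rinv_0_lt_compat, pow_lt. lra. }
  destruct (C_complete (fun n => C_derive (F n) z)) as [d Hd].
  { intros eps He. destruct (lip_small K (eps / 4)) as [d1 [Hd1 H1]]; [exact HK | lra |].
    (* At w = z + t, t times the difference of two derivatives consists of four differences of
       values, each below t eps / 8, and two remainders K t^2, each below t eps / 4. *)
    set (t := Rmin d1 (s / 4) / 2). assert (0 < Rmin d1 (s / 4)) by (apply Rmin_pos; lra).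
    pose proof (Rmin_l d1 (s / 4)). pose proof (Rmin_r d1 (s / 4)).
    assert (Ht : 0 < t) by (unfold t; lra).
    specialize (H1 t ltac:(lra) ltac:(unfold t; lra)).
    set (w := (z + RtoC t)%C). assert (Ewz : (w - z)%C = RtoC t) by (unfold w; ring).
    assert (Et : Cmod (RtoC t) = t) by (rewrite Cmod_R, Rabs_pos_eq; lra).
    assert (Hwz : Cmod (w - z) <= s / 4) by (rewrite Ewz, Et; unfold t; lra).
    assert (Hwc : Cmod (w - c) < rho) by (apply Hin; lra).
    destruct (HG w Hwc (t * eps / 8)) as [N1 HN1]; [nra|].
    destruct (HG z Hz (t * eps / 8)) as [N2 HN2]; [nra|].
    exists (max N1 N2). intros n m Hn Hm.
    pose proof (HN1 n ltac:(lia)) as A1. pose proof (HN1 m ltac:(lia)) as A2.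
    pose proof (HN2 n ltac:(lia)) as A3. pose proof (HN2 m ltac:(lia)) as A4.
    pose proof (Q n w Hwz) as Qn. pose proof (Q m w Hwz) as Qm. rewrite Ewz, Et in Qn, Qm.
    apply Rmult_lt_reg_l with t; [exact Ht|].
    rewrite <- Et at 1. rewrite <- Cmod_mult.
    replace (RtoC t * (C_derive (F n) z - C_derive (F m) z))%C with
      ((((G w - F m w) - (G w - F n w)) - ((G z - F m z) - (G z - F n z))) -
       ((F n w - F n z - C_derive (F n) z * RtoC t) - (F m w - F m z - C_derive (F m) z * RtoC t)))%C by ring.
    eapply Rle_lt_trans; [apply Cmod_triangle_minus|].
    pose proof (Cmod_triangle_minus ((G w - F m w) - (G w - F n w)) ((G z - F m z) - (G z - F n z))).
    pose proof (Cmod_triangle_minus (G w - F m w) (G w - F n w)).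
    pose proof (Cmod_triangle_minus (G z - F m z) (G z - F n z)).
    pose proof (Cmod_triangle_minus (F n w - F n z - C_derive (F n) z * RtoC t) (F m w - F m z - C_derive (F m) z * RtoC t)).
    assert (K * t ^ 2 < t * (eps / 4)) by (simpl; nra). lra. }
  exists d. apply (cderiv_quad G z d K (s / 4)); [lra|]. intros w Hw.
  apply le_epsilon. intros eps He. pose proof (Cmod_ge_0 (w - z)).
  set (e := eps / (2 + Cmod (w - z))). assert (He' : 0 < e) by (apply Rdiv_lt_0_compat; lra).
  destruct (HG w ltac:(apply Hin; lra) e He') as [N1 H1]. destruct (HG z Hz e He') as [N2 H2].
  destruct (Hd e He') as [N3 H3]. set (n := (N1 + N2 + N3)%nat).
  specialize (H1 n ltac:(unfold n; lia)). specialize (H2 n ltac:(unfold n; lia)).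
  specialize (H3 n ltac:(unfold n; lia)). specialize (Q n w ltac:(lra)).
  replace (G w - G z - d * (w - z))%C with
    ((F n w - F n z - C_derive (F n) z * (w - z)) +
     ((G w - F n w) - (G z - F n z) - (d - C_derive (F n) z) * (w - z)))%C by ring.
  eapply Rle_trans; [apply Cmod_triangle|]. apply Rplus_le_compat; [exact Q|].
  eapply Rle_trans; [apply Cmod_triangle_minus|].
  pose proof (Cmod_triangle_minus (G w - F n w) (G z - F n z)). rewrite Cmod_mult.
  assert (Cmod (d - C_derive (F n) z) * Cmod (w - z) <= e * Cmod (w - z)) by (apply Rmult_le_compat_r; lra).
  replace eps with (e * (2 + Cmod (w - z))) by (unfold e; field; lra). lra.
Qed.

Lemma holo_disk_plus (f g : C -> C) (c : C) (rho : R) :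
  holo_disk f c rho -> holo_disk g c rho -> holo_disk (fun w => f w + g w)%C c rho.
Proof.
  intros Hf Hg w Hw. destruct (Hf w Hw) as [l Hl]. destruct (Hg w Hw) as [m Hm].
  exists (l + m)%C. now apply cderiv_plus.
Qed.

Lemma holo_disk_scal (f : C -> C) (k c : C) (rho : R) :
  holo_disk f c rho -> holo_disk (fun w => k * f w)%C c rho.
Proof. intros Hf w Hw. destruct (Hf w Hw) as [l Hl]. exists (k * l)%C. now apply cderiv_scal. Qed.

Lemma holo_disk_ext (f g : C -> C) (c : C) (rho : R) :
  (forall w, f w = g w) -> holo_disk f c rho -> holo_disk g c rho.
Proof.
  intros E Hf w Hw. destruct (Hf w Hw) as [l Hl]. exists l.
  apply (cderiv_ext_near f); [|exact Hl]. exists 1. split; [lra | auto].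
Qed.

(** * Taylor polynomials in two variables *)

Section TwoVariables.

Variables (f : C -> C -> C) (u a : C) (r s M : R).
Hypothesis (Hr : 0 < r) (Hs : 0 < s).
Hypothesis H1 : forall y, Cmod (y - a) < s -> holo_disk (fun x => f x y) u r.
Hypothesis H2 : forall x, Cmod (x - u) < r -> holo_disk (f x) a s.
Hypothesis HM : forall x y, Cmod (x - u) < r -> Cmod (y - a) < s -> Cmod (f x y) <= M.

(* The coefficients in [y] are holomorphic in [x]: the [l]-th one is the limit of
   [(f x y - sum_(j < l) b_j x (y - a)^j) / (y - a)^l] as [y -> a]. *)
Lemma tc_holo (l : nat) : holo_disk (fun x => tc (f x) a l) u r.
Proof.
  induction l as [l IH] using (well_founded_induction lt_wf).
  assert (M0 : 0 <= M).
  { eapply Rle_trans; [apply Cmod_ge_0 | apply (HM u a)];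
      match goal with |- Cmod (?x - ?x) < _ => replace (x - x)%C with (RtoC 0) by ring end;
      rewrite Cmod_0; assumption. }
  assert (Hpart : forall n y, (n <= l)%nat -> holo_disk (fun x => psum (tc (f x) a) n y) u r).
  { intros n y. induction n; intros Hn.
    - intros w _. exists (RtoC 0). apply (cderiv_const (RtoC 0)).
    - simpl. apply holo_disk_plus; [apply IHn; lia|].
      apply (holo_disk_ext (fun x => y ^ n * tc (f x) a n)%C); [intros; ring|].
      apply holo_disk_scal. apply IH. lia. }
  (* A null sequence bounded by s / 4, the range in which [taylor_remainder] applies at radius s /
     2. *)
  set (t := fun n : nat => s / 4 * / INR (S n)).
  assert (Ht : forall n, 0 < t n <= s / 4).
  { intros n. unfold t. pose proof (lt_0_INR (S n) ltac:(lia)) as P.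
    assert (1 <= INR (S n)) by (rewrite S_INR; pose proof (pos_INR n); lra).
    split. apply Rmult_lt_0_compat; [lra | now apply Rinv_0_lt_compat].
    rewrite <- (Rmult_1_r (s / 4)) at 2. apply Rmult_le_compat_l; [lra|].
    rewrite <- Rinv_1. apply Rinv_le_contravar; lra. }
  assert (Htn : forall n, RtoC (t n) <> RtoC 0).
  { intros n E. apply RtoC_inj in E. pose proof (Ht n). lra. }
  assert (Htm : forall n, Cmod (RtoC (t n)) = t n).
  { intros n. rewrite Cmod_R, Rabs_pos_eq; [easy|]. pose proof (Ht n). lra. }
  (* Used twice: k = l bounds the approximants uniformly, and k = l + 1 shows that they converge to
     the l-th coefficient at the rate t n. *)
  assert (Rem : forall x n k, Cmod (x - u) < r ->
    Cmod (f x (a + RtoC (t n))%C - psum (tc (f x) a) k (RtoC (t n))) <= 2 * M / (s / 2) ^ k * t n ^ k).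
  { intros x n k Hx. pose proof (Ht n).
    assert (E : (a + RtoC (t n) - a)%C = RtoC (t n)) by ring.
    pose proof (taylor_remainder (f x) a s (s / 2) M (a + RtoC (t n))%C k ltac:(lra) (H2 _ Hx)
      (fun w Hw => HM _ _ Hx Hw)) as T.
    rewrite E, Htm in T. apply T. lra. }
  apply (bounded_limit_holo
    (fun n x => / RtoC (t n) ^ l * (f x (a + RtoC (t n)) + RtoC (-1) * psum (tc (f x) a) l (RtoC (t n))))%C
    _ u r (2 * M / (s / 2) ^ l)).
  - intros n. apply holo_disk_scal, holo_disk_plus.
    + apply H1. replace (a + RtoC (t n) - a)%C with (RtoC (t n)) by ring. rewrite Htm. pose proof (Ht n). lra.
    + apply holo_disk_scal, Hpart. lia.
  - intros n x Hx.
    replace (f x (a + RtoC (t n)) + RtoC (-1) * psum (tc (f x) a) l (RtoC (t n)))%C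
      with (f x (a + RtoC (t n)) - psum (tc (f x) a) l (RtoC (t n)))%C by ring.
    rewrite Cmod_mult, Cmod_inv, Cmod_pow, Htm by now apply Cpow_nz.
    pose proof (pow_lt (t n) l (proj1 (Ht n))). specialize (Rem x n l Hx).
    apply Rmult_le_reg_l with (t n ^ l); [lra|]. rewrite <- Rmult_assoc, Rinv_r by lra. lra.
  - intros x Hx eps He.
    set (K := 2 * M / (s / 2) ^ S l).
    assert (HK : 0 <= K) by (apply Rmult_le_pos; [lra | apply Rlt_le, Rinv_0_lt_compat, pow_lt; lra]).
    destruct (lip_small (K * (s / 4)) eps) as [d [Hd Hd']]; [nra | exact He |].
    destruct (archimed_cor1 d Hd) as [N [HN HN0]].
    exists N. intros n Hn.
    pose proof (Rem x n (S l) Hx) as B. fold K in B.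
    pose proof (pow_lt (t n) l (proj1 (Ht n))) as P.
    apply Rle_lt_trans with (K * t n).
    + apply Rmult_le_reg_l with (t n ^ l); [lra|].
      replace (t n ^ l * (K * t n)) with (K * t n ^ S l) by (simpl; ring).
      rewrite <- (Htm n) at 1. rewrite <- Cmod_pow, <- Cmod_mult.
      eapply Rle_trans; [|exact B]. right. rewrite <- Cmod_opp. f_equal.
      simpl psum. field. now apply Cpow_nz.
    + unfold t. rewrite <- Rmult_assoc. apply Hd'.
      * apply Rlt_le, Rinv_0_lt_compat, lt_0_INR. lia.
      * eapply Rle_lt_trans; [|exact HN]. apply Rinv_le_contravar; [apply lt_0_INR; lia | apply le_INR; lia].
Qed.

(** Connects the expansion with the hypothesis on [D1D2]: the l-th derivative in y is l! times the
    l-th coefficient, hence so is its expansion in x. *)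
Lemma tc_tc (k l : nat) :
  tc (fun x => tc (f x) a l) u k = (D1D2 k l f u a / RtoC (INR (fact k)) / RtoC (INR (fact l)))%C.
Proof.
  unfold D1D2. set (B := fun x => C_derive_n l (f x) a).
  pose proof (proj1 (taylor _ u r Hr (tc_holo l))) as T.
  assert (TB : analytic_on_disk B u r (fun n => RtoC (INR (fact l)) * tc (fun x => tc (f x) a l) u n)%C).
  { intros z Hz eps He. pose proof (INR_fact_lt_0 l) as P.
    destruct (T z Hz (eps / INR (fact l))) as [N HN]; [apply Rdiv_lt_0_compat; lra|].
    exists N. intros n Hn. specialize (HN n Hn).
    assert (E : forall m, psum (fun n => RtoC (INR (fact l)) * tc (fun x => tc (f x) a l) u n)%C m (z - u)
      = (RtoC (INR (fact l)) * psum (tc (fun x => tc (f x) a l) u) m (z - u))%C).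
    { intros m. induction m; simpl; [ring|]. rewrite IHm. ring. }
    rewrite E. replace (B z) with (RtoC (INR (fact l)) * tc (f z) a l)%C.
    2: { unfold tc, B. field. apply RtoC_fact_neq_0. }
    replace (RtoC (INR (fact l)) * tc (f z) a l - RtoC (INR (fact l)) * psum (tc (fun x => tc (f x) a l) u) n (z - u))%C
      with (RtoC (INR (fact l)) * (tc (f z) a l - psum (tc (fun x => tc (f x) a l) u) n (z - u)))%C by ring.
    rewrite Cmod_mult, Cmod_R, Rabs_pos_eq by lra.
    apply Rmult_lt_compat_l with (r := INR (fact l)) in HN; [|lra].
    replace (INR (fact l) * (eps / INR (fact l))) with eps in HN by (field; lra). exact HN. }
  pose proof (analytic_tc B u r _ Hr TB k) as E. cbv beta in E.
  replace (tc (fun x => tc (f x) a l) u k) with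
    (RtoC (INR (fact l)) * tc (fun x => tc (f x) a l) u k / RtoC (INR (fact l)))%C.
  - rewrite E. reflexivity.
  - field. apply RtoC_fact_neq_0.
Qed.

(** Expand in y with a remainder uniform in x, then expand each of the first [N] coefficients in x.
    Keeping m below 1 lets the powers of y be estimated by 1; the condition 0 < |x| comes from
    [jet]. *)
Lemma two_variable_jet (N : nat) : exists K d, 0 < d /\
  forall x y m, Cmod x <= m -> Cmod y <= m -> 0 < Cmod x -> m < d ->
    Cmod (f (u + x)%C (a + y)%C
          - psum (fun l => psum (tc (fun x => tc (f x) a l) u) N x) N y) <= K * m ^ N.
Proof.
  assert (Inner : forall n, exists K d, 0 < d /\ forall x y m, Cmod x <= m -> Cmod y <= m -> 0 < Cmod x -> m < d ->
    Cmod (psum (tc (f (u + x)%C) a) n y - psum (fun l => psum (tc (fun x => tc (f x) a l) u) N x) n y)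
      <= K * m ^ N).
  { induction n as [|n (K & d & Hd & IH)].
    - exists 0, 1. split; [lra|]. intros x y m _ _ _ _. simpl.
      replace (RtoC 0 - RtoC 0)%C with (RtoC 0) by ring. rewrite Cmod_0. lra.
    - destruct (analytic_jet _ u r _ N Hr (proj1 (taylor _ u r Hr (tc_holo n)))) as (K2 & d2 & Hd2 & J).
      exists (K + Rabs K2), (Rmin (Rmin d d2) 1). split. repeat apply Rmin_pos; lra.
      intros x y m Hx Hy Hx0 Hm.
      pose proof (Rmin_l (Rmin d d2) 1). pose proof (Rmin_r (Rmin d d2) 1).
      pose proof (Rmin_l d d2). pose proof (Rmin_r d d2).
      specialize (IH x y m Hx Hy Hx0 ltac:(lra)). specialize (J x ltac:(lra)). simpl psum.
      set (B := psum (tc (fun x => tc (f x) a n) u) N x) in *.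
      match goal with |- Cmod (?p + ?q * _ - (?p' + _)) <= _ =>
        replace (p + q * y ^ n - (p' + B * y ^ n))%C with ((p - p') + (q - B) * y ^ n)%C by ring end.
      eapply Rle_trans; [apply Cmod_triangle|].
      rewrite Rmult_plus_distr_r. apply Rplus_le_compat; [exact IH|].
      rewrite Cmod_mult, Cmod_pow.
      assert (Y : Cmod y ^ n <= 1).
      { rewrite <- (pow1 n). apply pow_incr. split; [apply Cmod_ge_0 | lra]. }
      assert (X : Cmod x ^ N <= m ^ N) by (apply pow_incr; split; lra).
      pose proof (pow_le (Cmod y) n (Cmod_ge_0 y)). pose proof (pow_le (Cmod x) N (Cmod_ge_0 x)).
      rewrite <- (Rmult_1_r (Rabs K2 * m ^ N)).
      apply Rmult_le_compat; [apply Cmod_ge_0 | lra | | exact Y].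
      eapply Rle_trans; [exact J|]. pose proof (Rle_abs K2). pose proof (Rabs_pos K2).
      apply Rle_trans with (Rabs K2 * Cmod x ^ N); [apply Rmult_le_compat_r; lra|].
      apply Rmult_le_compat_l; lra. }
  destruct (Inner N) as (K & d & Hd & HI).
  set (K2 := 2 * M / (s / 2) ^ N).
  exists (K2 + K), (Rmin (Rmin d r) (s / 4)). split. repeat apply Rmin_pos; lra.
  intros x y m Hx Hy Hx0 Hm.
  pose proof (Rmin_l (Rmin d r) (s / 4)). pose proof (Rmin_r (Rmin d r) (s / 4)).
  pose proof (Rmin_l d r). pose proof (Rmin_r d r).
  specialize (HI x y m Hx Hy Hx0 ltac:(lra)).
  assert (Hux : Cmod (u + x - u) < r) by (replace (u + x - u)%C with x by ring; lra).
  assert (Ey : (a + y - a)%C = y) by ring.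
  pose proof (taylor_remainder (f (u + x)%C) a s (s / 2) M (a + y)%C N ltac:(lra) (H2 _ Hux)
    (fun w Hw => HM _ _ Hux Hw)) as T.
  rewrite Ey in T. specialize (T ltac:(lra)). fold K2 in T.
  match goal with |- Cmod (?p - ?q) <= _ =>
    replace (p - q)%C with ((p - psum (tc (f (u + x)%C) a) N y) + (psum (tc (f (u + x)%C) a) N y - q))%C by ring end.
  eapply Rle_trans; [apply Cmod_triangle|]. rewrite Rmult_plus_distr_r.
  apply Rplus_le_compat; [|exact HI]. eapply Rle_trans; [exact T|].
  apply Rmult_le_compat_l.
  - unfold K2. apply Rmult_le_pos; [|apply Rlt_le, Rinv_0_lt_compat, pow_lt; lra].
    pose proof (Cmod_ge_0 (f (u + x)%C a)).
    pose proof (HM (u + x)%C a Hux) as B. replace (a - a)%C with (RtoC 0) in B by ring.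
    rewrite Cmod_0 in B. specialize (B Hs). lra.
  - apply pow_incr. split; [apply Cmod_ge_0 | exact Hy].
Qed.

End TwoVariables.

(** * Domination of jets *)

Lemma C_nonneg_plus x y : C_nonneg x -> C_nonneg y -> C_nonneg (x + y)%C.
Proof. intros [H1 H2] [H3 H4]. split; rewrite ?im_plus, ?re_plus; lra. Qed.

Lemma C_nonneg_mult x y : C_nonneg x -> C_nonneg y -> C_nonneg (x * y)%C.
Proof.
  intros [H1 H2] [H3 H4]. split; rewrite ?im_mult, ?re_mult, ?H1, ?H3; [ring|].
  pose proof (Rmult_le_pos _ _ H2 H4). lra.
Qed.

Lemma C_nonneg_RtoC r : 0 <= r -> C_nonneg (RtoC r).
Proof. intros H. split; simpl; lra. Qed.

Lemma C_nonneg_sub_self x : C_nonneg (x - x)%C.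
Proof. replace (x - x)%C with (RtoC 0) by ring. apply C_nonneg_RtoC. lra. Qed.

Lemma jet_close (N : nat) (phi psi : C -> C) (p : nat -> C) (K d : R) : 0 < d ->
  (forall z, 0 < Cmod z < d -> Cmod (psi z - phi z) <= K * Cmod z ^ N) ->
  jet N phi p -> jet N psi p.
Proof.
  intros Hd H (K' & d' & Hd' & H'). exists (K + K'), (Rmin d d'). split; [now apply Rmin_pos|].
  intros z [Hz0 Hz]. pose proof (Rmin_l d d'). pose proof (Rmin_r d d').
  specialize (H z ltac:(lra)). specialize (H' z ltac:(lra)).
  replace (psi z - psum p N z)%C with ((psi z - phi z) + (phi z - psum p N z))%C by ring.
  eapply Rle_trans; [apply Cmod_triangle|]. lra.
Qed.

Lemma jet_ext (N : nat) (phi psi : C -> C) (p : nat -> C) :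
  (forall z, z <> RtoC 0 -> phi z = psi z) -> jet N phi p -> jet N psi p.
Proof.
  intros E. apply (jet_close N phi psi p 0 1); [lra|]. intros z Hz.
  rewrite E by (apply Cmod_gt_0; lra). replace (psi z - psi z)%C with (RtoC 0) by ring.
  rewrite Cmod_0. lra.
Qed.

Lemma jet_coef_ext (N : nat) (phi : C -> C) (p q : nat -> C) :
  (forall k, (k < N)%nat -> p k = q k) -> jet N phi p -> jet N phi q.
Proof.
  intros E (K & d & Hd & H). exists K, d. split; [exact Hd|]. intros z Hz.
  rewrite <- (psum_ext p q N z E). now apply H.
Qed.

Lemma psum_plus (p q : nat -> C) (n : nat) (z : C) :
  psum (fun k => p k + q k)%C n z = (psum p n z + psum q n z)%C.
Proof. induction n; simpl; [ring|]. rewrite IHn. ring. Qed.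

Lemma psum_scal (c : C) (p : nat -> C) (n : nat) (z : C) :
  psum (fun k => c * p k)%C n z = (c * psum p n z)%C.
Proof. induction n; simpl; [ring|]. rewrite IHn. ring. Qed.

Lemma psum_S_shift (p : nat -> C) (n : nat) (z : C) :
  psum p (S n) z = (p 0%nat + z * psum (fun k => p (S k)) n z)%C.
Proof.
  induction n; [simpl; ring|].
  change (psum p (S (S n)) z) with (psum p (S n) z + p (S n) * z ^ S n)%C.
  rewrite IHn. simpl. ring.
Qed.

Lemma jet_plus (N : nat) (phi psi : C -> C) (p q : nat -> C) :
  jet N phi p -> jet N psi q -> jet N (fun z => phi z + psi z)%C (fun k => p k + q k)%C.
Proof.
  intros (K & d & Hd & H) (K' & d' & Hd' & H'). exists (K + K'), (Rmin d d').
  split; [now apply Rmin_pos|]. intros z [Hz0 Hz]. pose proof (Rmin_l d d'). pose proof (Rmin_r d d').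
  specialize (H z ltac:(lra)). specialize (H' z ltac:(lra)). rewrite psum_plus.
  replace (phi z + psi z - (psum p N z + psum q N z))%C with
    ((phi z - psum p N z) + (psi z - psum q N z))%C by ring.
  eapply Rle_trans; [apply Cmod_triangle|]. lra.
Qed.

Lemma jet_scal (N : nat) (c : C) (phi : C -> C) (p : nat -> C) :
  jet N phi p -> jet N (fun z => c * phi z)%C (fun k => c * p k)%C.
Proof.
  intros (K & d & Hd & H). exists (Cmod c * K), d. split; [exact Hd|]. intros z Hz.
  rewrite psum_scal. replace (c * phi z - c * psum p N z)%C with (c * (phi z - psum p N z))%C by ring.
  rewrite Cmod_mult, Rmult_assoc. apply Rmult_le_compat_l; [apply Cmod_ge_0 | now apply H].
Qed.

Lemma jet_shift (N : nat) (phi : C -> C) (p : nat -> C) : jet N phi p ->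
  jet (S N) (fun z => z * phi z)%C (fun k => match k with O => RtoC 0 | S j => p j end).
Proof.
  intros (K & d & Hd & H). exists K, d. split; [exact Hd|]. intros z Hz.
  rewrite psum_S_shift. change (fun k => p k) with p.
  replace (z * phi z - (RtoC 0 + z * psum p N z))%C with (z * (phi z - psum p N z))%C by ring.
  rewrite Cmod_mult. simpl pow. replace (K * (Cmod z * Cmod z ^ N)) with (Cmod z * (K * Cmod z ^ N)) by ring.
  apply Rmult_le_compat_l; [lra | now apply H].
Qed.

Lemma jet_split (N : nat) (phi : C -> C) (p : nat -> C) : jet (S N) phi p ->
  jet N (fun z => (phi z - p 0%nat) / z)%C (fun k => p (S k)).
Proof.
  intros (K & d & Hd & H). exists K, d. split; [exact Hd|]. intros z Hz.
  assert (Hz0 : z <> RtoC 0) by (apply Cmod_gt_0; lra).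
  apply Rmult_le_reg_l with (Cmod z); [lra|]. rewrite <- Cmod_mult.
  specialize (H z Hz). rewrite psum_S_shift in H. simpl pow in H.
  replace (z * ((phi z - p 0%nat) / z - psum (fun k => p (S k)) N z))%C with
    (phi z - (p 0%nat + z * psum (fun k => p (S k)) N z))%C by (field; exact Hz0).
  replace (Cmod z * (K * Cmod z ^ N)) with (K * (Cmod z * Cmod z ^ N)) by ring. exact H.
Qed.

(** A jet of order 0 merely says that the function is bounded near 0, so the sequence [r] is
    arbitrary. *)
Lemma jet_0_mult (phi psi : C -> C) (p q r : nat -> C) :
  jet 0 phi p -> jet 0 psi q -> jet 0 (fun z => phi z * psi z)%C r.
Proof.
  intros (K & d & Hd & H) (K' & d' & Hd' & H'). exists (K * K'), (Rmin d d').
  split; [now apply Rmin_pos|]. intros z [Hz0 Hz]. pose proof (Rmin_l d d'). pose proof (Rmin_r d d').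
  specialize (H z ltac:(lra)). specialize (H' z ltac:(lra)). simpl in *. rewrite Rmult_1_r in *.
  replace (phi z * psi z - RtoC 0)%C with ((phi z - RtoC 0) * (psi z - RtoC 0))%C by ring.
  rewrite Cmod_mult. apply Rmult_le_compat; auto; apply Cmod_ge_0.
Qed.

(** [N] is the order up to which the jets are compared and [M] the number of coefficients that are
    already exact. They are independent because an approximation with fixed [M] is compared to every
    order [N]. *)
Definition dom (N M : nat) (phi psi : C -> C) : Prop :=
  exists p q, jet N phi p /\ jet N psi q /\
    forall k, (k < N)%nat ->
      C_nonneg (p k) /\ C_nonneg (q k - p k)%C /\ ((k < M)%nat -> p k = q k).

Lemma dom_pred N M phi psi : dom (S N) M phi psi -> dom N M phi psi.
Proof.
  intros (p & q & Hp & Hq & H). exists p, q. split; [now apply jet_pred|].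
  split; [now apply jet_pred|]. intros k Hk. apply H. lia.
Qed.

Lemma dom_ext N M phi psi phi' psi' :
  (forall z, z <> RtoC 0 -> phi z = phi' z) -> (forall z, z <> RtoC 0 -> psi z = psi' z) ->
  dom N M phi psi -> dom N M phi' psi'.
Proof.
  intros E1 E2 (p & q & Hp & Hq & H). exists p, q.
  split; [now apply (jet_ext N phi)|]. split; [now apply (jet_ext N psi) | exact H].
Qed.

Lemma dom_plus N M f f' g g' : dom N M f f' -> dom N M g g' ->
  dom N M (fun z => f z + g z)%C (fun z => f' z + g' z)%C.
Proof.
  intros (p & p' & Hp & Hp' & H) (q & q' & Hq & Hq' & H').
  exists (fun k => p k + q k)%C, (fun k => p' k + q' k)%C.
  split; [now apply jet_plus|]. split; [now apply jet_plus|]. intros k Hk.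
  destruct (H k Hk) as (A & B & D). destruct (H' k Hk) as (A' & B' & D').
  split; [now apply C_nonneg_plus|]. split.
  - replace (p' k + q' k - (p k + q k))%C with ((p' k - p k) + (q' k - q k))%C by ring.
    now apply C_nonneg_plus.
  - intros HM. now rewrite D, D'.
Qed.

Lemma dom_scal N M (c c' : C) g g' : C_nonneg c -> C_nonneg (c' - c)%C -> ((0 < M)%nat -> c = c') ->
  dom N M g g' -> dom N M (fun z => c * g z)%C (fun z => c' * g' z)%C.
Proof.
  intros Hc Hc' HM (q & q' & Hq & Hq' & H).
  exists (fun k => c * q k)%C, (fun k => c' * q' k)%C.
  split; [now apply jet_scal|]. split; [now apply jet_scal|]. intros k Hk.
  destruct (H k Hk) as (A & B & D). split; [now apply C_nonneg_mult|]. split.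
  (* Writing q' as (q' - q) + q exhibits it as a sum of nonnegative numbers. *)
  - replace (c' * q' k - c * q k)%C with ((c' - c) * ((q' k - q k) + q k) + c * (q' k - q k))%C by ring.
    apply C_nonneg_plus; apply C_nonneg_mult; auto. now apply C_nonneg_plus.
  - intros Hk'. rewrite D by exact Hk'. rewrite HM by lia. reflexivity.
Qed.

(** Coefficient k moves to k + 1 and the new constant term 0 is exact on both sides, so agreement
    below M - 1 suffices for agreement below M. *)
Lemma dom_shift N M g g' : dom N (pred M) g g' ->
  dom (S N) M (fun z => z * g z)%C (fun z => z * g' z)%C.
Proof.
  intros (q & q' & Hq & Hq' & H).
  exists (fun k => match k with O => RtoC 0 | S j => q j end), (fun k => match k with O => RtoC 0 | S j => q' j end).
  split; [now apply jet_shift|]. split; [now apply jet_shift|]. intros [|k] Hk.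
  - split; [apply C_nonneg_RtoC; lra|]. split; [apply C_nonneg_sub_self | easy].
  - destruct (H k ltac:(lia)) as (A & B & D). split; [exact A|]. split; [exact B|]. intros; apply D. lia.
Qed.

(* Induction on the order, writing [f z = f 0 + z f1 z]. *)
Lemma dom_mult N M f f' g g' : dom N M f f' -> dom N M g g' ->
  dom N M (fun z => f z * g z)%C (fun z => f' z * g' z)%C.
Proof.
  revert M f f' g g'. induction N; intros M f f' g g' Hf Hg.
  - destruct Hf as (p & p' & Hp & Hp' & _). destruct Hg as (q & q' & Hq & Hq' & _).
    exists p, p'. split; [now apply (jet_0_mult f g p q)|].
    split; [now apply (jet_0_mult f' g' p' q')|]. intros; lia.
  - destruct Hf as (p & p' & Hp & Hp' & H).
    assert (H1 : dom N (pred M) (fun z => (f z - p 0%nat) / z)%C (fun z => (f' z - p' 0%nat) / z)%C).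
    { exists (fun k => p (S k)), (fun k => p' (S k)). split; [now apply jet_split|].
      split; [now apply jet_split|]. intros k Hk. destruct (H (S k) ltac:(lia)) as (A & B & D).
      split; [exact A|]. split; [exact B|]. intros; apply D; lia. }
    assert (Hg1 : dom N (pred M) g g').
    { destruct (dom_pred _ _ _ _ Hg) as (q & q' & Hq & Hq' & G). exists q, q'. split; [easy|]. split; [easy|].
      intros k Hk. destruct (G k Hk) as (A & B & D). split; [easy|]. split; [easy|]. intros; apply D; lia. }
    destruct (H 0%nat ltac:(lia)) as (A & B & D).
    refine (dom_ext _ _ _ _ _ _ _ _ (dom_plus _ _ _ _ _ _ (dom_scal _ M _ _ _ _ A B D Hg)
      (dom_shift _ M _ _ (IHN _ _ _ _ _ H1 Hg1)))); intros z Hz; cbv beta; field; exact Hz.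
Qed.

Lemma dom_psum_self N M (c : nat -> C) : (forall k, C_nonneg (c k)) -> dom N M (psum c N) (psum c N).
Proof.
  intros Hc. assert (J : jet N (psum c N) c).
  { exists 0, 1. split; [lra|]. intros z _. replace (psum c N z - psum c N z)%C with (RtoC 0) by ring.
    rewrite Cmod_0. lra. }
  exists c, c. split; [exact J|]. split; [exact J|]. intros k _.
  split; [apply Hc|]. split; [apply C_nonneg_sub_self | easy].
Qed.

Lemma psum_const (c : C) (n : nat) (z : C) :
  psum (fun k => match k with O => c | _ => RtoC 0 end) (S n) z = c.
Proof.
  rewrite psum_S_shift.
  assert (E : psum (fun _ => RtoC 0) n z = RtoC 0) by (induction n; simpl; [ring | rewrite IHn; ring]).
  rewrite E. ring.
Qed.

Lemma dom_const N M c : C_nonneg c -> dom N M (fun _ => c) (fun _ => c).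
Proof.
  intros Hc. assert (J : jet N (fun _ => c) (fun k => match k with O => c | _ => RtoC 0 end)).
  { exists (Cmod c), 1. split; [lra|]. intros z _. destruct N.
    - simpl. replace (c - RtoC 0)%C with c by ring. lra.
    - rewrite psum_const. replace (c - c)%C with (RtoC 0) by ring. rewrite Cmod_0.
      apply Rmult_le_pos; [apply Cmod_ge_0 | apply pow_le, Cmod_ge_0]. }
  exists (fun k => match k with O => c | _ => RtoC 0 end), (fun k => match k with O => c | _ => RtoC 0 end).
  split; [exact J|]. split; [exact J|]. intros k _. split.
  - destruct k; [exact Hc | apply C_nonneg_RtoC; lra].
  - split; [apply C_nonneg_sub_self | easy].
Qed.

Lemma dom_pow N M f f' n : dom N M f f' -> dom N M (fun z => f z ^ n)%C (fun z => f' z ^ n)%C.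
Proof.
  intros H. induction n.
  - apply (dom_const N M (RtoC 1)). apply C_nonneg_RtoC; lra.
  - apply (dom_mult _ _ f f' _ _ H IHn).
Qed.

(** Substitution into a polynomial uses only sums and products, and both preserve domination; the
    [J l] stand for coefficients that are themselves polynomials in z. *)
Lemma dom_psum_comp N M (J : nat -> C -> C) f f' n :
  (forall l, dom N M (J l) (J l)) -> dom N M f f' ->
  dom N M (fun z => psum (fun l => J l z) n (f z)) (fun z => psum (fun l => J l z) n (f' z)).
Proof.
  intros HJ Hf. induction n.
  - apply (dom_const N M (RtoC 0)). apply C_nonneg_RtoC; lra.
  - simpl. apply (dom_plus _ _ _ _ _ _ IHn).
    apply (dom_mult _ _ (J n) (J n)); [apply HJ | now apply dom_pow].
Qed.

Lemma dom_close N M phi psi phi' psi' (K d : R) : 0 < d ->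
  (forall z, 0 < Cmod z < d -> Cmod (phi' z - phi z) <= K * Cmod z ^ N) ->
  (forall z, 0 < Cmod z < d -> Cmod (psi' z - psi z) <= K * Cmod z ^ N) ->
  dom N M phi psi -> dom N M phi' psi'.
Proof.
  intros Hd H1 H2 (p & q & Hp & Hq & H). exists p, q.
  split; [now apply (jet_close N phi phi' p K d)|].
  split; [now apply (jet_close N psi psi' q K d) | exact H].
Qed.

Lemma comp_near (f : C -> C -> C) (u a : C) (P : C -> C -> C) (psi : C -> C) (N : nat) :
  (exists K d, 0 < d /\ forall x y m, Cmod x <= m -> Cmod y <= m -> 0 < Cmod x -> m < d ->
     Cmod (f (u + x)%C (a + y)%C - P x y) <= K * m ^ N) ->
  (exists L d, 0 < d /\ forall z, 0 < Cmod z < d -> Cmod (psi z) <= L * Cmod z) ->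
  exists K d, 0 < d /\ forall z, 0 < Cmod z < d ->
     Cmod (f (u + z)%C (a + psi z)%C - P z (psi z)) <= K * Cmod z ^ N.
Proof.
  intros (K & d & Hd & H) (L & d' & Hd' & HL).
  (* With L1 >= 1 the single number m = L1 |z| bounds both |z| and |psi z|. *)
  set (L1 := Rmax 1 L). pose proof (Rmax_l 1 L). pose proof (Rmax_r 1 L). fold L1 in H0, H1.
  destruct (lip_small L1 d) as [d2 [Hd2 H2]]; [lra | exact Hd |].
  exists (K * L1 ^ N), (Rmin d' d2). split; [now apply Rmin_pos|]. intros z [Hz0 Hz].
  pose proof (Rmin_l d' d2). pose proof (Rmin_r d' d2). specialize (HL z ltac:(lra)).
  rewrite Rmult_assoc, <- Rpow_mult_distr. apply H; [nra | nra | exact Hz0 | apply H2; lra].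
Qed.

(** Replacing [f] by its polynomial changes both composites by O(|z|^N) only, since [psi] and [psi']
    are O(|z|); jets of order [N] do not notice this, and for the polynomial the claim is
    [dom_psum_comp]. *)
Lemma comp_dom (f : C -> C -> C) (u a : C) (c : nat -> nat -> C) (psi psi' : C -> C) (N M : nat) :
  (exists K d, 0 < d /\ forall x y m, Cmod x <= m -> Cmod y <= m -> 0 < Cmod x -> m < d ->
     Cmod (f (u + x)%C (a + y)%C - psum (fun l => psum (c l) N x) N y) <= K * m ^ N) ->
  (forall l k, C_nonneg (c l k)) ->
  (exists L d, 0 < d /\ forall z, 0 < Cmod z < d -> Cmod (psi z) <= L * Cmod z) ->
  (exists L d, 0 < d /\ forall z, 0 < Cmod z < d -> Cmod (psi' z) <= L * Cmod z) ->
  dom N M psi psi' ->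
  dom N M (fun z => f (u + z)%C (a + psi z)%C) (fun z => f (u + z)%C (a + psi' z)%C).
Proof.
  intros Hf Hc H1 H2 H.
  destruct (comp_near f u a _ psi N Hf H1) as (K & d & Hd & E1).
  destruct (comp_near f u a _ psi' N Hf H2) as (K' & d' & Hd' & E2).
  apply (dom_close N M (fun z => psum (fun l => psum (c l) N z) N (psi z))
    (fun z => psum (fun l => psum (c l) N z) N (psi' z)) _ _ (Rmax K K') (Rmin d d')); [now apply Rmin_pos | | |].
  - intros z [Hz0 Hz]. pose proof (Rmin_l d d'). eapply Rle_trans; [apply E1; lra|].
    apply Rmult_le_compat_r; [apply pow_le; lra | apply Rmax_l].
  - intros z [Hz0 Hz]. pose proof (Rmin_r d d'). eapply Rle_trans; [apply E2; lra|].
    apply Rmult_le_compat_r; [apply pow_le; lra | apply Rmax_r].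
  - apply (dom_psum_comp N M (fun l => psum (c l) N)); [|exact H]. intros l. now apply dom_psum_self.
Qed.

(** * The integral operator *)

Lemma holo2_comp (D E : C -> Prop) (f : C -> C -> C) (al be : C -> C) (x l m : C) :
  holomorphic2_on D E f -> D (al x) -> E (be x) -> cderiv al x l -> cderiv be x m ->
  exists k, cderiv (fun t => f (al t) (be t)) x k.
Proof.
  intros Hf Hx Hy Ha Hb. destruct (Hf _ _ Hx Hy) as [lf Hlf].
  apply cderiv_is_derive in Ha. apply cderiv_is_derive in Hb.
  assert (H : @ex_derive C_AbsRing C_NormedModule (fun t => f (al t) (be t)) x).
  { apply ex_derive_filterdiff. eexists.
    apply (filterdiff_comp'_2 (T := AbsRing_NormedModule C_AbsRing) (U := C_NormedModule)
      (V := C_NormedModule) (W := C_NormedModule) al be f x _ _ (fun a b => lf (a, b)) Ha Hb).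
    refine (filterdiff_ext_lin _ _ _ Hlf _). intros [p q]. reflexivity. }
  destruct H as [k Hk]. exists k. now apply cderiv_is_derive.
Qed.

Lemma cderiv_id (x : C) : cderiv (fun t => t) x (RtoC 1).
Proof.
  intros eps He. exists 1. split; [lra|]. intros w _.
  replace (w - x - RtoC 1 * (w - x))%C with (RtoC 0) by ring.
  rewrite Cmod_0. apply Rmult_le_pos; [lra | apply Cmod_ge_0].
Qed.

Lemma holo2_locally_bounded (D E : C -> Prop) (f : C -> C -> C) (u a : C) :
  holomorphic2_on D E f -> D u -> E a ->
  exists d, 0 < d /\ forall x y, Cmod (x - u) < d -> Cmod (y - a) < d -> Cmod (f x y) <= Cmod (f u a) + 1.
Proof.
  intros Hf Hu Ha.
  assert (Hc : @continuous (prod_UniformSpace C_UniformSpace C_UniformSpace) C_UniformSpace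
    (fun p => f (fst p) (snd p)) (u, a)).
  { apply (filterdiff_continuous (U := prod_NormedModule C_AbsRing C_NormedModule C_NormedModule)
      (V := C_NormedModule) (fun p => f (fst p) (snd p)) (u, a)). exact (Hf u a Hu Ha). }
  destruct (Hc (fun w => Cmod (w - f u a) < 1)) as [d Hd].
  { apply (locally_C_intro _ _ 1); [lra | auto]. }
  assert (B : forall z w, Cmod (w - z) < d -> @ball C_UniformSpace z d w).
  { intros z w H. pose proof (Rmax_Cmod (w - z)%C) as R1.
    split; simpl; unfold ball; simpl; unfold AbsRing_ball; simpl; unfold abs, minus, plus, opp; simpl.
    - eapply Rle_lt_trans; [|exact H]. eapply Rle_trans; [|exact R1]. apply Rmax_l.
    - eapply Rle_lt_trans; [|exact H]. eapply Rle_trans; [|exact R1]. apply Rmax_r. }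
  exists d. split; [apply cond_pos|]. intros x y Hx Hy.
  assert (H : Cmod (f x y - f u a) < 1) by (apply (Hd (x, y)); split; apply B; assumption).
  replace (f x y) with ((f x y - f u a) + f u a)%C by ring.
  eapply Rle_trans; [apply Cmod_triangle|]. lra.
Qed.

(** On a small bidisk, with one radius for both variables, [f] is bounded and holomorphic in each
    variable; there its double Taylor coefficients exist and are nonnegative by [tc_tc]. *)
Lemma holo2_jet (D E : C -> Prop) (f : C -> C -> C) (u a : C) :
  holomorphic2_on D E f -> open D -> open E -> D u -> E a ->
  (forall k l, C_nonneg (D1D2 k l f u a)) ->
  exists c : nat -> nat -> C, (forall l k, C_nonneg (c l k)) /\
    forall N, exists K d, 0 < d /\ forall x y m, Cmod x <= m -> Cmod y <= m -> 0 < Cmod x -> m < d ->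
     Cmod (f (u + x)%C (a + y)%C - psum (fun l => psum (c l) N x) N y) <= K * m ^ N.
Proof.
  intros Hf HD HE Hu Ha Hnn.
  destruct (locally_C_elim _ _ (HD u Hu)) as [d1 [Hd1 H1]].
  destruct (locally_C_elim _ _ (HE a Ha)) as [d2 [Hd2 H2]].
  destruct (holo2_locally_bounded D E f u a Hf Hu Ha) as [d3 [Hd3 H3]].
  set (d := Rmin (Rmin d1 d2) d3). assert (Hd : 0 < d) by (unfold d; repeat apply Rmin_pos; lra).
  assert (L1 : d <= d1) by (unfold d; eapply Rle_trans; [apply Rmin_l | apply Rmin_l]).
  assert (L2 : d <= d2) by (unfold d; eapply Rle_trans; [apply Rmin_l | apply Rmin_r]).
  assert (L3 : d <= d3) by (unfold d; apply Rmin_r).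
  assert (S1 : forall y, Cmod (y - a) < d -> holo_disk (fun x => f x y) u d).
  { intros y Hy w Hw. apply (holo2_comp D E f (fun t => t) (fun _ => y) w (RtoC 1) (RtoC 0) Hf).
    apply H1; lra. apply H2; lra. apply cderiv_id. apply cderiv_const. }
  assert (S2 : forall x, Cmod (x - u) < d -> holo_disk (f x) a d).
  { intros x Hx w Hw. apply (holo2_comp D E f (fun _ => x) (fun t => t) w (RtoC 0) (RtoC 1) Hf).
    apply H1; lra. apply H2; lra. apply cderiv_const. apply cderiv_id. }
  assert (S3 : forall x y, Cmod (x - u) < d -> Cmod (y - a) < d -> Cmod (f x y) <= Cmod (f u a) + 1).
  { intros x y Hx Hy. apply H3; lra. }
  exists (fun l => tc (fun x => tc (f x) a l) u). split.
  - intros l k. rewrite (tc_tc f u a d d _ Hd Hd S1 S2 S3).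
    assert (Inv : forall n, C_nonneg (/ RtoC (INR (fact n)))%C).
    { intros n. pose proof (INR_fact_lt_0 n). rewrite <- RtoC_inv by lra.
      apply C_nonneg_RtoC. now apply Rlt_le, Rinv_0_lt_compat. }
    apply C_nonneg_mult; [apply C_nonneg_mult; [apply Hnn | apply Inv] | apply Inv].
  - intros N. exact (two_variable_jet f u a d d _ Hd Hd S1 S2 S3 N).
Qed.

Definition pint (p : nat -> C) (n : nat) : C :=
  match n with O => RtoC 0 | S m => (p m / RtoC (INR (S m)))%C end.

Lemma RtoC_INR_S_neq_0 n : RtoC (INR (S n)) <> RtoC 0.
Proof. intros E. apply RtoC_inj in E. pose proof (lt_0_INR (S n) ltac:(lia)). lra. Qed.

Lemma pder_pint p n : pder (pint p) n = p n.
Proof. unfold pder, pint. field. apply RtoC_INR_S_neq_0. Qed.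

Lemma bdd_pint p r : 0 <= r -> bdd p r -> bdd (pint p) r.
Proof.
  intros Hr [M HM]. assert (M0 : 0 <= M).
  { specialize (HM 0%nat). simpl in HM. pose proof (Cmod_ge_0 (p 0%nat)). lra. }
  exists (M * r). intros [|n].
  - simpl pint. rewrite Cmod_0. nra.
  - change (pint p (S n)) with (p n / RtoC (INR (S n)))%C. rewrite Cmod_div, Cmod_R, Rabs_pos_eq by (try apply RtoC_INR_S_neq_0; apply pos_INR).
    assert (I : / INR (S n) <= 1).
    { rewrite <- Rinv_1. apply Rinv_le_contravar; [lra|]. rewrite S_INR. pose proof (pos_INR n). lra. }
    assert (I0 : 0 < / INR (S n)) by (apply Rinv_0_lt_compat, lt_0_INR; lia).
    specialize (HM n). pose proof (Cmod_ge_0 (p n)). pose proof (pow_le r n Hr).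
    replace (Cmod (p n) / INR (S n) * r ^ S n) with (Cmod (p n) * r ^ n * (/ INR (S n) * r)) by (simpl pow; unfold Rdiv; ring).
    apply Rmult_le_compat; [apply Rmult_le_pos; lra | nra | exact HM | nra].
Qed.

(** The Taylor series of [h] is integrated termwise; [has_ps] being a relation, its sum is picked by
    [epsilon]. *)
Lemma holo_primitive (h : C -> C) (u : C) (rho : R) : 0 < rho -> holo_disk h u rho ->
  exists H, H u = RtoC 0 /\ forall x, Cmod (x - u) < rho -> cderiv H x (h x).
Proof.
  intros Hr Hh. destruct (taylor h u rho Hr Hh) as [T _]. set (p := tc h u) in *.
  set (H := fun x => epsilon (inhabits (RtoC 0)) (has_ps (pint p) (x - u))).
  assert (A : analytic_on_disk H u rho (pint p)).
  { intros x Hx. apply epsilon_spec. pose proof (Cmod_ge_0 (x - u)).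
    apply (bdd_has_ps _ ((Cmod (x - u) + rho) / 2)); [lra|]. apply bdd_pint; [lra|].
    apply (analytic_bdd h u rho); [lra | exact T]. }
  exists H. split.
  - pose proof (A u) as E. replace (u - u)%C with (RtoC 0) in E by ring. rewrite Cmod_0 in E.
    exact (has_ps_0 _ _ (E Hr)).
  - intros x Hx. destruct (analytic_cderiv H u rho _ A x Hx) as [D [H1 H2]].
    replace (h x) with D; [exact H2|].
    apply (has_ps_unique p (x - u)); [|now apply T].
    apply (has_ps_ext (pder (pint p))); [apply pder_pint | exact H1].
Qed.

(** As [path_integral] is an [epsilon] choice, two facts are needed: every admissible value, along
    whatever path, equals H x - H u, and some value exists. The segment from [u] to [x] provides
    one, a disk being star-shaped about its centre. *)
Lemma path_integral_primitive (U : C -> Prop) (h H : C -> C) (u x : C) (rho : R) :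
  0 < rho -> (forall z, U z <-> Cmod (z - u) < rho) -> holo_disk h u rho ->
  (forall z, Cmod (z - u) < rho -> cderiv H z (h z)) -> U x ->
  path_integral U h u x = (H x - H u)%C.
Proof.
  intros Hr HU Hh HH Hx.
  assert (Val : forall v, is_path_integral U h u x v -> v = (H x - H u)%C).
  { intros v (ga & dga & (G0 & G1 & Hga) & Hv).
    apply (is_CInt_unique _ _ _ _ _ Hv). rewrite <- G0, <- G1 at 1.
    apply (is_CInt_deriv (fun t => H (ga t))); [lra | |].
    - intros t Ht. destruct (Hga t Ht) as (A & B & _).
      apply (rderiv_comp H ga); [apply HH, HU, A | now apply rderiv_is_derive].
    - intros t Ht. destruct (Hga t Ht) as (A & B & Cc). apply continuous_R_Cmult; [|exact Cc].
      destruct (Hh (ga t)) as [l Hl]; [now apply HU|].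
      apply (rderiv_continuous _ _ (l * dga t)%C). apply (rderiv_comp h ga); [exact Hl | now apply rderiv_is_derive]. }
  apply Val. unfold path_integral. apply epsilon_spec.
  set (ga := fun t : R => (u + RtoC t * (x - u))%C).
  assert (Hd : forall t, rderiv ga t (x - u)%C).
  { intros t eps He. exists 1. split; [lra|]. intros t' _. unfold ga.
    replace (u + RtoC t' * (x - u) - (u + RtoC t * (x - u)) - RtoC (t' - t) * (x - u))%C with (RtoC 0)
      by (rewrite RtoC_minus; ring).
    rewrite Cmod_0. apply Rmult_le_pos; [lra | apply Rabs_pos]. }
  assert (Hin : forall t, 0 <= t <= 1 -> U (ga t)).
  { intros t Ht. apply HU. apply HU in Hx. unfold ga.
    replace (u + RtoC t * (x - u) - u)%C with (RtoC t * (x - u))%C by ring.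
    rewrite Cmod_mult, Cmod_R, Rabs_pos_eq by lra. pose proof (Cmod_ge_0 (x - u)). nra. }
  eexists. exists ga, (fun _ => (x - u)%C). split.
  - split; [unfold ga; ring|]. split; [unfold ga; ring|]. intros t Ht.
    split; [now apply Hin|]. split; [now apply rderiv_is_derive|].
    apply (@continuous_const R_UniformSpace C_UniformSpace).
  - apply (is_CInt_deriv (fun t => H (ga t))); [lra | |].
    + intros t Ht. apply (rderiv_comp H ga); [apply HH, HU, Hin, Ht | apply Hd].
    + intros t Ht. apply continuous_R_Cmult; [|apply (@continuous_const R_UniformSpace C_UniformSpace)].
      destruct (Hh (ga t)) as [l Hl]; [now apply HU, Hin|].
      apply (rderiv_continuous _ _ (l * (x - u))%C). apply (rderiv_comp h ga); [exact Hl | apply Hd].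
Qed.

(** The counterpart of [dom] for actual Taylor coefficients: [dom] passes through compositions,
    [coef_dom] through integrations, and uniqueness of jets connects them. *)
Definition coef_dom (u : C) (N M : nat) (phi psi : C -> C) : Prop :=
  forall k, (k < N)%nat -> C_nonneg (tc phi u k) /\ C_nonneg (tc psi u k - tc phi u k)%C /\
    ((k < M)%nat -> tc phi u k = tc psi u k).

Lemma coef_dom_dom (u a : C) (rho : R) (N M : nat) (phi psi : C -> C) : 0 < rho ->
  holo_disk phi u rho -> holo_disk psi u rho -> phi u = a -> psi u = a ->
  coef_dom u N M phi psi ->
  dom N M (fun z => phi (u + z) - a)%C (fun z => psi (u + z) - a)%C.
Proof.
  intros Hr H1 H2 E1 E2 H.
  assert (J : forall f, holo_disk f u rho -> f u = a ->
    jet N (fun z => f (u + z) - a)%C (fun k => match k with O => RtoC 0 | _ => tc f u k end)).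
  { intros f Hf Ef. pose proof (analytic_jet f u rho _ (S N) Hr (proj1 (taylor f u rho Hr Hf))) as A.
    (* Dividing by z and multiplying back replaces the constant coefficient by 0, as required for f
       (u + z) - a. *)
    apply jet_split, jet_shift in A. apply jet_pred in A.
    apply (jet_ext N (fun z => z * ((f (u + z) - tc f u 0) / z))%C).
    - intros z Hz. rewrite tc_0, Ef. field. exact Hz.
    - refine (jet_coef_ext N _ _ _ _ A). now intros [|k] _. }
  exists (fun k => match k with O => RtoC 0 | _ => tc phi u k end), (fun k => match k with O => RtoC 0 | _ => tc psi u k end).
  split; [now apply J|]. split; [now apply J|]. intros [|k] Hk.
  - split; [apply C_nonneg_RtoC; lra|]. split; [apply C_nonneg_sub_self | easy].
  - now apply H.
Qed.

Lemma dom_coef_dom (u : C) (rho : R) (N M : nat) (phi psi : C -> C) : 0 < rho ->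
  holo_disk phi u rho -> holo_disk psi u rho ->
  dom N M (fun z => phi (u + z)%C) (fun z => psi (u + z)%C) -> coef_dom u N M phi psi.
Proof.
  intros Hr H1 H2 (p & q & Hp & Hq & H) k Hk.
  rewrite (jet_unique N _ _ _ (analytic_jet phi u rho _ N Hr (proj1 (taylor phi u rho Hr H1))) Hp k Hk).
  rewrite (jet_unique N _ _ _ (analytic_jet psi u rho _ N Hr (proj1 (taylor psi u rho Hr H2))) Hq k Hk).
  now apply H.
Qed.

Lemma tc_S_primitive (G h : C -> C) (u : C) (rho : R) : 0 < rho ->
  holo_disk h u rho -> (forall x, Cmod (x - u) < rho -> cderiv G x (h x)) ->
  forall k, tc G u (S k) = (tc h u k / RtoC (INR (S k)))%C.
Proof.
  intros Hr Hh HG k.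
  rewrite (tc_ext h (C_derive G) u rho Hr Hh).
  - rewrite tc_pder. unfold pder. field. apply RtoC_INR_S_neq_0.
  - intros z Hz. symmetry. now apply cderiv_C_derive, HG.
Qed.

(** Integration sends coefficient k, divided by k + 1, to position k + 1, and both constant terms
    equal [a']. Hence one integration gains one order of comparison and one exact coefficient. *)
Lemma coef_dom_step (D E : C -> Prop) (f : C -> C -> C) (u a a' : C) (rho : R) (N M : nat)
  (phi psi G G' : C -> C) :
  0 < rho -> (forall z, D z <-> Cmod (z - u) < rho) -> open D -> open E -> holomorphic2_on D E f ->
  E a -> (forall k l, C_nonneg (D1D2 k l f u a)) -> C_nonneg a' ->
  holo_disk phi u rho -> holo_disk psi u rho -> phi u = a -> psi u = a ->
  (forall x, D x -> E (phi x)) -> (forall x, D x -> E (psi x)) ->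
  (forall x, D x -> cderiv G x (f x (phi x))) -> (forall x, D x -> cderiv G' x (f x (psi x))) ->
  G u = a' -> G' u = a' ->
  coef_dom u N M phi psi -> coef_dom u (S N) (S M) G G'.
Proof.
  intros Hr HD HDo HEo Hf Ha Hnn Ha' Hphi Hpsi Ephi Epsi Vphi Vpsi HG HG' EG EG' H.
  assert (Hu : D u) by (apply HD; replace (u - u)%C with (RtoC 0) by ring; rewrite Cmod_0; exact Hr).
  assert (Hcomp : forall p, holo_disk p u rho -> (forall x, D x -> E (p x)) -> holo_disk (fun x => f x (p x)) u rho).
  { intros p Hp Vp x Hx. destruct (Hp x Hx) as [l Hl].
    apply (holo2_comp D E f (fun t => t) p x (RtoC 1) l Hf); [now apply HD | apply Vp; now apply HD | apply cderiv_id | exact Hl]. }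
  pose proof (Hcomp phi Hphi Vphi) as H1. pose proof (Hcomp psi Hpsi Vpsi) as H2.
  destruct (holo2_jet D E f u a Hf HDo HEo Hu Ha Hnn) as (c & Hc & Hj).
  assert (Lip : forall p, holo_disk p u rho -> p u = a ->
    exists L d, 0 < d /\ forall z, 0 < Cmod z < d -> Cmod (p (u + z)%C - a) <= L * Cmod z).
  { intros p Hp Ep. destruct (Hp u) as [l Hl]; [now apply HD|]. destruct (cderiv_lip _ _ _ Hl) as [d [Hd Hl']].
    exists (Cmod l + 1), d. split; [exact Hd|]. intros z Hz. specialize (Hl' (u + z)%C).
    replace (u + z - u)%C with z in Hl' by ring. rewrite Ep in Hl'. apply Hl'. lra. }
  assert (Hh : coef_dom u N M (fun x => f x (phi x)) (fun x => f x (psi x))).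
  { apply (dom_coef_dom u rho); [exact Hr | exact H1 | exact H2 |].
    refine (dom_ext _ _ _ _ _ _ _ _ (comp_dom f u a c (fun z => phi (u + z) - a)%C (fun z => psi (u + z) - a)%C N M
      (Hj N) Hc (Lip phi Hphi Ephi) (Lip psi Hpsi Epsi) (coef_dom_dom u a rho N M phi psi Hr Hphi Hpsi Ephi Epsi H)));
      intros z _; cbv beta; f_equal; ring. }
  intros [|k] Hk.
  - rewrite !tc_0, EG, EG'. split; [exact Ha'|]. split; [apply C_nonneg_sub_self | easy].
  - rewrite (tc_S_primitive G _ u rho Hr H1) by (intros; now apply HG, HD).
    rewrite (tc_S_primitive G' _ u rho Hr H2) by (intros; now apply HG', HD).
    destruct (Hh k ltac:(lia)) as (A & B & Cc).
    assert (I : C_nonneg (/ RtoC (INR (S k)))%C).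
    { pose proof (lt_0_INR (S k) ltac:(lia)). rewrite <- RtoC_inv by lra.
      apply C_nonneg_RtoC. now apply Rlt_le, Rinv_0_lt_compat. }
    split; [now apply C_nonneg_mult|]. split.
    + match goal with |- C_nonneg (?x / ?n - ?y / ?n)%C => replace (x / n - y / n)%C with ((x - y) * / n)%C by (unfold Cdiv; ring) end.
      now apply C_nonneg_mult.
    + intros HM. rewrite Cc by lia. reflexivity.
Qed.

(** * Majorants and convergence *)

Fixpoint rsum (q : nat -> R) (n : nat) (r : R) : R :=
  match n with O => 0 | S m => rsum q m r + q m * r ^ m end.

Lemma C_nonneg_Cmod z : C_nonneg z -> Cmod z = Re z.
Proof.
  intros [H1 H2]. replace z with (RtoC (Re z)).
  - rewrite Cmod_R, re_RtoC. now apply Rabs_pos_eq.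
  - destruct z as [x y]. simpl in *. now rewrite H1.
Qed.

Lemma C_nonneg_eq z : C_nonneg z -> z = RtoC (Re z).
Proof. intros [H1 H2]. destruct z as [x y]. simpl in *. now rewrite H1. Qed.

Lemma rsum_incr (q : nat -> R) (n k : nat) (r : R) : 0 <= r -> (forall k, 0 <= q k) ->
  rsum q n r <= rsum q (n + k) r.
Proof.
  intros Hr Hq. induction k; [rewrite Nat.add_0_r; lra|]. rewrite Nat.add_succ_r. simpl.
  pose proof (Rmult_le_pos _ _ (Hq (n + k)%nat) (pow_le r (n + k) Hr)). lra.
Qed.

Lemma rsum_mono (q : nat -> R) (n : nat) (t r : R) : 0 <= t <= r -> (forall k, 0 <= q k) ->
  rsum q n t <= rsum q n r.
Proof.
  intros Htr Hq. induction n; simpl; [lra|]. apply Rplus_le_compat; [exact IHn|].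
  apply Rmult_le_compat_l; [apply Hq | now apply pow_incr].
Qed.

Lemma pow_lt_pow (t r : R) (k : nat) : 0 <= t < r -> t ^ S k < r ^ S k.
Proof.
  intros H. induction k; [simpl; lra|].
  change (t * t ^ S k < r * r ^ S k). pose proof (pow_le t (S k) (proj1 H)).
  apply Rle_lt_trans with (t * r ^ S k); [apply Rmult_le_compat_l; lra|].
  apply Rmult_lt_compat_r; lra.
Qed.

(** No term decreases, so the increase of a single one is a lower bound for the total; this is the
    source of the strict inequality in [dominated_in_V]. *)
Lemma rsum_gap (q : nat -> R) (n k : nat) (t r : R) : 0 <= t <= r -> (forall k, 0 <= q k) ->
  (k < n)%nat -> q k * (r ^ k - t ^ k) <= rsum q n r - rsum q n t.
Proof.
  intros Htr Hq. revert k. induction n; intros k Hk; [lia|]. simpl.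
  assert (D : forall j, 0 <= q j * (r ^ j - t ^ j)).
  { intros j. apply Rmult_le_pos; [apply Hq|]. pose proof (pow_incr t r j Htr). lra. }
  destruct (Nat.eq_dec k n) as [->|].
  - pose proof (rsum_mono q n t r Htr Hq). specialize (D n). lra.
  - specialize (IHn k ltac:(lia)). specialize (D n). lra.
Qed.

Lemma psum_RtoC (p : nat -> C) (n : nat) (r : R) : (forall k, C_nonneg (p k)) ->
  psum p n (RtoC r) = RtoC (rsum (fun k => Re (p k)) n r).
Proof.
  intros Hp. induction n; [easy|]. simpl. rewrite IHn, RtoC_plus, RtoC_mult, RtoC_pow.
  now rewrite <- (C_nonneg_eq (p n)).
Qed.

(** The first [n] terms cancel, and afterwards 0 <= q k - p k <= q k, so the difference is at most a
    block of the majorant series. *)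
Lemma psum_diff_le (p q : nat -> C) (z : C) (r : R) (n k : nat) : Cmod z <= r ->
  (forall k, C_nonneg (p k)) -> (forall k, C_nonneg (q k - p k)%C) ->
  (forall k, (k < n)%nat -> p k = q k) ->
  Cmod (psum p (n + k) z - psum q (n + k) z) <=
    rsum (fun k => Re (q k)) (n + k) r - rsum (fun k => Re (q k)) n r.
Proof.
  intros Hz Hp Hq E. induction k.
  - rewrite Nat.add_0_r, (psum_ext p q n z E).
    replace (psum q n z - psum q n z)%C with (RtoC 0) by ring. rewrite Cmod_0. lra.
  - rewrite Nat.add_succ_r. simpl. set (m := (n + k)%nat) in *.
    replace (psum p m z + p m * z ^ m - (psum q m z + q m * z ^ m))%C with
      ((psum p m z - psum q m z) - (q m - p m) * z ^ m)%C by ring.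
    eapply Rle_trans; [apply Cmod_triangle_minus|]. rewrite Cmod_mult, Cmod_pow, (C_nonneg_Cmod (q m - p m)) by apply Hq.
    replace (Re (q m - p m)) with (Re (q m) + - Re (p m)) by (unfold Cminus; now rewrite re_plus, re_opp).
    pose proof (proj2 (Hp m)). pose proof (proj2 (Hq m)) as Hq2. unfold Cminus in Hq2. rewrite re_plus, re_opp in Hq2.
    assert ((Re (q m) + - Re (p m)) * Cmod z ^ m <= Re (q m) * r ^ m).
    { apply Rmult_le_compat; [lra | apply pow_le, Cmod_ge_0 | lra |].
      apply pow_incr. split; [apply Cmod_ge_0 | exact Hz]. }
    lra.
Qed.

Lemma psum_dev_le (p q : nat -> C) (z : C) (n : nat) :
  (forall k, C_nonneg (p k)) -> (forall k, C_nonneg (q k - p k)%C) ->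
  Cmod (p 0%nat - psum p (S n) z) <=
    rsum (fun k => Re (q k)) (S n) (Cmod z) - Re (q 0%nat).
Proof.
  intros Hp Hq. induction n.
  - simpl. replace (p 0%nat - (RtoC 0 + p 0%nat * 1))%C with (RtoC 0) by ring. rewrite Cmod_0. lra.
  - change (psum p (S (S n)) z) with (psum p (S n) z + p (S n) * z ^ S n)%C.
    change (rsum (fun k => Re (q k)) (S (S n)) (Cmod z)) with
      (rsum (fun k => Re (q k)) (S n) (Cmod z) + Re (q (S n)) * Cmod z ^ S n).
    replace (p 0%nat - (psum p (S n) z + p (S n) * z ^ S n))%C with
      ((p 0%nat - psum p (S n) z) - p (S n) * z ^ S n)%C by ring.
    eapply Rle_trans; [apply Cmod_triangle_minus|]. rewrite Cmod_mult, Cmod_pow, (C_nonneg_Cmod (p (S n))) by apply Hp.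
    pose proof (proj2 (Hq (S n))) as Hq2. unfold Cminus in Hq2. rewrite re_plus, re_opp in Hq2.
    assert (Re (p (S n)) * Cmod z ^ S n <= Re (q (S n)) * Cmod z ^ S n).
    { apply Rmult_le_compat_r; [apply pow_le, Cmod_ge_0 | lra]. }
    lra.
Qed.

Lemma has_ps_diff_le (p q : nat -> C) (z v w : C) (B : R) (n0 : nat) :
  has_ps p z v -> has_ps q z w ->
  (forall n, (n0 <= n)%nat -> Cmod (psum p n z - psum q n z) <= B) -> Cmod (v - w) <= B.
Proof.
  intros Hv Hw H. apply le_epsilon. intros eps He.
  destruct (Hv (eps / 2)) as [N1 H1]; [lra|]. destruct (Hw (eps / 2)) as [N2 H2]; [lra|].
  set (n := (N1 + N2 + n0)%nat). specialize (H1 n ltac:(unfold n; lia)).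
  specialize (H2 n ltac:(unfold n; lia)). specialize (H n ltac:(unfold n; lia)).
  replace (v - w)%C with ((psum p n z - psum q n z) + ((v - psum p n z) - (w - psum q n z)))%C by ring.
  eapply Rle_trans; [apply Cmod_triangle|].
  pose proof (Cmod_triangle_minus (v - psum p n z) (w - psum q n z)). lra.
Qed.

Lemma has_ps_rsum_lim (q : nat -> C) (r : R) (v : C) : (forall k, C_nonneg (q k)) ->
  has_ps q (RtoC r) v -> forall eps, 0 < eps -> exists N, forall n, (N <= n)%nat ->
    Rabs (Re v - rsum (fun k => Re (q k)) n r) < eps.
Proof.
  intros Hq H eps He. destruct (H eps He) as [N HN]. exists N. intros n Hn.
  eapply Rle_lt_trans; [|apply (HN n Hn)]. rewrite psum_RtoC by exact Hq.
  eapply Rle_trans; [|apply re_le_Cmod]. right. reflexivity.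
Qed.

Lemma has_ps_rsum_le (q : nat -> C) (r : R) (v : C) (n : nat) : 0 <= r -> (forall k, C_nonneg (q k)) ->
  has_ps q (RtoC r) v -> rsum (fun k => Re (q k)) n r <= Re v.
Proof.
  intros Hr Hq H. apply le_epsilon. intros eps He.
  destruct (has_ps_rsum_lim q r v Hq H eps He) as [N HN]. specialize (HN (n + N)%nat ltac:(lia)).
  pose proof (rsum_incr (fun k => Re (q k)) n N r Hr (fun k => proj2 (Hq k))).
  apply Rabs_def2 in HN. lra.
Qed.

(** The limit is the supremum, or [p_infty] if there is no bound. Existence has to be proved because
    [R_tilde] is an [epsilon] choice and carries information only when a limit exists. *)
Lemma monotone_left_limit (G : R -> R) (rho : R) : 0 < rho ->
  (forall t r, 0 <= t -> t <= r -> r < rho -> G t <= G r) ->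
  exists l : Rbar, filterlim G (at_left rho) (Rbar_locally l).
Proof.
  intros Hr Hm.
  destruct (classic (exists B, forall t, 0 <= t < rho -> G t <= B)) as [[B HB] | Hun].
  - destruct (completeness (fun y => exists t, 0 <= t < rho /\ y = G t)) as [s [Hs1 Hs2]].
    + exists B. intros y [t [Ht ->]]. now apply HB.
    + exists (G 0), 0. split; [lra | easy].
    + exists (Finite s). intros P [e HP].
      assert (Ex : exists t, 0 <= t < rho /\ s - e < G t).
      { apply NNPP. intros Hn. pose proof (cond_pos e).
        assert (s <= s - e); [|lra]. apply Hs2. intros y [t [Ht ->]].
        apply Rnot_lt_le. intros Hlt. apply Hn. now exists t. }
      destruct Ex as [t [Ht HGt]].
      assert (Hd : 0 < rho - t) by lra. exists (mkposreal _ Hd). intros y Hy Hyr.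
      change (Rabs (y - rho) < rho - t) in Hy. apply Rabs_def2 in Hy. apply HP.
      change (Rabs (G y - s) < e). apply Rabs_def1.
      * assert (G y <= s) by (apply Hs1; exists y; split; [lra | easy]). pose proof (cond_pos e). lra.
      * pose proof (Hm t y ltac:(lra) ltac:(lra) ltac:(lra)). lra.
  - exists p_infty. intros P [M HP].
    assert (Ex : exists t, 0 <= t < rho /\ M < G t).
    { apply NNPP. intros Hn. apply Hun. exists M. intros t Ht.
      apply Rnot_lt_le. intros Hlt. apply Hn. now exists t. }
    destruct Ex as [t [Ht HGt]].
    assert (Hd : 0 < rho - t) by lra. exists (mkposreal _ Hd). intros y Hy Hyr.
    change (Rabs (y - rho) < rho - t) in Hy. apply Rabs_def2 in Hy. apply HP.
    pose proof (Hm t y ltac:(lra) ltac:(lra) ltac:(lra)). lra.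
Qed.

Lemma monotone_le_left_limit (G : R -> R) (rho r : R) (l : Rbar) : 0 <= r < rho ->
  (forall t r, 0 <= t -> t <= r -> r < rho -> G t <= G r) ->
  filterlim G (at_left rho) (Rbar_locally l) -> Rbar_le (Finite (G r)) l.
Proof.
  intros Hr Hm Hl.
  apply (filterlim_le (F := at_left rho) (fun _ => G r) G); [| |exact Hl].
  - assert (Hd : 0 < rho - r) by lra. exists (mkposreal _ Hd). intros y Hy Hyr.
    change (Rabs (y - rho) < rho - r) in Hy. apply Rabs_def2 in Hy. apply Hm; lra.
  - intros P HP. apply (filter_forall (F := at_left rho) (fun _ => P (G r))). intros y. exact (locally_singleton (G r) P HP).
Qed.

Lemma rsum_continuous (q : nat -> R) (n : nat) (r : R) : continuity_pt (rsum q n) r.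
Proof.
  induction n; simpl.
  - apply continuity_pt_const. now intros x y.
  - apply (continuity_pt_plus (rsum q n) (fun r => q n * r ^ n)); [exact IHn|].
    apply (continuity_pt_scal (fun r => r ^ n)). apply derivable_continuous_pt, derivable_pt_pow.
Qed.

(** Partial sums are polynomials and so reach the boundary radius by continuity, although nothing is
    assumed about the function there. *)
Lemma rsum_bound_closure (q : nat -> R) (n : nat) (rho B : R) : 0 < rho ->
  (forall t, 0 <= t < rho -> rsum q n t <= B) -> rsum q n rho <= B.
Proof.
  intros Hr H. apply le_epsilon. intros eps He.
  destruct (rsum_continuous q n rho eps He) as [d [Hd Hc]].
  set (t := Rmax 0 (rho - d / 2)).
  assert (Ht : 0 <= t < rho /\ rho - d / 2 <= t).
  { unfold t. pose proof (Rmax_l 0 (rho - d / 2)). pose proof (Rmax_r 0 (rho - d / 2)).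
    split; [split; [lra|]|lra]. apply Rmax_lub_lt; lra. }
  specialize (Hc t). specialize (H t ltac:(lra)).
  assert (A : Rabs (rsum q n t - rsum q n rho) < eps).
  { apply Hc. split. split; [exact I | lra]. unfold Rdist. simpl. unfold Rdist. apply Rabs_def1; lra. }
  apply Rabs_def2 in A. lra.
Qed.

Lemma rsum_tail_small (q : nat -> R) (r B eps : R) : 0 <= r -> (forall k, 0 <= q k) ->
  (forall n, rsum q n r <= B) -> 0 < eps ->
  exists N, forall n k, (N <= n)%nat -> rsum q (n + k) r - rsum q n r < eps.
Proof.
  intros Hr Hq HB He.
  destruct (completeness (fun y => exists n, y = rsum q n r)) as [s [Hs1 Hs2]].
  - exists B. intros y [n ->]. apply HB.
  - exists (rsum q 0 r). now exists 0%nat.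
  - assert (Ex : exists N, s - eps < rsum q N r).
    { apply NNPP. intros Hn. assert (s <= s - eps); [|lra]. apply Hs2. intros y [n ->].
      apply Rnot_lt_le. intros Hlt. apply Hn. now exists n. }
    destruct Ex as [N HN]. exists N. intros n k Hn.
    pose proof (rsum_incr q N (n - N) r Hr Hq) as I. replace (N + (n - N))%nat with n in I by lia.
    assert (rsum q (n + k) r <= s) by (apply Hs1; now exists (n + k)%nat). lra.
Qed.

(** * The approximation system: coefficients, inclusions and convergence *)

Section NonNegativeSystem.

Variables (A : approx_system) (g : nat -> C -> C) (rho : R).
Hypothesis (hAg : is_AS_for A g) (hnn : non_negative A) (hrho : 0 < rho).
Hypothesis hU : forall z : C, as_U A z <-> disk (as_u A) (Finite rho) z.
Hypothesis hV : forall i : nat, (1 <= i)%nat ->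
  subset (disk (as_a A i) (R_tilde A g rho i)) (as_V A (i - 1)).

Let u := as_u A.

Lemma as_U_disk z : as_U A z <-> Cmod (z - u) < rho.
Proof. apply hU. Qed.

Lemma g_deriv i x : as_U A x -> cderiv (g i) x (as_f A i x (g (S i) x)).
Proof. intros Hx. apply cderiv_is_derive. destruct (hAg i) as (_ & _ & _ & H). now apply H. Qed.

Lemma g_holo i : holo_disk (g i) u rho.
Proof. intros x Hx. eexists. apply g_deriv. now apply as_U_disk. Qed.

Lemma g_base i : g i u = as_a A i.
Proof. apply hAg. Qed.

Lemma g_ps i x : as_U A x -> has_ps (tc (g i) u) (x - u) (g i x).
Proof. intros Hx. apply (taylor (g i) u rho hrho (g_holo i)). now apply as_U_disk. Qed.

Lemma system_step i N M phi psi G G' :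
  holo_disk phi u rho -> holo_disk psi u rho ->
  phi u = as_a A (S i) -> psi u = as_a A (S i) ->
  (forall x, as_U A x -> as_V A i (phi x)) -> (forall x, as_U A x -> as_V A i (psi x)) ->
  (forall x, as_U A x -> cderiv G x (as_f A i x (phi x))) ->
  (forall x, as_U A x -> cderiv G' x (as_f A i x (psi x))) ->
  G u = as_a A i -> G' u = as_a A i ->
  coef_dom u N M phi psi -> coef_dom u (S N) (S M) G G'.
Proof.
  intros. apply (coef_dom_step (as_U A) (as_V A i) (as_f A i) u (as_a A (S i)) (as_a A i) rho N M phi psi); auto.
  - apply as_U_open.
  - apply as_V_open.
  - apply as_f_holo.
  - apply as_a_in.
  - intros k l. apply hnn.
  - apply hnn.
Qed.

(** Nonnegativity is domination of g_j by itself. Order N for g_(j + 1) gives order N + 1 for g_j,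
    so the induction on N treats all indices j at once. *)
Lemma g_coef_nonneg i k : C_nonneg (tc (g i) u k).
Proof.
  assert (H : forall N j, coef_dom u N N (g j) (g j)).
  { induction N; intros j; [intros k' Hk; lia|].
    apply (system_step j N N (g (S j)) (g (S j))); auto using g_holo, g_base; try (intros; now apply g_deriv).
    - apply hAg.
    - apply hAg. }
  apply (H (S k) i k). lia.
Qed.

Let Q i k := Re (tc (g i) u k).

Lemma Q_nonneg i k : 0 <= Q i k.
Proof. apply g_coef_nonneg. Qed.

Lemma u_plus_in r : 0 <= r < rho -> as_U A (u + RtoC r)%C.
Proof.
  intros Hr. apply as_U_disk. replace (u + RtoC r - u)%C with (RtoC r) by ring.
  rewrite Cmod_R, Rabs_pos_eq; lra.
Qed.

Lemma g_ps_real i r : 0 <= r < rho -> has_ps (tc (g i) u) (RtoC r) (g i (u + RtoC r)%C).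
Proof.
  intros Hr. pose proof (g_ps i _ (u_plus_in r Hr)) as H.
  now replace (u + RtoC r - u)%C with (RtoC r) in H by ring.
Qed.

Let G i r := Re (g i (u + RtoC r)%C - as_a A i)%C.

Lemma G_eq i r : G i r = Re (g i (u + RtoC r)%C) - Q i 0.
Proof. unfold G, Q, Cminus. rewrite re_plus, re_opp, tc_0, g_base. ring. Qed.

Lemma G_gap i t r k : 0 <= t -> t <= r -> r < rho -> Q i k * (r ^ k - t ^ k) <= G i r - G i t.
Proof.
  intros Ht Htr Hr. rewrite !G_eq. apply le_epsilon. intros eps He.
  destruct (has_ps_rsum_lim _ r _ (g_coef_nonneg i) (g_ps_real i r ltac:(lra)) (eps / 2)) as [N1 H1]; [lra|].
  destruct (has_ps_rsum_lim _ t _ (g_coef_nonneg i) (g_ps_real i t ltac:(lra)) (eps / 2)) as [N2 H2]; [lra|].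
  set (n := (S k + N1 + N2)%nat). specialize (H1 n ltac:(unfold n; lia)). specialize (H2 n ltac:(unfold n; lia)).
  fold (Q i) in H1, H2. change (fun k => Re (tc (g i) u k)) with (Q i) in H1, H2.
  pose proof (rsum_gap (Q i) n k t r ltac:(lra) (Q_nonneg i) ltac:(unfold n; lia)).
  apply Rabs_def2 in H1. apply Rabs_def2 in H2. lra.
Qed.

Lemma G_mono i t r : 0 <= t -> t <= r -> r < rho -> G i t <= G i r.
Proof. intros Ht Htr Hr. pose proof (G_gap i t r 0 Ht Htr Hr). simpl in H. lra. Qed.

Lemma G_le_R_tilde i r : 0 <= r < rho -> Rbar_le (Finite (G i r)) (R_tilde A g rho i).
Proof.
  intros Hr. apply (monotone_le_left_limit (G i) rho r); [exact Hr | apply G_mono |].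
  unfold R_tilde. apply (epsilon_spec (inhabits p_infty)
    (fun l => filterlim (G i) (at_left rho) (Rbar_locally l))).
  apply monotone_left_limit; [exact hrho | apply G_mono].
Qed.

Lemma dominated_in_V i phi : holo_disk phi u rho -> phi u = as_a A (S i) ->
  (forall k, C_nonneg (tc phi u k)) -> (forall k, C_nonneg (tc (g (S i)) u k - tc phi u k)%C) ->
  forall x, as_U A x -> as_V A i (phi x).
Proof.
  intros Hphi Eu Hp Hq x Hx. pose proof (proj1 (as_U_disk x) Hx) as Hx'. pose proof (Cmod_ge_0 (x - u)).
  assert (Dev : Cmod (phi x - as_a A (S i)) <= G (S i) (Cmod (x - u))).
  { apply (has_ps_limit_le (tc phi u) (x - u) _ _ _ 1).
    - now apply (taylor phi u rho hrho Hphi).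
    - intros [|n] Hn; [lia|]. rewrite <- Eu, <- (tc_0 phi u).
      eapply Rle_trans; [apply (psum_dev_le _ (tc (g (S i)) u) _ _ Hp Hq)|].
      rewrite G_eq. apply Rplus_le_compat_r.
      apply (has_ps_rsum_le (tc (g (S i)) u)); [lra | apply g_coef_nonneg | apply g_ps_real; lra]. }
  destruct (classic (exists k, 0 < Q (S i) (S k))) as [[k Hk] | Hn].
  - replace i with (S i - 1)%nat by lia. apply hV; [lia|].
    (* At any radius strictly between |x - u| and rho, [G] has already grown by a positive amount
       and is still at most the limit [R_tilde]; the midpoint is such a radius. *)
    set (r := (Cmod (x - u) + rho) / 2).
    pose proof (G_gap (S i) (Cmod (x - u)) r (S k) ltac:(lra) ltac:(unfold r; lra) ltac:(unfold r; lra)) as Gap.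
    pose proof (pow_lt_pow (Cmod (x - u)) r k ltac:(unfold r; lra)) as P.
    pose proof (G_le_R_tilde (S i) r ltac:(unfold r; lra)) as L.
    unfold disk. eapply Rbar_lt_le_trans; [|exact L]. simpl.
    assert (0 < Q (S i) (S k) * (r ^ S k - Cmod (x - u) ^ S k)) by (apply Rmult_lt_0_compat; lra).
    lra.
  (* Now all higher coefficients of g_(i + 1) vanish and its disk is empty. But then phi x is the
     centre itself, which lies in V_i by the definition of a system. *)
  - assert (Z : phi x = as_a A (S i)); [|rewrite Z; apply as_a_in].
    apply Ceq_minus, Cmod_eq_0. apply Rle_antisym; [|apply Cmod_ge_0].
    eapply Rle_trans; [exact Dev|]. rewrite G_eq.
    apply le_epsilon. intros eps He.
    destruct (has_ps_rsum_lim _ (Cmod (x - u)) _ (g_coef_nonneg (S i)) (g_ps_real (S i) (Cmod (x - u)) ltac:(lra)) eps He) as [N HN].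
    specialize (HN (S N) ltac:(lia)). change (fun k => Re (tc (g (S i)) u k)) with (Q (S i)) in HN.
    assert (E : forall n, rsum (Q (S i)) (S n) (Cmod (x - u)) = Q (S i) 0%nat).
    { induction n; [simpl; ring|].
      change (rsum (Q (S i)) (S n) (Cmod (x - u)) + Q (S i) (S n) * Cmod (x - u) ^ S n = Q (S i) 0%nat).
      rewrite IHn. replace (Q (S i) (S n)) with 0; [ring|].
      apply Rle_antisym; [apply Q_nonneg|]. apply Rnot_lt_le. intros Hlt. apply Hn. now exists n. }
    rewrite E in HN. apply Rabs_def2 in HN. lra.
Qed.

Lemma tc_const (a : C) k : tc (fun _ => a) u k = match k with O => a | _ => RtoC 0 end.
Proof.
  symmetry. revert k. apply (analytic_tc (fun _ => a) u 1); [lra|]. intros z _ eps He.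
  exists 1%nat. intros [|n] Hn; [lia|]. rewrite psum_const.
  replace (a - a)%C with (RtoC 0) by ring. now rewrite Cmod_0.
Qed.

Lemma coef_dom_all_nonneg M phi psi : (forall N, coef_dom u N M phi psi) ->
  (forall k, C_nonneg (tc phi u k)) /\ (forall k, C_nonneg (tc psi u k - tc phi u k)%C) /\
  (forall k, (k < M)%nat -> tc phi u k = tc psi u k).
Proof.
  intros H. repeat split; intros; apply (H (S k) k); auto; lia.
Qed.

(** After [m] integrations the coefficients of index 0 to m are exact, which is the count S m. The
    three claims are proved together since the next integrand is holomorphic only by the inclusion
    that domination yields. *)
Lemma approx_spec m : forall i,
  holo_disk (approx_aux A m i) u rho /\ approx_aux A m i u = as_a A i /\
  forall N, coef_dom u N (S m) (approx_aux A m i) (g i).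
Proof.
  induction m; intros i.
  - split; [intros x _; exists (RtoC 0); apply (cderiv_const (as_a A i))|]. split; [easy|].
    intros N k _. simpl approx_aux. rewrite tc_const. destruct k.
    + rewrite tc_0, g_base. split; [apply hnn|]. split; [apply C_nonneg_sub_self | easy].
    + split; [apply C_nonneg_RtoC; lra|]. split; [|intros; lia].
      replace (tc (g i) u (S k) - RtoC 0)%C with (tc (g i) u (S k)) by ring. apply g_coef_nonneg.
  - destruct (IHm (S i)) as (Hh & Hu & Hc).
    set (phi := approx_aux A m (S i)) in *.
    destruct (coef_dom_all_nonneg _ _ _ Hc) as (P1 & P2 & _).
    pose proof (dominated_in_V i phi Hh Hu P1 P2) as HinV.
    set (h := fun t => as_f A i t (phi t)).
    assert (Hhh : holo_disk h u rho).
    { intros x Hx. destruct (Hh x Hx) as [l Hl]. apply as_U_disk in Hx.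
      apply (holo2_comp _ _ (as_f A i) (fun t => t) phi x (RtoC 1) l (as_f_holo A i) Hx (HinV x Hx)); [apply cderiv_id | exact Hl]. }
    destruct (holo_primitive h u rho hrho Hhh) as (H & H0 & HH).
    (* Inside the disk [path_integral] equals the primitive, so the derivative of the approximation
       can be read off from a neighbourhood of x contained in the disk. *)
    assert (E : forall x, Cmod (x - u) < rho -> (as_a A i + H x)%C = approx_aux A (S m) i x).
    { intros x Hx. simpl. fold phi u. fold h. f_equal.
      rewrite (path_integral_primitive (as_U A) h H u x rho hrho as_U_disk Hhh HH); [|now apply as_U_disk].
      rewrite H0. ring. }
    assert (Hd : forall x, as_U A x -> cderiv (approx_aux A (S m) i) x (h x)).
    { intros x Hx. apply as_U_disk in Hx.
      apply (cderiv_ext_near (fun x => as_a A i + H x)%C).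
      - exists (rho - Cmod (x - u)). split; [lra|]. intros w Hw. apply E.
        replace (w - u)%C with ((w - x) + (x - u))%C by ring. pose proof (Cmod_triangle (w - x) (x - u)). lra.
      - replace (h x) with (RtoC 0 + h x)%C by ring.
        apply (cderiv_plus (fun _ => as_a A i)); [apply cderiv_const | now apply HH]. }
    assert (Eu : approx_aux A (S m) i u = as_a A i).
    { rewrite <- E; [rewrite H0; ring|]. replace (u - u)%C with (RtoC 0) by ring. rewrite Cmod_0. exact hrho. }
    split; [intros x Hx; exists (h x); apply Hd; now apply as_U_disk|]. split; [exact Eu|].
    intros N k Hk. revert k Hk.
    assert (D : coef_dom u (S N) (S (S m)) (approx_aux A (S m) i) (g i)).
    { apply (system_step i N (S m) phi (g (S i))); auto using g_holo, g_base; [apply hAg | intros; now apply g_deriv]. }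
    intros k Hk. apply D. lia.
Qed.

(** The error is at most a tail of the majorant series at radius [r], which does not depend on x.
    Allowing r = rho makes smaller disks and the whole disk two instances of one estimate. *)
Lemma approximation_uniform_of_bound (r B : R) (D : C -> Prop) : 0 < r <= rho ->
  (forall x, D x -> as_U A x /\ Cmod (x - u) <= r) ->
  (forall n, rsum (Q 0) n r <= B) -> converges_uniformly_on D (approximation A) (g 0%nat).
Proof.
  intros Hr HD HB eps He.
  destruct (rsum_tail_small (Q 0) r B (eps / 2) ltac:(lra) (Q_nonneg 0) HB ltac:(lra)) as [N HN].
  exists N. intros n Hn x Hx. destruct (HD x Hx) as [HxU Hxr].
  unfold approximation, approx_at. rewrite Nat.sub_0_r.
  destruct (approx_spec n 0) as (Hh & _ & Hc). destruct (coef_dom_all_nonneg _ _ _ Hc) as (P1 & P2 & P3).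
  apply Rle_lt_trans with (eps / 2); [|lra].
  apply (has_ps_diff_le (tc (approx_aux A n 0) u) (tc (g 0%nat) u) (x - u) _ _ _ (S n)).
  - apply (taylor _ u rho hrho Hh). now apply as_U_disk.
  - now apply g_ps.
  - intros m Hm. replace m with (S n + (m - S n))%nat by lia.
    eapply Rle_trans; [apply (psum_diff_le _ _ _ r (S n) _ Hxr P1 P2 P3)|].
    apply Rlt_le, HN. lia.
Qed.

Lemma rsum_le_G i n r : 0 <= r < rho -> rsum (Q i) n r <= G i r + Q i 0.
Proof.
  intros Hr. rewrite G_eq. replace (Re (g i (u + RtoC r)%C) - Q i 0 + Q i 0) with (Re (g i (u + RtoC r)%C)) by ring.
  apply (has_ps_rsum_le (tc (g i) u)); [lra | apply g_coef_nonneg | now apply g_ps_real].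
Qed.

Lemma approximations_proper : proper A.
Proof.
  intros n i Hi x Hx. unfold approx_at.
  destruct (approx_spec (n - S i) (S i)) as (Hh & Hu & Hc).
  destruct (coef_dom_all_nonneg _ _ _ Hc) as (P1 & P2 & _).
  now apply dominated_in_V.
Qed.

Lemma approximation_uniform_smaller_disk r : 0 < r < rho ->
  converges_uniformly_on (disk (as_u A) (Finite r)) (approximation A) (g 0%nat).
Proof.
  intros Hr. apply (approximation_uniform_of_bound r (G 0 r + Q 0 0)); [lra | |].
  - intros x Hx. unfold disk in Hx. simpl in Hx. fold u in Hx. split; [apply as_U_disk|]; lra.
  - intros n. apply rsum_le_G. lra.
Qed.

(** For t < rho the partial sums of the majorant are at most [R_tilde] plus the constant
    coefficient, and by continuity this bound persists at t = rho. *)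
Lemma approximation_uniform_whole_disk : is_finite (R_tilde A g rho 0) ->
  converges_uniformly_on (as_U A) (approximation A) (g 0%nat).
Proof.
  intros Hf. apply (approximation_uniform_of_bound rho (real (R_tilde A g rho 0) + Q 0 0)); [lra | |].
  - intros x Hx. split; [exact Hx|]. apply as_U_disk in Hx. lra.
  - intros n. apply rsum_bound_closure; [exact hrho|]. intros t Ht.
    pose proof (rsum_le_G 0 n t Ht). pose proof (G_le_R_tilde 0 t Ht) as L.
    rewrite <- Hf in L. simpl in L. lra.
Qed.

End NonNegativeSystem.

(* "Converges uniformly to g on U" is read in the function-theoretic sense
   (uniformly on every smaller concentric disk, i.e. on compact subsets of U):
   for f_i(x,y) = y, a_i = i!, U = B(0,1), V_i = C, g = 1/(1-x), where g^[n] is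
   the n-th Taylor polynomial, convergence is not uniform on all of U.  The last
   conjunct keeps uniform convergence on the whole of U whenever the limit
   R_tilde_0 is finite. *)
Theorem theorem5p12 (A : approx_system) (g : nat -> C -> C) (rho : R)
  (hAg : is_AS_for A g)
  (hnonneg : non_negative A)
  (hrho : 0 < rho)
  (hU : forall z : C, as_U A z <-> disk (as_u A) (Finite rho) z)
  (hV : forall i : nat, (1 <= i)%nat ->
     subset (disk (as_a A i) (R_tilde A g rho i)) (as_V A (i - 1))) :
  proper A /\
  is_AS_for A g /\
  (forall r : R, 0 < r < rho ->
     converges_uniformly_on (disk (as_u A) (Finite r)) (approximation A) (g 0%nat)) /\
  (is_finite (R_tilde A g rho 0) ->
     converges_uniformly_on (as_U A) (approximation A) (g 0%nat)).
Proof.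
  split; [exact (approximations_proper A g rho hAg hnonneg hrho hU hV)|].
  split; [exact hAg|]. split.
  - intros r Hr.
    exact (approximation_uniform_smaller_disk A g rho hAg hnonneg hrho hU hV r Hr).
  - exact (approximation_uniform_whole_disk A g rho hAg hnonneg hrho hU hV).
Qed.
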